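(* If $A$ and $B$ are inner quasidiagonal C*-algebras, then the minimal tensor product $A\otimes_{\min}B$ is inner quasidiagonal.
   Context: Inner quasidiagonal: a C*-algebra $A$ is inner quasidiagonal if for every $x_1,\dots,x_n\in A$ and $\epsilon>0$ there are a representation $\pi$ of $A$ on a Hilbert space $\mathcal{H}$ and a finite-rank projection $P\in\pi(A)''$ (the bicommutant of $\pi(A)$ in $\mathcal{L}(\mathcal{H})$) such that $\|P\pi(x_j)-\pi(x_j)P\|<\epsilon$ and $\|P\pi(x_j)P\|>\|x_j\|-\epsilon$ for $1\le j\le n$. The C*-algebras are not assumed separable. *)

(* Defs.v *)
From HB Require Import structures.
From mathcomp Require Import all_boot all_order all_algebra sesquilinear.
From mathcomp Require Import all_classical all_reals all_analysis.
From mathcomp Require Import complex.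

Set Implicit Arguments.
Unset Strict Implicit.
Unset Printing Implicit Defensive.

Import Order.TTheory GRing.Theory Num.Theory.
Import numFieldNormedType.Exports.

Local Open Scope classical_set_scope.
Local Open Scope ring_scope.

(* Not assumed unital, so the product is a bilinear map rather than a ring
   structure. *)
HB.mixin Record isCStarAlgebra (R : realType) A
    of CompleteNormedModule R[i] A := {
  cmul : {bilinear A -> A -> A};
  cmulA : associative cmul;
  cmul_norm_le : forall a b : A, `|cmul a b| <= `|a| * `|b|;
  star : A -> A;
  starK : involutive star;
  starD : {morph star : a b / a + b};
  starZ : forall (c : R[i]) (a : A), star (c *: a) = Num.conj c *: star a;
  starM : forall a b : A, star (cmul a b) = cmul (star b) (star a);
  cstar_identity : forall a : A, `|cmul (star a) a| = `|a| ^+ 2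
}.

#[short(type="cstarType")]
HB.structure Definition CStarAlgebra (R : realType) :=
  {A of isCStarAlgebra R A & CompleteNormedModule R[i] A}.

(* The inner product is linear in its first argument and conjugate-linear in
   the second. *)
HB.mixin Record isHilbertSpace (R : realType) H
    of CompleteNormedModule R[i] H := {
  inner : {dot H for (@Num.conj R[i])};
  inner_norm : forall x : H, inner x x = `|x| ^+ 2
}.

#[short(type="hilbertType")]
HB.structure Definition HilbertSpace (R : realType) :=
  {H of isHilbertSpace R H & CompleteNormedModule R[i] H}.

(* The library norm of a normed space over R[i] takes its values in R[i]. *)
Definition rnorm (R : realType) (V : normedModType R[i]) (x : V) : R :=
  complex.Re `|x|.

Definition bounded_operator (R : realType) (H : hilbertType R) : set (H -> H) :=
  [set T | linear T /\ continuous T].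

(* The operator norm when T is a bounded operator, a junk value otherwise. *)
Definition opnorm (R : realType) (H : hilbertType R) (T : H -> H) : R :=
  sup [set rnorm (T x) | x in [set x : H | `|x| <= 1]].

(* A *-homomorphism from A to L(H), not assumed nondegenerate or faithful. *)
Definition representation (R : realType) (A : cstarType R) (H : hilbertType R)
    (pi : A -> H -> H) : Prop :=
  [/\ forall a : A, bounded_operator (pi a),
      forall (c : R[i]) (a b : A), pi (c *: a + b) = c \*: pi a \+ pi b,
      forall a b : A, pi (cmul a b) = pi a \o pi b &
      forall (a : A) (x y : H), inner (pi (star a) x) y = inner x (pi a y)].

Definition commutant (R : realType) (H : hilbertType R) (S : set (H -> H)) :
    set (H -> H) :=
  [set T | bounded_operator T /\ forall U, S U -> T \o U = U \o T].

Definition bicommutant (R : realType) (H : hilbertType R) (S : set (H -> H)) :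
    set (H -> H) :=
  commutant (commutant S).

Definition projection (R : realType) (H : hilbertType R) (P : H -> H) : Prop :=
  [/\ bounded_operator P, P \o P = P &
      forall x y : H, inner (P x) y = inner x (P y)].

Definition finite_rank (R : realType) (H : hilbertType R) (T : H -> H) : Prop :=
  exists (n : nat) (v : 'I_n -> H),
    forall x, exists c : 'I_n -> R[i], T x = \sum_(i < n) c i *: v i.

Definition inner_quasidiagonal (R : realType) (A : cstarType R) : Prop :=
  forall (n : nat) (x : 'I_n -> A) (eps : R), 0 < eps ->
  exists (H : hilbertType R) (pi : A -> H -> H) (P : H -> H),
    [/\ representation pi,
        projection P /\ finite_rank P,
        bicommutant (range pi) P &
        forall j : 'I_n,
          opnorm ((P \o pi (x j)) \- (pi (x j) \o P)) < eps /\
          opnorm (P \o pi (x j) \o P) > rnorm (x j) - eps].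

(* A list s of pairs stands for the element of the algebraic tensor product
   that is the sum of the p.1 (x) p.2 for p in s; scalars can be absorbed in
   either factor. *)
Definition tensor_sum (R : realType) (U V W : lmodType R[i])
    (t : {bilinear U -> V -> W}) (s : seq (U * V)) : W :=
  \sum_(p <- s) t p.1 p.2.

(* (L, t) is the Hilbert space tensor product of H and K: the completion of
   the algebraic tensor product for the product inner product. *)
Definition hilbert_tensor (R : realType) (H K L : hilbertType R)
    (t : {bilinear H -> K -> L}) : Prop :=
  (forall (x x' : H) (y y' : K),
     inner (t x y) (t x' y') = inner x x' * inner y y') /\
  dense (range (tensor_sum t)).

(* S is the operator (pi (x) sigma)(s) on the Hilbert space tensor product. *)
Definition tensor_operator (R : realType) (A B : cstarType R)
    (H K L : hilbertType R) (t : {bilinear H -> K -> L})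
    (pi : A -> H -> H) (sigma : B -> K -> K) (s : seq (A * B))
    (S : L -> L) : Prop :=
  bounded_operator S /\
  forall (x : H) (y : K), S (t x y) = \sum_(p <- s) t (pi p.1 x) (sigma p.2 y).

(* The minimal (spatial) C*-norm on the algebraic tensor product: the supremum
   of the norms of (pi (x) sigma)(s) over all representations pi of A and
   sigma of B. *)
Definition min_norm (R : realType) (A B : cstarType R) (s : seq (A * B)) : R :=
  sup [set r : R |
    exists (H K L : hilbertType R) (t : {bilinear H -> K -> L})
           (pi : A -> H -> H) (sigma : B -> K -> K) (S : L -> L),
      [/\ hilbert_tensor t, representation pi, representation sigma,
          tensor_operator t pi sigma s S & r = opnorm S]].

(* (C, t) is the minimal tensor product of A and B: the completion of the
   algebraic tensor product *-algebra for the minimal C*-norm.  This determines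
   (C, t) up to a unique isomorphism. *)
Definition min_tensor_product (R : realType) (A B C : cstarType R)
    (t : {bilinear A -> B -> C}) : Prop :=
  [/\ forall (a a' : A) (b b' : B),
        cmul (t a b) (t a' b') = t (cmul a a') (cmul b b'),
      forall (a : A) (b : B), star (t a b) = t (star a) (star b),
      forall s : seq (A * B), rnorm (tensor_sum t s) = min_norm s &
      dense (range (tensor_sum t))].

(* Main.v *)
Require Import Defs.
From HB Require Import structures.
From mathcomp Require Import all_boot all_order all_algebra sesquilinear.
From mathcomp Require Import all_classical all_reals all_analysis.
From mathcomp Require Import complex.
From mathcomp Require Import ring lra.

(** Let P in pi(A)'' and Q in sigma(B)'' be finite-rank projections, with range in
   the essential subspaces, that nearly commute with given elements of A and B.
   Then P (x) Q has finite rank, nearly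
   commutes with given elements of the algebraic tensor product, and lies in the
   bicommutant of pi (x) sigma (bicommutant_tensor).  What has to be seen is that
   P and Q can be chosen so that the compression by P (x) Q also nearly attains
   the minimal norm of finitely many elements of the algebraic tensor product,
   although inner quasidiagonality speaks of the norms of elements of A and of B
   separately.

   The minimal norm of z is nearly attained at finite sums of elementary tensors,
   in some representation rho (x) tau (min_norm_gt).  Over an orthonormal family
   spanning the finitely many vectors of the second factor, the corresponding
   coefficient of z becomes a coefficient of a matrix X over A.  So rho may be
   replaced by a compression of A as soon as the compressions of A are norming on
   matrices over A (eventually_half_compress); then tau may be replaced by a
   compression of B in the same way, the compression of A now playing the part of
   the other factor.

   Norming on matrices follows from norming on elements
   (eventually_matrix_norming).  Compression by a nearly commuting P is nearly
   multiplicative, so that it nearly squares norms under X |-> X* X, as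
   representations do.  After l steps norms are raised to the power 2^l, and a
   strict loss of norm under compression would exceed the constant factor by which
   the norm of an m x m matrix can differ from the norms of its entries.

   Around this core, Hilbert spaces are produced by completing pre-Hilbert spaces
   of formal sums (prehilbert_completion, hilbert_tensor_exists); representations
   are shown to be contractive (rep_contractive), so that pi (x) sigma is bounded
   by the minimal norm and extends to the minimal tensor product
   (tensor_representation); and the projections are cut down to the essential
   subspaces (good_pair_exists), because T in the commutant of pi (x) sigma can be
   handled there through its slices, which lie in pi(A)' and in sigma(B)'. *)

Set Implicit Arguments.
Unset Strict Implicit.
Unset Printing Implicit Defensive.

Import Order.TTheory GRing.Theory Num.Theory.
Import numFieldNormedType.Exports.

Local Open Scope classical_set_scope.
Local Open Scope ring_scope.
Local Open Scope complex_scope.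

(** * Real-valued norms and moduli *)

Section Modulus.
Variable R : realType.
Implicit Types (c d : R[i]) (r : R).

Definition modulus c : R := complex.Re `|c|.

Lemma normE_modulus c : `|c| = (modulus c)%:C.
Proof. by rewrite /modulus normc_def. Qed.

Lemma modulus_ge0 c : 0 <= modulus c.
Proof. by rewrite -lecR -normE_modulus normr_ge0. Qed.

Lemma modulusM c d : modulus (c * d) = modulus c * modulus d.
Proof. by apply: complexI; rewrite rmorphM /= -!normE_modulus normrM. Qed.

Lemma modulusD c d : modulus (c + d) <= modulus c + modulus d.
Proof. by rewrite -lecR rmorphD /= -!normE_modulus ler_normD. Qed.

Lemma modulusN c : modulus (- c) = modulus c.
Proof. by rewrite /modulus normrN. Qed.

Lemma modulus0 : modulus 0 = 0.
Proof. by rewrite /modulus normr0. Qed.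

Lemma modulus_conj c : modulus (Num.conj c) = modulus c.
Proof. by rewrite /modulus norm_conjC. Qed.

Lemma modulus_eq0 c : (modulus c == 0) = (c == 0).
Proof. by rewrite -(inj_eq (@complexI R)) -normE_modulus normr_eq0. Qed.

Lemma modulus_real r : 0 <= r -> modulus r%:C = r.
Proof. by move=> r0; apply: complexI; rewrite -normE_modulus ger0_norm ?ler0c. Qed.

Lemma conjE c : Num.conj c = complex.Re c -i* complex.Im c.
Proof. by case: c. Qed.

Lemma conj_real r : Num.conj r%:C = r%:C.
Proof. by rewrite conjE /= oppr0. Qed.

Lemma mul_conj c : c * Num.conj c = (modulus c ^+ 2)%:C.
Proof. by rewrite -normCK normE_modulus rmorphXn. Qed.

Lemma Re_le_modulus c : complex.Re c <= modulus c.
Proof.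
apply: le_trans (ler_norm _) _.
by rewrite -lecR -normE_modulus normc_ge_Re.
Qed.

Lemma ReM_real r c : complex.Re (r%:C * c) = r * complex.Re c.
Proof. by case: c => a b /=; rewrite mul0r subr0. Qed.

Lemma ReD c d : complex.Re (c + d) = complex.Re c + complex.Re d.
Proof. by case: c d => [a b] [a' b']. Qed.

Lemma ReN c : complex.Re (- c) = - complex.Re c.
Proof. by case: c. Qed.

Lemma Re_conjugate c : complex.Re (Num.conj c) = complex.Re c.
Proof. by rewrite conjE. Qed.

Lemma Re_sum (I : Type) (s : seq I) (f : I -> R[i]) :
  complex.Re (\sum_(i <- s) f i) = \sum_(i <- s) complex.Re (f i).
Proof. by elim: s => [|a s IH]; rewrite ?big_nil // !big_cons ReD IH. Qed.

Lemma modulus_sum (I : Type) (s : seq I) (f : I -> R[i]) :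
  modulus (\sum_(i <- s) f i) <= \sum_(i <- s) modulus (f i).
Proof.
elim: s => [|a s IH]; first by rewrite !big_nil modulus0.
by rewrite !big_cons (le_trans (modulusD _ _)) // lerD2l.
Qed.

Lemma rotate c : exists2 d, modulus d = 1 & d * c = (modulus c)%:C.
Proof.
have [->|c0] := eqVneq c 0.
  exists 1; first by rewrite -[1]/(1%:C) modulus_real.
  by rewrite mulr0 modulus0.
have m0 : modulus c != 0 by rewrite modulus_eq0.
exists (Num.conj c / (modulus c)%:C).
  by rewrite modulusM modulus_conj -fmorphV modulus_real ?invr_ge0 ?modulus_ge0 // divff.
rewrite mulrAC [_ * c]mulrC mul_conj -fmorphV -rmorphM /= expr2 -mulrA divff ?mulr1 //.
Qed.

End Modulus.

Section RealNorm.
Variables (R : realType) (V : normedModType R[i]).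
Implicit Types (x y : V) (c : R[i]).

Lemma normE_rnorm x : `|x| = (rnorm x)%:C.
Proof.
have : 0 <= `|x| by [].
by rewrite /rnorm; case: `|x| => a b; rewrite lecE /= => /andP[/eqP -> _].
Qed.

Lemma rnorm_ge0 x : 0 <= rnorm x.
Proof. by rewrite -lecR -normE_rnorm normr_ge0. Qed.

Lemma rnormD x y : rnorm (x + y) <= rnorm x + rnorm y.
Proof. by rewrite -lecR rmorphD /= -!normE_rnorm ler_normD. Qed.

Lemma rnormN x : rnorm (- x) = rnorm x.
Proof. by rewrite /rnorm normrN. Qed.

Lemma rnorm0 : rnorm (0 : V) = 0.
Proof. by rewrite /rnorm normr0. Qed.

Lemma rnorm_eq0 x : (rnorm x == 0) = (x == 0).
Proof. by rewrite -(inj_eq (@complexI R)) -normE_rnorm normr_eq0. Qed.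

Lemma rnormZ c x : rnorm (c *: x) = modulus c * rnorm x.
Proof.
by apply: complexI; rewrite rmorphM /= -normE_modulus -!normE_rnorm normrZ.
Qed.

Lemma rnorm_le1 x : (`|x| <= 1) = (rnorm x <= 1).
Proof. by rewrite normE_rnorm -[1]/(1%:C) lecR. Qed.

Lemma rnorm_distC x y : rnorm (x - y) = rnorm (y - x).
Proof. by rewrite -rnormN opprB. Qed.

Lemma rnorm_triangle z x y : rnorm (x - y) <= rnorm (x - z) + rnorm (z - y).
Proof. by rewrite -[x - y](subrKA z) rnormD. Qed.

Lemma rnorm_sum (I : Type) (s : seq I) (f : I -> V) :
  rnorm (\sum_(i <- s) f i) <= \sum_(i <- s) rnorm (f i).
Proof.
elim: s => [|a s IH]; first by rewrite !big_nil rnorm0.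
by rewrite !big_cons (le_trans (rnormD _ _)) // lerD2l.
Qed.

Lemma rnorm_diff_le x y : rnorm x <= rnorm y + rnorm (x - y).
Proof. by rewrite -[x in rnorm x](subrK y) addrC rnormD. Qed.

Lemma eq_rnorm_small x y : (forall e : R, 0 < e -> rnorm (x - y) <= e) -> x = y.
Proof.
move=> h; apply/eqP; rewrite -subr_eq0 -rnorm_eq0 eq_le rnorm_ge0 andbT.
by apply/ler_addgt0Pr => e /h; rewrite add0r.
Qed.

Lemma nbhs_rnormP (x : V) (A : set V) :
  nbhs x A <-> exists2 e : R, 0 < e & forall y, rnorm (x - y) < e -> A y.
Proof.
split=> [/nbhs_ballP[e /= e0 eA]|[e e0 eA]].
- have eE : e = (complex.Re e)%:C.
    by move: e0; case: (e) => a b; rewrite ltcE /= => /andP[/eqP -> _].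
  exists (complex.Re e); first by rewrite eE -[0]/(0%:C) ltcR in e0.
  by move=> y xy; apply: eA; rewrite -ball_normE /ball_ /= eE normE_rnorm ltcR.
- apply/nbhs_ballP; exists e%:C; first by rewrite /= -[0]/(0%:C) ltcR.
  by move=> y; rewrite -ball_normE /ball_ /= normE_rnorm ltcR => /eA.
Qed.

Lemma dense_rnormP (A : set V) :
  dense A <-> forall x (e : R), 0 < e -> exists2 y, A y & rnorm (x - y) < e.
Proof.
split=> [dA x e e0|h].
  have [||y] := dA [set y | rnorm (x - y) < e]^°.
  - exists x; apply/nbhs_rnormP; exists e => //.
  - exact: open_interior.
  - by move=> [/interior_subset xy Ay]; exists y.
move=> O [x Ox] oO.
have /nbhs_rnormP [e e0 eO] : nbhs x O by apply: open_nbhs_nbhs.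
by have [y Ay xy] := h x e e0; exists y; split => //; apply: eO.
Qed.

End RealNorm.

(** * Cauchy sequences and Lipschitz maps *)

Section CauchySeq.
Variable R : realType.

Definition cauchy_seq (V : normedModType R[i]) (u : nat -> V) :=
  forall e : R, 0 < e -> exists N, forall m n, (N <= m)%N -> (N <= n)%N ->
    rnorm (u m - u n) < e.

Definition limit_seq (V : normedModType R[i]) (u : nat -> V) (l : V) :=
  forall e : R, 0 < e -> exists N, forall n, (N <= n)%N -> rnorm (l - u n) < e.

Lemma cauchy_seq_cvg (V : completeNormedModType R[i]) (u : nat -> V) :
  cauchy_seq u -> exists l, limit_seq u l.
Proof.
move=> cu.
have : cvg (u @ \oo).
  apply: cauchy_cvg; apply: cauchy_exP => e e0.
  have eE : e = (complex.Re e)%:C.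
    by move: e0; case: (e) => a b; rewrite ltcE /= => /andP[/eqP -> _].
  have e0' : 0 < complex.Re e by rewrite eE -[0]/(0%:C) ltcR in e0.
  have [N hN] := cu _ e0'.
  exists (u N); exists N => // n /= Nn.
  by rewrite -ball_normE /ball_ /= eE normE_rnorm ltcR; apply: hN.
move=> /cvg_ex[l ul]; exists l => e e0.
have /ul [N _ hN] : nbhs l [set y | rnorm (l - y) < e].
  by apply/nbhs_rnormP; exists e.
by exists N => n /hN.
Qed.

Lemma inv_nat_small (e : R) : 0 < e -> exists N, forall n, (N <= n)%N -> n.+1%:R^-1 < e.
Proof.
move=> e0; have [N] := @ltr_add_invr R 0 e e0.
rewrite add0r => hN; exists N => n Nn; apply: le_lt_trans hN.
by rewrite lef_pV2 ?posrE // ler_nat.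
Qed.

Lemma cauchy_seq_rate (V : normedModType R[i]) (u : nat -> V) (M : R) :
  (forall m n, rnorm (u m - u n) <= M * (m.+1%:R^-1 + n.+1%:R^-1)) -> cauchy_seq u.
Proof.
move=> h e e0.
have M1 : 0 < `|M| + 1 by rewrite ltr_wpDl.
have [|N hN] := @inv_nat_small (e / (2 * (`|M| + 1))).
  by rewrite divr_gt0 // mulr_gt0.
exists N => m n /hN hm /hN hn; apply: le_lt_trans (h m n) _.
apply: (@le_lt_trans _ _ ((`|M| + 1) * (m.+1%:R^-1 + n.+1%:R^-1))).
  by rewrite ler_wpM2r ?addr_ge0 ?invr_ge0 // (le_trans (ler_norm _)) // lerDl.
rewrite -ltr_pdivlMl //; apply: lt_le_trans (ltrD hm hn) _.
rewrite le_eqVlt; apply/orP; left; apply/eqP.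
by field; rewrite gt_eqF //=.
Qed.

End CauchySeq.

Section Lipschitz.
Variable R : realType.

Definition lipschitz_map (V W : normedModType R[i]) (f : V -> W) :=
  exists2 M : R, 0 <= M & forall x y, rnorm (f x - f y) <= M * rnorm (x - y).

Lemma lipschitz_eq_dense (V W : normedModType R[i]) (I : Type) (iota : I -> V)
    (f g : V -> W) : dense (range iota) -> lipschitz_map f -> lipschitz_map g ->
  (forall i, f (iota i) = g (iota i)) -> forall x, f x = g x.
Proof.
move=> /dense_rnormP dI [M M0 fM] [N N0 gN] fg x; apply: eq_rnorm_small => e e0.
have MN : 0 < M + N + 1 by rewrite ltr_wpDl // addr_ge0.
have [_ [i _ <-] xi] := dI x (e / (M + N + 1)) (divr_gt0 e0 MN).
apply: le_trans (rnorm_triangle (f (iota i)) _ _) _.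
have h1 := fM x (iota i); have h2 := gN x (iota i).
rewrite {2}fg [rnorm (g _ - _)]rnorm_distC.
move: xi; rewrite ltr_pdivlMr // => xi.
have := rnorm_ge0 (x - iota i); nra.
Qed.

(** Approximations of x by the dense image are sent to Cauchy sequences.
   Operators and representations on completed tensor products are all obtained
   from this extension. *)
Lemma lipschitz_extend (V : normedModType R[i]) (W : completeNormedModType R[i])
    (I : Type) (iota : I -> V) (f : I -> W) (M : R) :
  dense (range iota) -> 0 <= M ->
  (forall i j, rnorm (f i - f j) <= M * rnorm (iota i - iota j)) ->
  exists2 g : V -> W, (forall i, g (iota i) = f i) &
    forall x y, rnorm (g x - g y) <= M * rnorm (x - y).
Proof.
move=> /dense_rnormP dI M0 fM.
have ex x : exists l, forall e : R, 0 < e ->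
    exists2 i, rnorm (x - iota i) < e & rnorm (l - f i) < e.
  have near n : exists i, rnorm (x - iota i) < n.+1%:R^-1.
    have [|_ [i _ <-] xi] := dI x n.+1%:R^-1; first by rewrite invr_gt0.
    by exists i.
  have [u xu] := choice near.
  have [|l ul] := @cauchy_seq_cvg R W (f \o u).
    apply: (@cauchy_seq_rate R W _ M) => m n /=; apply: le_trans (fM _ _) _.
    rewrite ler_wpM2l // (le_trans (rnorm_triangle x _ _)) //.
    by rewrite rnorm_distC; apply: lerD; exact: ltW (xu _).
  exists l => e e0; have [N1 h1] := ul e e0; have [N2 h2] := inv_nat_small e0.
  exists (u (maxn N1 N2)); last by apply: h1; rewrite leq_maxl.
  by apply: lt_trans (xu _) _; apply: h2; rewrite leq_maxr.
have [g gP] := choice ex.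
have gM x y : rnorm (g x - g y) <= M * rnorm (x - y).
  apply/ler_addgt0Pr => e e0.
  have d0 : 0 < e / (2 + 2 * M) by rewrite divr_gt0 // ltr_wpDr // mulr_ge0.
  have [i xi gi] := gP x _ d0; have [j yj gj] := gP y _ d0.
  have t1 := rnorm_triangle (f i) (g x) (g y).
  have t2 := rnorm_triangle (f j) (f i) (g y); rewrite [rnorm (f j - _)]rnorm_distC in t2.
  have t3 := fM i j.
  have t4 := rnorm_triangle x (iota i) (iota j); rewrite [rnorm (iota i - x)]rnorm_distC in t4.
  have t5 := rnorm_triangle y x (iota j).
  have dE : e = e / (2 + 2 * M) * (2 + 2 * M) by rewrite mulfVK // gt_eqF // ltr_wpDr // mulr_ge0.
  move: d0 xi gi yj gj dE; set d := e / _ => d0 xi gi yj gj dE; nra.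
exists g => // i; apply: eq_rnorm_small => e e0.
have M1 : 0 < 1 + M by rewrite ltr_wpDr.
have [j ij gj] := gP (iota i) _ (divr_gt0 e0 M1).
have t1 := rnorm_triangle (f j) (g (iota i)) (f i).
have t2 := fM j i; rewrite [rnorm (iota j - _)]rnorm_distC in t2.
have dE : e = e / (1 + M) * (1 + M) by rewrite mulfVK // gt_eqF.
move: ij gj dE; set d := e / _ => ij gj dE; nra.
Qed.

End Lipschitz.

(** * Pre-Hilbert spaces and their completion *)

(** The operations only have to be compatible with the form, so that formal
   sums, that is, sequences with concatenation, make up such a structure without
   passing to a quotient. *)
Record prehilbert (R : realType) := PreHilbert {
  pcar :> Type;
  pelt : pcar;
  padd : pcar -> pcar -> pcar;
  pscale : R[i] -> pcar -> pcar;
  pform : pcar -> pcar -> R[i];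
  pformD : forall i j k, pform (padd i j) k = pform i k + pform j k;
  pformZ : forall c i k, pform (pscale c i) k = c * pform i k;
  pform_conj : forall i j, pform j i = Num.conj (pform i j);
  pform_ge0 : forall i, 0 <= pform i i
}.

Section PreHilbert.
Variables (R : realType) (I : prehilbert R).
Implicit Types (i j : I) (c : R[i]).

Definition pnorm2 i : R := complex.Re (pform i i).
Definition pnorm i : R := Num.sqrt (pnorm2 i).

Lemma pformE i : pform i i = (pnorm2 i)%:C.
Proof.
have := pform_ge0 i; rewrite /pnorm2; case: (pform i i) => a b.
by rewrite lecE /= => /andP[/eqP -> _].
Qed.

Lemma pnorm2_ge0 i : 0 <= pnorm2 i.
Proof. by have := pform_ge0 i; rewrite pformE ler0c. Qed.

Lemma pnorm_ge0 i : 0 <= pnorm i. Proof. exact: sqrtr_ge0. Qed.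

Lemma pnormK i : pnorm i ^+ 2 = pnorm2 i.
Proof. by rewrite sqr_sqrtr // pnorm2_ge0. Qed.

Lemma pformDr i j k : pform k (padd i j) = pform k i + pform k j.
Proof. by rewrite pform_conj pformD rmorphD /= -!pform_conj. Qed.

Lemma pformZr c i k : pform k (pscale c i) = Num.conj c * pform k i.
Proof. by rewrite pform_conj pformZ rmorphM /= -pform_conj. Qed.

Lemma pnorm2D i j : pnorm2 (padd i j) =
  pnorm2 i + 2 * complex.Re (pform i j) + pnorm2 j.
Proof.
rewrite /pnorm2 pformD !pformDr !ReD [pform j i]pform_conj Re_conjugate; ring.
Qed.

Lemma pnorm2Z c i : pnorm2 (pscale c i) = modulus c ^+ 2 * pnorm2 i.
Proof. by rewrite /pnorm2 pformZ pformZr mulrA mul_conj ReM_real. Qed.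

Lemma pnormZ c i : pnorm (pscale c i) = modulus c * pnorm i.
Proof.
by rewrite /pnorm pnorm2Z sqrtrM ?sqr_ge0 // sqrtr_sqr ger0_norm ?modulus_ge0.
Qed.

End PreHilbert.

Lemma le_of_sqr (R : realType) (a b : R) : 0 <= b -> a ^+ 2 <= b ^+ 2 -> a <= b.
Proof. by move=> b0 h; rewrite leNgt; apply/negP => ba; nra. Qed.

Lemma discriminant_le (R : realType) (a b c : R) : 0 <= a -> 0 <= c ->
  (forall t, 0 <= a - 2 * t * b + t ^+ 2 * c) -> b ^+ 2 <= a * c.
Proof.
move=> a0; rewrite le_eqVlt => /orP[/eqP <-|c0] h.
  rewrite mulr0; have [->|b0] := eqVneq b 0; first by rewrite expr0n.
  have := h ((a + 1) / (2 * b)).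
  have -> : 2 * ((a + 1) / (2 * b)) * b = a + 1 by field.
  by rewrite mulr0; lra.
have := h (b / c).
have -> : a - 2 * (b / c) * b + (b / c) ^+ 2 * c = (a * c - b ^+ 2) / c.
  by field; rewrite gt_eqF.
by rewrite pmulr_lge0 ?invr_gt0 // subr_ge0.
Qed.

Section PreHilbertTheory.
Variables (R : realType) (I : prehilbert R).
Implicit Types (i j : I).

Lemma pform_cauchy_schwarz i j : modulus (pform i j) <= pnorm i * pnorm j.
Proof.
apply: le_of_sqr; first by rewrite mulr_ge0 ?pnorm_ge0.
rewrite exprMn !pnormK.
(* The square of the norm of i - t d^* j is nonnegative for all real t, where
   d rotates the form of i and j onto its modulus. *)
apply: discriminant_le; rewrite ?pnorm2_ge0 // => t.
have [d d1 dE] := rotate (pform i j).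
have := pnorm2_ge0 (padd i (pscale (- t%:C * Num.conj d) j)).
rewrite pnorm2D pnorm2Z pformZr rmorphM /= conjCK rmorphN /= conj_real.
rewrite -mulrA dE -rmorphN -rmorphM /= modulusM modulus_conj d1 mulr1.
have -> : modulus (- t)%:C ^+ 2 = t ^+ 2.
  apply: complexI; rewrite -mul_conj conj_real -rmorphM /=; congr (_ %:C); ring.
by congr (0 <= _); ring.
Qed.

(** Near-minimizers of |i|^2 - 2 Re (f i) nearly represent f.  This variational
   argument gives both the density of a pre-Hilbert space in its completion and,
   later on, orthogonal projections. *)
Lemma near_representation (f : I -> R[i]) (M : R) :
  (forall i j, f (padd i j) = f i + f j) ->
  (forall c i, f (pscale c i) = Num.conj c * f i) ->
  (forall i, modulus (f i) <= M * pnorm i) ->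
  forall e : R, 0 < e -> exists i, forall j,
    modulus (f j - pform i j) <= e * pnorm j.
Proof.
move=> fD fZ fM e e0.
pose J i := pnorm2 i - 2 * complex.Re (f i).
have Jlb i : - M ^+ 2 <= J i.
  have := le_trans (Re_le_modulus (f i)) (fM i).
  rewrite /J -pnormK => h; have := sqr_ge0 (pnorm i - M); nra.
have Jinf : has_inf (range J).
  by split; [exists (J (pelt I)), (pelt I)|exists (- M ^+ 2) => _ [i _ <-]].
have [_ [i _ <-] Ji] := inf_adherent (exprn_gt0 2 e0) Jinf.
(* Moving from i by z j cannot lower the infimum by more than e^2; z is chosen
   of modulus |t| with the phase that makes the linear term t |g|. *)
exists i => j; set g := f j - pform i j.
apply: le_of_sqr; first by rewrite mulr_ge0 ?pnorm_ge0 ?ltW.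
rewrite exprMn pnormK.
apply: discriminant_le; rewrite ?sqr_ge0 ?pnorm2_ge0 // => t.
have [d d1 dE] := rotate g.
pose z := t%:C * Num.conj d.
have Jz : inf (range J) <= J (padd i (pscale z j)).
  by apply: ge_inf; [case: Jinf|exists (padd i (pscale z j))].
have zg : complex.Re (Num.conj z * g) = t * modulus g.
  by rewrite /z rmorphM /= conjCK conj_real -mulrA dE ReM_real.
have z2 : modulus z ^+ 2 = t ^+ 2.
  apply: complexI; rewrite /z modulusM modulus_conj d1 mulr1.
  by rewrite -mul_conj conj_real -rmorphM /= expr2.
move: zg; rewrite /g mulrBr ReD ReN => zg.
move: Jz Ji; rewrite /J pnorm2D pnorm2Z pformZr fD fZ z2 ReD.
by move=> *; lra.
Qed.

End PreHilbertTheory.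

Section CompletionType.
Variables (R : realType) (I : prehilbert R).

Definition bounded_antilinear : {pred I -> R[i]} := fun f => `[<
  [/\ forall i j, f (padd i j) = f i + f j,
      forall c i, f (pscale c i) = Num.conj c * f i &
      exists M, forall i, modulus (f i) <= M * pnorm i] >].

Lemma bounded_antilinear_submod : submod_closed bounded_antilinear.
Proof.
split.
  apply/asboolP; split=> [i j|c i|]; rewrite ?addr0 ?mulr0 //.
  by exists 0 => i; rewrite mul0r modulus0.
move=> c f g /asboolP[fD fZ [M fM]] /asboolP[gD gZ [N gN]]; apply/asboolP.
split=> [i j|d i|].
- by rewrite !fctE /= fD gD scalerDr addrACA.
- by rewrite !fctE /= fZ gZ /GRing.scale /= mulrDr mulrCA.
exists (modulus c * M + N) => i; rewrite !fctE /=.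
apply: le_trans (modulusD _ _) _; rewrite mulrDl lerD // /GRing.scale /= modulusM.
by rewrite -mulrA ler_wpM2l // modulus_ge0.
Qed.

HB.instance Definition _ :=
  GRing.isSubmodClosed.Build R[i] (I -> R[i]) bounded_antilinear
    bounded_antilinear_submod.

(** The completion is realized as the space of bounded conjugate-linear
   functionals: linear structure and limits are then computed pointwise. *)
Record completion := Completion {
  cfun : I -> R[i];
  cfun_in : cfun \in bounded_antilinear
}.

HB.instance Definition _ := [isSub for cfun].
HB.instance Definition _ := [Choice of completion by <:].
HB.instance Definition _ := [SubChoice_isSubLmodule of completion by <:].

Implicit Types (f g : completion) (i j : I).

Lemma cfun_padd f i j : cfun f (padd i j) = cfun f i + cfun f j.
Proof. by have /asboolP[] := cfun_in f. Qed.

Lemma cfun_pscale f c i : cfun f (pscale c i) = Num.conj c * cfun f i.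
Proof. by have /asboolP[] := cfun_in f. Qed.

Lemma cfunD f g i : cfun (f + g) i = cfun f i + cfun g i. Proof. by []. Qed.
Lemma cfunB f g i : cfun (f - g) i = cfun f i - cfun g i. Proof. by []. Qed.
Lemma cfunZ c f i : cfun (c *: f) i = c * cfun f i. Proof. by []. Qed.

Lemma cfun_inj f g : (forall i, cfun f i = cfun g i) -> f = g.
Proof. by move=> h; apply: val_inj; apply/funext. Qed.

Definition cnorm f : R := sup [set modulus (cfun f i) | i in [set i | pnorm i <= 1]].

Lemma cnorm_has_sup f : has_sup [set modulus (cfun f i) | i in [set i | pnorm i <= 1]].
Proof.
split.
  exists (modulus (cfun f (pscale 0 (pelt I)))), (pscale 0 (pelt I)) => //=.
  by rewrite pnormZ modulus0 mul0r ler01.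
have /asboolP[_ _ [M fM]] := cfun_in f; exists `|M| => _ [i /= i1 <-].
apply: le_trans (fM i) _; apply: le_trans (ler_wpM2r (pnorm_ge0 i) (ler_norm M)) _.
by rewrite ler_piMr.
Qed.

Lemma cnorm_ge0 f : 0 <= cnorm f.
Proof.
apply: le_trans (modulus_ge0 (cfun f (pscale 0 (pelt I)))) _.
apply: sup_upper_bound; first exact: cnorm_has_sup.
by exists (pscale 0 (pelt I)) => //=; rewrite pnormZ modulus0 mul0r ler01.
Qed.

Lemma cfun_le f i : modulus (cfun f i) <= cnorm f * pnorm i.
Proof.
have [i0|i0] := eqVneq (pnorm i) 0.
  have /asboolP[_ _ [M fM]] := cfun_in f.
  by have := fM i; rewrite i0 !mulr0.
have ip : 0 < pnorm i by rewrite lt_neqAle eq_sym i0 pnorm_ge0.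
rewrite -ler_pdivrMr //.
pose c : R[i] := (pnorm i)^-1%:C.
have cE : modulus c = (pnorm i)^-1 by rewrite modulus_real // invr_ge0 ltW.
suff : modulus (cfun f (pscale c i)) <= cnorm f.
  by rewrite cfun_pscale modulusM modulus_conj cE mulrC.
apply: sup_upper_bound; first exact: cnorm_has_sup.
by exists (pscale c i) => //=; rewrite pnormZ cE mulVf.
Qed.

Lemma cnorm_le f M : 0 <= M -> (forall i, modulus (cfun f i) <= M * pnorm i) ->
  cnorm f <= M.
Proof.
move=> M0 fM; apply: ge_sup; first by case: (cnorm_has_sup f).
move=> _ [i /= i1 <-]; apply: le_trans (fM i) _; rewrite ler_piMr //.
Qed.

Definition cnormC f : R[i] := (cnorm f)%:C.

Lemma cnormC_triangle f g : cnormC (f + g) <= cnormC f + cnormC g.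
Proof.
rewrite /cnormC -rmorphD lecR; apply: cnorm_le => [|i].
  by rewrite addr_ge0 // cnorm_ge0.
by rewrite cfunD mulrDl (le_trans (modulusD _ _)) // lerD // cfun_le.
Qed.

Lemma cnormC_scale c f : cnormC (c *: f) = `|c| * cnormC f.
Proof.
rewrite /cnormC normE_modulus -rmorphM; congr (_ %:C); apply/eqP; rewrite eq_le.
apply/andP; split.
  apply: cnorm_le => [|i]; first by rewrite mulr_ge0 ?modulus_ge0 ?cnorm_ge0.
  by rewrite cfunZ modulusM -mulrA ler_wpM2l ?modulus_ge0 ?cfun_le.
have [->|c0] := eqVneq c 0; first by rewrite modulus0 mul0r cnorm_ge0.
have cp : 0 < modulus c by rewrite lt_neqAle eq_sym modulus_eq0 c0 modulus_ge0.
rewrite mulrC -ler_pdivlMr //; apply: cnorm_le => [|i].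
  by rewrite divr_ge0 ?cnorm_ge0 // ltW.
rewrite mulrAC ler_pdivlMr // mulrC -modulusM -cfunZ; exact: cfun_le.
Qed.

Lemma cnormC_eq0 f : cnormC f = 0 -> f = 0.
Proof.
move=> /(congr1 (@complex.Re R)) /= f0; apply: cfun_inj => i; apply/eqP.
by rewrite -modulus_eq0 eq_le modulus_ge0 andbT (le_trans (cfun_le f i)) // f0 mul0r.
Qed.

HB.instance Definition _ := Lmodule_isNormed.Build R[i] completion
  cnormC_triangle cnormC_scale cnormC_eq0.

Lemma rnorm_cnorm f : rnorm f = cnorm f. Proof. by []. Qed.

End CompletionType.

Section SequentialCompleteness.
Variable R : realType.

Lemma real_cauchy_cvg (u : nat -> R) :
  (forall e, 0 < e -> exists N, forall m n, (N <= m)%N -> (N <= n)%N ->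
     `|u m - u n| < e) ->
  exists l, forall e, 0 < e -> exists N, forall n, (N <= n)%N -> `|l - u n| < e.
Proof.
move=> cu.
have : cvg (u @ \oo).
  apply: cauchy_cvg; apply: cauchy_exP => e e0.
  have [N hN] := cu _ e0; exists (u N); exists N => // n /= Nn.
  by rewrite -ball_normE /ball_ /=; apply: hN.
move=> /cvg_ex[l ul]; exists l => e e0.
have /ul [N _ hN] : nbhs l [set y | `|l - y| < e].
  by apply/nbhs_ballP; exists e => // y; rewrite -ball_normE.
by exists N => n /hN.
Qed.

Lemma ReIm_le_modulus (c : R[i]) :
  `|complex.Re c| <= modulus c /\ `|complex.Im c| <= modulus c.
Proof.
have h (d : R[i]) : `|complex.Re d| <= modulus d.
  by rewrite ler_norml Re_le_modulus andbT lerNl -ReN -modulusN Re_le_modulus.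
split=> //; have := h ((0 +i* 1) * c); rewrite modulusM.
have -> : modulus (0 +i* 1) = 1 :> R.
  by rewrite /modulus normc_def /= expr0n expr1n /= add0r sqrtr1.
by rewrite mul1r; case: c => a b /=; rewrite mul0r mul1r sub0r normrN.
Qed.

Lemma modulus_le_ReIm (c : R[i]) :
  modulus c <= `|complex.Re c| + `|complex.Im c|.
Proof.
case: c => a b /=; have -> : a +i* b = a%:C + (0 +i* 1) * b%:C.
  by apply/eqP; rewrite eq_complex /=; apply/andP; split; apply/eqP; ring.
apply: le_trans (modulusD _ _) _.
have -> : modulus ((0 +i* 1) * b%:C) = `|b|.
  rewrite modulusM /modulus !normc_def /= !expr0n expr1n /= addr0 add0r.
  by rewrite sqrtr1 mul1r sqrtr_sqr.
by rewrite lerD2r /modulus normc_def /= expr0n /= addr0 sqrtr_sqr.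
Qed.

Lemma complex_cauchy_cvg (u : nat -> R[i]) :
  (forall e, 0 < e -> exists N, forall m n, (N <= m)%N -> (N <= n)%N ->
     modulus (u m - u n) < e) ->
  exists l, forall e, 0 < e -> exists N, forall n, (N <= n)%N ->
    modulus (l - u n) < e.
Proof.
move=> cu.
have [|a ha] := @real_cauchy_cvg (fun n => complex.Re (u n)).
  move=> e /cu[N hN]; exists N => m n Nm Nn; apply: le_lt_trans (hN m n Nm Nn).
  by rewrite -ReN -ReD; case: (ReIm_le_modulus (u m - u n)).
have [|b hb] := @real_cauchy_cvg (fun n => complex.Im (u n)).
  move=> e /cu[N hN]; exists N => m n Nm Nn; apply: le_lt_trans (hN m n Nm Nn).
  have := (ReIm_le_modulus (u m - u n)).2.
  by case: (u m) => ? ?; case: (u n).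
exists (a +i* b) => e e0.
have e2 : 0 < e / 2 by rewrite divr_gt0.
have [N1 h1] := ha _ e2; have [N2 h2] := hb _ e2.
exists (maxn N1 N2) => n; rewrite geq_max => /andP[/h1 n1 /h2 n2].
apply: le_lt_trans (modulus_le_ReIm _) _.
rewrite [e]splitr; move: n1 n2; case: (u n) => c d /=; exact: ltrD.
Qed.

(** Completeness is a statement about filters; with balls of radius 1/(n+1)
   a Cauchy filter is controlled by one sequence with that rate. *)
Lemma complete_of_rate (V : normedModType R[i]) :
  (forall u : nat -> V,
     (forall m n, rnorm (u m - u n) <= m.+1%:R^-1 + n.+1%:R^-1) ->
     exists l, forall n, rnorm (l - u n) <= n.+1%:R^-1) ->
  forall F : set_system V, ProperFilter F -> cauchy F -> cvg F.
Proof.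
move=> h F FF /(@cauchyP R[i] V) Fc.
have near n : exists x : V, F [set y | rnorm (x - y) < n.+1%:R^-1].
  have [|x Fx] := Fc (n.+1%:R^-1)%:C.
    by rewrite -[0]/(0%:C) ltcR invr_gt0.
  exists x; apply: filterS Fx => y.
  by rewrite -ball_normE /ball_ /= normE_rnorm ltcR.
have [u uF] := choice near.
have [|l lu] := h u.
  move=> m n; have /filter_ex[y [/= my ny]] : F ([set y | rnorm (u m - y) < m.+1%:R^-1] `&`
      [set y | rnorm (u n - y) < n.+1%:R^-1]) by exact: filterI.
  apply: le_trans (rnorm_triangle y _ _) _.
  by rewrite [rnorm (y - _)]rnorm_distC; apply: lerD; apply: ltW.
apply/cvg_ex; exists l => A /nbhs_rnormP[e e0 eA].
have [|N hN] := @inv_nat_small R (e / 2); first by rewrite divr_gt0.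
apply: filterS (uF N) => y /= Ny; apply: eA.
have := rnorm_triangle (u N) l y; have := lu N; have := hN N (leqnn N).
by move: Ny; set r := N.+1%:R^-1; lra.
Qed.

End SequentialCompleteness.

Section CompletionHilbert.
Variables (R : realType) (I : prehilbert R).
Implicit Types (f g : completion I) (i j : I).

Lemma completion_complete (F : set_system (completion I)) :
  ProperFilter F -> cauchy F -> cvg F.
Proof.
apply: complete_of_rate => u uc.
have ule m n i : modulus (cfun (u m) i - cfun (u n) i) <=
    (m.+1%:R^-1 + n.+1%:R^-1) * pnorm i.
  rewrite -cfunB; apply: le_trans (cfun_le _ _) _.
  by rewrite ler_wpM2r ?pnorm_ge0 // -rnorm_cnorm.
have cv i : exists l, forall n, modulus (l - cfun (u n) i) <= n.+1%:R^-1 * pnorm i.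
  have [|l ul] := @complex_cauchy_cvg R (fun n => cfun (u n) i).
    move=> e e0; have p1 : 0 < pnorm i + 1 by rewrite ltr_wpDl ?pnorm_ge0.
    have [|N hN] := @inv_nat_small R (e / (2 * (pnorm i + 1))).
      by rewrite divr_gt0 // mulr_gt0.
    exists N => m n /hN hm /hN hn; apply: le_lt_trans (ule m n i) _.
    have dE : e = e / (2 * (pnorm i + 1)) * (2 * (pnorm i + 1)).
      by rewrite mulfVK // gt_eqF // mulr_gt0.
    have d0 : 0 < e / (2 * (pnorm i + 1)) by rewrite divr_gt0 // mulr_gt0.
    rewrite [ltRHS]dE; move: d0 hm hn; set d := e / _ => d0 hm hn.
    apply: (@le_lt_trans _ _ (d * 2 * pnorm i)); last by nra.
    by rewrite ler_wpM2r ?pnorm_ge0 // -[2]/(1 + 1) mulrDr mulr1 lerD // ltW.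
  exists l => n; apply/ler_addgt0Pr => e e0.
  have [N1 h1] := ul _ (divr_gt0 e0 (ltr0Sn R 1)).
  have p1 : 0 < pnorm i + 1 by rewrite ltr_wpDl ?pnorm_ge0.
  have [|N2 h2] := @inv_nat_small R (e / 2 / (pnorm i + 1)).
    by rewrite !divr_gt0.
  pose m := maxn N1 N2.
  have hm1 : modulus (l - cfun (u m) i) < e / 2 by apply: h1; rewrite leq_maxl.
  have hm2 : m.+1%:R^-1 < e / 2 / (pnorm i + 1) by apply: h2; rewrite leq_maxr.
  have t := modulusD (l - cfun (u m) i) (cfun (u m) i - cfun (u n) i).
  rewrite subrKA in t; apply: le_trans t _.
  have := ule m n i; have := pnorm_ge0 i.
  have : e / 2 = e / 2 / (pnorm i + 1) * (pnorm i + 1) by rewrite mulfVK // gt_eqF.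
  move: hm2 hm1; set d := e / 2 / _; set mi := m.+1%:R^-1; set ni := n.+1%:R^-1.
  move=> *; nra.
have [l lP] := choice cv.
have l0 (c : R[i]) (i : I) (K : R) :
    (forall n, modulus c <= K * n.+1%:R^-1) -> c = 0.
  move=> h; apply/eqP; rewrite -modulus_eq0 eq_le modulus_ge0 andbT.
  apply/ler_addgt0Pr => e e0; rewrite add0r.
  have K1 : 0 < `|K| + 1 by rewrite ltr_wpDl.
  have [N /(_ N (leqnn N)) hN] := @inv_nat_small R _ (divr_gt0 e0 K1).
  apply: le_trans (h N) _; have := ler_norm K.
  have : e = e / (`|K| + 1) * (`|K| + 1) by rewrite mulfVK // gt_eqF.
  have : 0 < (N.+1%:R : R)^-1 by rewrite invr_gt0.
  have := normr_ge0 K.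
  move: hN; set d := e / _; set ni := N.+1%:R^-1 => *; nra.
have lin : l \in @bounded_antilinear R I.
  apply/asboolP; split=> [i j|c i|].
  - apply/eqP; rewrite -subr_eq0; apply/eqP.
    apply: (l0 _ i (pnorm (padd i j) + pnorm i + pnorm j)) => n.
    have -> : l (padd i j) - (l i + l j) = (l (padd i j) - cfun (u n) (padd i j))
       - (l i - cfun (u n) i) - (l j - cfun (u n) j) by rewrite cfun_padd; ring.
    have t1 := modulusD (l (padd i j) - cfun (u n) (padd i j) - (l i - cfun (u n) i))
      (- (l j - cfun (u n) j)).
    have t2 := modulusD (l (padd i j) - cfun (u n) (padd i j)) (- (l i - cfun (u n) i)).
    rewrite !modulusN in t1 t2; apply: le_trans t1 _.
    have := lP (padd i j) n; have := lP i n; have := lP j n.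
    by set r := n.+1%:R^-1; lra.
  - apply/eqP; rewrite -subr_eq0; apply/eqP.
    apply: (l0 _ i (2 * modulus c * pnorm i)) => n.
    have -> : l (pscale c i) - Num.conj c * l i =
       (l (pscale c i) - cfun (u n) (pscale c i)) - Num.conj c * (l i - cfun (u n) i).
      by rewrite cfun_pscale; ring.
    apply: le_trans (modulusD _ _) _; rewrite modulusN modulusM modulus_conj.
    have := lP (pscale c i) n; have := lP i n; have := modulus_ge0 c.
    by rewrite pnormZ; set r := n.+1%:R^-1; nra.
  exists (1 + cnorm (u 0%N)) => i.
  have := modulusD (l i - cfun (u 0%N) i) (cfun (u 0%N) i); rewrite subrK.
  by have := lP i 0%N; have := cfun_le (u 0%N) i; rewrite invr1; lra.
exists (Completion lin) => n; rewrite rnorm_cnorm.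
by apply: cnorm_le => [|i]; [rewrite invr_ge0|rewrite cfunB lP].
Qed.

HB.instance Definition _ := Uniform_isComplete.Build (completion I)
  completion_complete.

Lemma pform_antilinear i : pform i \in @bounded_antilinear R I.
Proof.
apply/asboolP; split=> [j k|c j|]; [exact: pformDr|exact: pformZr|].
by exists (pnorm i) => j; apply: pform_cauchy_schwarz.
Qed.

Definition cembed i : completion I := Completion (pform_antilinear i).

Lemma cembedD i j : cembed (padd i j) = cembed i + cembed j.
Proof. by apply: cfun_inj => k; rewrite cfunD /= pformD. Qed.

Lemma cembedZ c i : cembed (pscale c i) = c *: cembed i.
Proof. by apply: cfun_inj => k; rewrite cfunZ /= pformZ. Qed.

Lemma rnorm_cembed i : rnorm (cembed i) = pnorm i.
Proof.
rewrite rnorm_cnorm; apply/eqP; rewrite eq_le; apply/andP; split.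
  by apply: cnorm_le => [|j]; [exact: pnorm_ge0|exact: pform_cauchy_schwarz].
have := cfun_le (cembed i) i; rewrite /= pformE modulus_real ?pnorm2_ge0 // -pnormK.
have [->|i0] := eqVneq (pnorm i) 0; first by rewrite cnorm_ge0.
by rewrite expr2 ler_pM2r // lt_neqAle eq_sym i0 pnorm_ge0.
Qed.

Lemma dense_cembed : dense (range cembed).
Proof.
apply/dense_rnormP => f e e0.
have e2 : 0 < e / 2 by rewrite divr_gt0.
have [i hi] := near_representation (cfun_padd f) (cfun_pscale f) (cfun_le f) e2.
exists (cembed i); first by exists i.
rewrite rnorm_cnorm; apply: le_lt_trans (_ : e / 2 < e); last by lra.
by apply: cnorm_le => [|j]; [exact: ltW|rewrite cfunB; exact: hi].
Qed.


Lemma dense_cembed_lt f (e : R) : 0 < e -> exists i, rnorm (f - cembed i) < e.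
Proof.
by move=> e0; have /dense_rnormP /(_ f e e0)[_ [i _ <-] fi] := dense_cembed; exists i.
Qed.

(** The inner product of f and g has to be the limit of the values of f along any
   approximation of g by embedded elements. *)
Lemma cinner_ex f g : exists c, forall i,
  modulus (c - cfun f i) <= rnorm f * rnorm (g - cembed i).
Proof.
have fB i j : modulus (cfun f i - cfun f j) <= rnorm f * rnorm (cembed i - cembed j).
  have -> : cfun f i - cfun f j = cfun f (padd i (pscale (-1) j)).
    by rewrite cfun_padd cfun_pscale rmorphN rmorph1 mulN1r.
  have -> : cembed i - cembed j = cembed (padd i (pscale (-1) j)).
    by rewrite cembedD cembedZ scaleN1r.
  by rewrite rnorm_cembed; apply: cfun_le.
have near n : exists i, rnorm (g - cembed i) < n.+1%:R^-1.
  by apply: dense_cembed_lt; rewrite invr_gt0.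
have [u ug] := choice near.
have f1 : 0 < rnorm f + 1 by rewrite ltr_wpDl // rnorm_ge0.
have [|c cu] := @complex_cauchy_cvg R (fun n => cfun f (u n)).
  move=> e e0; have d0 : 0 < e / (2 * (rnorm f + 1)) by rewrite divr_gt0 // mulr_gt0.
  have [N hN] := inv_nat_small d0; exists N => m n /hN hm /hN hn.
  apply: le_lt_trans (fB _ _) _.
  have t := rnorm_triangle g (cembed (u m)) (cembed (u n)).
  rewrite [rnorm (_ - g)]rnorm_distC in t.
  have gm := lt_trans (ug m) hm; have gn := lt_trans (ug n) hn.
  have := rnorm_ge0 f; have : e = e / (2 * (rnorm f + 1)) * (2 * (rnorm f + 1)).
    by rewrite mulfVK // gt_eqF // mulr_gt0.
  move: d0 gm gn t; set d := e / _; set a := rnorm (cembed _ - _) => d0 gm gn t eE f0.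
  have : a < 2 * d by lra.
  nra.
exists c => i; apply/ler_addgt0Pr => e e0.
have d0 : 0 < e / (rnorm f + 1) by rewrite divr_gt0.
have [N1 h1] := inv_nat_small d0; have [N2 h2] := cu _ d0.
pose n := maxn N1 N2.
have hn1 : rnorm (g - cembed (u n)) < e / (rnorm f + 1).
  by apply: lt_trans (ug n) _; apply: h1; rewrite leq_maxl.
have hn2 : modulus (c - cfun f (u n)) < e / (rnorm f + 1).
  by apply: h2; rewrite leq_maxr.
have t1 := modulusD (c - cfun f (u n)) (cfun f (u n) - cfun f i).
rewrite subrKA in t1; apply: le_trans t1 _.
have t2 := fB (u n) i; have t3 := rnorm_triangle g (cembed (u n)) (cembed i).
rewrite [rnorm (_ - g)]rnorm_distC in t3.
have := rnorm_ge0 f.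
have : e = e / (rnorm f + 1) * (rnorm f + 1) by rewrite mulfVK // gt_eqF.
move: hn1 hn2 d0 t2 t3; set d := e / _.
set a := rnorm (g - cembed (u n)); set b := rnorm (cembed (u n) - _).
set k := rnorm (g - cembed i); move=> *; nra.
Qed.

Definition cinner f g : R[i] := projT1 (cid (cinner_ex f g)).

Lemma cinner_le f g i :
  modulus (cinner f g - cfun f i) <= rnorm f * rnorm (g - cembed i).
Proof. exact: projT2 (cid (cinner_ex f g)) i. Qed.

Lemma cinner_uniq f g c K : 0 <= K ->
  (forall i, modulus (c - cfun f i) <= K * rnorm (g - cembed i)) -> cinner f g = c.
Proof.
move=> K0 h; apply/eqP; rewrite -subr_eq0 -modulus_eq0 eq_le modulus_ge0 andbT.
apply/ler_addgt0Pr => e e0; rewrite add0r.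
have d0 : 0 < rnorm f + K + 1 by rewrite ltr_wpDl // addr_ge0 // rnorm_ge0.
have [i gi] := dense_cembed_lt g (divr_gt0 e0 d0).
have t := modulusD (cinner f g - cfun f i) (- (c - cfun f i)).
rewrite modulusN opprB subrKA in t; apply: le_trans t _.
have := cinner_le f g i; have := h i; have := rnorm_ge0 f.
have := rnorm_ge0 (g - cembed i).
have : e = e / (rnorm f + K + 1) * (rnorm f + K + 1) by rewrite mulfVK // gt_eqF.
move: gi; set d := e / _; set a := rnorm (g - _); move=> *; nra.
Qed.

Lemma cinner_embed f i : cinner f (cembed i) = cfun f i.
Proof.
apply/eqP; rewrite -subr_eq0 -modulus_eq0 eq_le modulus_ge0 andbT.
by have := cinner_le f (cembed i) i; rewrite subrr rnorm0 mulr0.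
Qed.

Lemma cinner_linearl a f f' g : cinner (a *: f + f') g = a * cinner f g + cinner f' g.
Proof.
apply: (@cinner_uniq _ _ _ (modulus a * rnorm f + rnorm f')) => [|i].
  by rewrite addr_ge0 ?mulr_ge0 ?modulus_ge0 ?rnorm_ge0.
have -> : a * cinner f g + cinner f' g - cfun (a *: f + f') i =
  a * (cinner f g - cfun f i) + (cinner f' g - cfun f' i).
  by rewrite cfunD cfunZ; ring.
apply: le_trans (modulusD _ _) _; rewrite modulusM mulrDl -mulrA.
by apply: lerD; rewrite ?ler_wpM2l ?modulus_ge0 ?cinner_le.
Qed.

Lemma cinner_near f g i j :
  modulus (cinner f g - pform i j) <=
  rnorm f * rnorm (g - cembed j) +
  rnorm (f - cembed i) * (rnorm g + rnorm (g - cembed j)).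
Proof.
have t := modulusD (cinner f g - cfun f j) (cfun f j - pform i j).
rewrite subrKA in t; apply: le_trans t _; rewrite lerD ?cinner_le //.
rewrite -[pform i j]/(cfun (cembed i) j) -cfunB.
apply: le_trans (cfun_le _ _) _; rewrite ler_wpM2l ?cnorm_ge0 // -rnorm_cembed.
by rewrite rnorm_distC rnorm_diff_le.
Qed.

Lemma cinner_conj f g : cinner g f = Num.conj (cinner f g).
Proof.
apply/eqP; rewrite -subr_eq0 -modulus_eq0 eq_le modulus_ge0 andbT.
apply/ler_addgt0Pr => e e0; rewrite add0r.
pose K := rnorm f + rnorm g + 1.
have K0 : 0 < K by rewrite ltr_wpDl // addr_ge0 // rnorm_ge0.
have d1 : 0 < Num.min 1 (e / (2 * K)) by rewrite lt_min ltr01 divr_gt0 // mulr_gt0.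
have [ i ] := dense_cembed_lt f d1; rewrite lt_min => /andP[fi1 fi].
have [j] := dense_cembed_lt g d1; rewrite lt_min => /andP[gj1 gj].
have t := modulusD (cinner g f - pform j i) (- Num.conj (cinner f g - pform i j)).
rewrite modulusN modulus_conj rmorphB /= -pform_conj opprB subrKA in t.
apply: le_trans t _; have := cinner_near f g i j; have := cinner_near g f j i.
have : e = e / (2 * K) * (2 * K) by rewrite mulfVK // gt_eqF // mulr_gt0.
have := rnorm_ge0 f; have := rnorm_ge0 g.
have := rnorm_ge0 (f - cembed i); have := rnorm_ge0 (g - cembed j).
rewrite {2}/K; move: fi gj fi1 gj1; set d := e / _; set a := rnorm (f - _).
set b := rnorm (g - _) => ad bd a1 b1 b0 a0 g0 f0 -> h1 h2.
have h3 : a * b <= d by nra.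
have h4 : a * b <= a by nra.
have h5 : rnorm f * b <= rnorm f * d by nra.
have h6 : rnorm g * a <= rnorm g * d by nra.
nra.
Qed.

Lemma cinner_norm f : cinner f f = `|f| ^+ 2.
Proof.
apply/eqP; rewrite -subr_eq0 -modulus_eq0 eq_le modulus_ge0 andbT.
apply/ler_addgt0Pr => e e0; rewrite add0r.
pose K := 4 * rnorm f + 2.
have K0 : 0 < K by have := rnorm_ge0 f; rewrite /K; lra.
have d1 : 0 < Num.min 1 (e / K) by rewrite lt_min ltr01 divr_gt0.
have [ i ] := dense_cembed_lt f d1; rewrite lt_min => /andP[fi1 fi].
have -> : cinner f f - `|f| ^+ 2 = (cinner f f - pform i i) + (pform i i - `|f| ^+ 2).
  by ring.
apply: le_trans (modulusD _ _) _.
have -> : modulus (pform i i - `|f| ^+ 2) = `|rnorm (cembed i) ^+ 2 - rnorm f ^+ 2|.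
  rewrite pformE -pnormK -rnorm_cembed normE_rnorm -rmorphXn -rmorphB /=.
  by rewrite /modulus normc_def /= expr0n /= addr0 sqrtr_sqr.
have h1 := cinner_near f f i i.
have h2 := rnorm_diff_le f (cembed i).
have h3 := rnorm_diff_le (cembed i) f; rewrite rnorm_distC in h3.
have h4 : `|rnorm (cembed i) ^+ 2 - rnorm f ^+ 2| <=
    rnorm (f - cembed i) * (2 * rnorm f + rnorm (f - cembed i)).
  have := rnorm_ge0 f; have := rnorm_ge0 (cembed i).
  by rewrite ler_norml; move=> *; apply/andP; split; nra.
have : e = e / K * K by rewrite mulfVK // gt_eqF.
have := rnorm_ge0 f; have := rnorm_ge0 (f - cembed i).
rewrite {2}/K; move: fi fi1 h1 h2 h3 h4; set d := e / _; set a := rnorm (f - _).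
move=> ad a1 h1 h2 h3 h4 a0 f0 ->.
have h5 : rnorm f * a <= rnorm f * d by nra.
have h6 : a * a <= a by nra.
nra.
Qed.

Lemma cinner_bilinear : bilinear_for
  (GRing.Scale.Law.clone _ _ ( *%R ) _)
  (GRing.Scale.Law.clone _ _ (Num.conj \; *%R ) _) cinner.
Proof.
split=> [g a f f'|f a g g'] /=; first exact: cinner_linearl.
by rewrite !(cinner_conj _ f) cinner_linearl rmorphD rmorphM.
Qed.

HB.instance Definition _ := bilinear_isBilinear.Build R[i]
  (completion I) (completion I) R[i]
  (GRing.Scale.Law.clone _ _ ( *%R ) _)
  (GRing.Scale.Law.clone _ _ (Num.conj \; *%R ) _) cinner cinner_bilinear.

Lemma cinner_hermitian f g :
  cinner f g = (-1) ^+ false * Num.conj (cinner g f).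
Proof. by rewrite expr0 mul1r cinner_conj. Qed.

HB.instance Definition _ := isHermitianSesquilinear.Build R[i] (completion I)
  false (@Num.conj R[i]) cinner cinner_hermitian.

Lemma cinner_pos f : f != 0 -> 0 < cinner f f.
Proof. by move=> f0; rewrite cinner_norm exprn_gt0 // normr_gt0. Qed.

HB.instance Definition _ := isDotProduct.Build R[i] (completion I)
  cinner cinner_pos.

HB.instance Definition _ := isHilbertSpace.Build R (completion I) cinner_norm.

End CompletionHilbert.

Theorem prehilbert_completion (R : realType) (I : prehilbert R) :
  exists (L : hilbertType R) (iota : I -> L),
    [/\ forall i j, iota (padd i j) = iota i + iota j,
        forall c i, iota (pscale c i) = c *: iota i,
        forall i j, inner (iota i) (iota j) = pform i j &
        dense (range iota)].
Proof.
exists (completion I), (@cembed R I); split.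
- exact: cembedD.
- exact: cembedZ.
- by move=> i j; rewrite [inner _ _]cinner_embed.
- exact: dense_cembed.
Qed.

(** * Inner products and bounded operators *)

Section LinearFacts.
Variables (R : realType) (V W : lmodType R[i]) (T : V -> W).
Hypothesis lT : linear T.

Lemma linear_opD x y : T (x + y) = T x + T y.
Proof. by rewrite -[x]scale1r lT !scale1r. Qed.

Lemma linear_op0 : T 0 = 0.
Proof. by apply: (addrI (T 0)); rewrite -linear_opD !addr0. Qed.

Lemma linear_opZ c x : T (c *: x) = c *: T x.
Proof. by rewrite -[c *: x]addr0 lT linear_op0 addr0. Qed.

Lemma linear_opN x : T (- x) = - T x.
Proof. by rewrite -scaleN1r linear_opZ scaleN1r. Qed.

Lemma linear_opB x y : T (x - y) = T x - T y.
Proof. by rewrite linear_opD linear_opN. Qed.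

Lemma linear_op_sum (I : Type) (s : seq I) (f : I -> V) :
  T (\sum_(i <- s) f i) = \sum_(i <- s) T (f i).
Proof.
by elim: s => [|i s IH]; rewrite ?big_nil ?linear_op0 // !big_cons linear_opD IH.
Qed.

End LinearFacts.

Section InnerFacts.
Variables (R : realType) (H : hilbertType R).
Implicit Types (x y z : H) (c : R[i]).

Lemma innerDl x y z : inner (x + y) z = inner x z + inner y z.
Proof. exact: linearDl. Qed.

Lemma innerDr x y z : inner z (x + y) = inner z x + inner z y.
Proof. exact: linearDr. Qed.

Lemma innerZl c x y : inner (c *: x) y = c * inner x y.
Proof. exact: linearZl_LR. Qed.

Lemma innerZr c x y : inner x (c *: y) = Num.conj c * inner x y.
Proof. exact: linearZr_LR. Qed.

Lemma inner_conj x y : inner y x = Num.conj (inner x y).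
Proof. by rewrite (hermitian_subproof y x) expr0 mul1r. Qed.

Lemma inner0l x : inner 0 x = 0. Proof. exact: linear0l. Qed.
Lemma innerBl x y z : inner (x - y) z = inner x z - inner y z.
Proof. exact: linearBl. Qed.
Lemma innerBr x y z : inner z (x - y) = inner z x - inner z y.
Proof. exact: linearBr. Qed.

Lemma inner_suml (I : Type) (s : seq I) (f : I -> H) y :
  inner (\sum_(i <- s) f i) y = \sum_(i <- s) inner (f i) y.
Proof. exact: linear_sumlz. Qed.

Lemma inner_sumr (I : Type) (s : seq I) (f : I -> H) y :
  inner y (\sum_(i <- s) f i) = \sum_(i <- s) inner y (f i).
Proof. exact: linear_sumr. Qed.

Lemma inner_rnorm x : inner x x = (rnorm x ^+ 2)%:C.
Proof. by rewrite inner_norm normE_rnorm rmorphXn. Qed.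

Lemma inner_ge0 x : 0 <= inner x x.
Proof. by rewrite inner_rnorm ler0c sqr_ge0. Qed.

Definition hilbert_pre : prehilbert R :=
  PreHilbert 0 innerDl innerZl inner_conj inner_ge0.

Lemma hilbert_pnorm x : @pnorm R hilbert_pre x = rnorm x.
Proof.
by rewrite /pnorm /pnorm2 /= inner_rnorm /= sqrtr_sqr ger0_norm ?rnorm_ge0.
Qed.

Lemma cauchy_schwarz x y : modulus (inner x y) <= rnorm x * rnorm y.
Proof. by have := @pform_cauchy_schwarz R hilbert_pre x y; rewrite !hilbert_pnorm. Qed.

Lemma inner_inj x y : (forall z, inner x z = inner y z) -> x = y.
Proof.
move=> h; apply/eqP; rewrite -subr_eq0 -rnorm_eq0 -sqrf_eq0.
by rewrite -(inj_eq (@complexI R)) -inner_rnorm innerBl h subrr.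
Qed.

Lemma rnorm_le_inner x (M : R) : 0 <= M ->
  (forall z, modulus (inner x z) <= M * rnorm z) -> rnorm x <= M.
Proof.
move=> M0 /(_ x); rewrite inner_rnorm modulus_real ?sqr_ge0 // expr2.
have [->//|x0] := eqVneq (rnorm x) 0.
by rewrite ler_pM2r // lt_neqAle eq_sym x0 rnorm_ge0.
Qed.

End InnerFacts.

Section Operators.
Variables (R : realType) (H : hilbertType R).
Implicit Types (S T : H -> H).

Definition bounded_by (V W : normedModType R[i]) (M : R) (T : V -> W) :=
  forall x, rnorm (T x) <= M * rnorm x.

Lemma lipschitz_linear (V W : normedModType R[i]) (M : R) (T : V -> W) :
  linear T -> 0 <= M -> bounded_by M T -> lipschitz_map T.
Proof. by move=> lT M0 TM; exists M => // x y; rewrite -linear_opB. Qed.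

Lemma bounded_operatorP T : bounded_operator T <->
  linear T /\ exists2 M, 0 <= M & bounded_by M T.
Proof.
split=> [[lT cT]|[lT [M M0 TM]]]; split=> //.
  have /nbhs_rnormP[d d0 dT] : nbhs (0 : H) [set x | rnorm (T x) < 1].
    have := cT 0 [set y | rnorm y < 1]; apply.
    apply/nbhs_rnormP; exists 1 => // y.
    by rewrite (linear_op0 lT) sub0r rnormN.
  exists (2 / d); first by rewrite divr_ge0 // ltW.
  move=> x; have [->|x0] := eqVneq x 0.
    by rewrite (linear_op0 lT) !rnorm0 mulr0.
  have xp : 0 < rnorm x by rewrite lt_neqAle eq_sym rnorm_eq0 x0 rnorm_ge0.
  pose c : R[i] := (d / 2 / rnorm x)%:C.
  have cE : modulus c = d / 2 / rnorm x.
    by rewrite modulus_real // !divr_ge0 // ltW.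
  have /= := dT (c *: x); rewrite sub0r rnormN (linear_opZ lT) !rnormZ cE.
  rewrite mulfVK ?gt_eqF // => /(_ _) h.
  have {h} : d / 2 / rnorm x * rnorm (T x) < 1 by apply: h; lra.
  rewrite -ltr_pdivlMl ?divr_gt0 // => /ltW h; apply: le_trans h _.
  by rewrite le_eqVlt; apply/orP; left; apply/eqP; field; rewrite !gt_eqF.
move=> x A /nbhs_rnormP[e e0 eA].
rewrite /nbhs /=; apply/nbhs_rnormP; exists (e / (M + 1)); first by rewrite divr_gt0 // ltr_wpDl.
move=> y xy; apply: eA; rewrite -(linear_opB lT); apply: le_lt_trans (TM _) _.
have M1 : 0 < M + 1 by rewrite ltr_wpDl.
by move: xy; rewrite ltr_pdivlMr //; have := rnorm_ge0 (x - y); nra.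
Qed.

Lemma opnorm_has_sup T : bounded_operator T ->
  has_sup [set rnorm (T x) | x in [set x : H | `|x| <= 1]].
Proof.
move=> /bounded_operatorP[lT [M M0 TM]]; split.
  by exists (rnorm (T 0)), 0 => //=; rewrite normr0 ler01.
exists M => _ [x /= + <-]; rewrite rnorm_le1 => x1.
by apply: le_trans (TM x) _; rewrite ler_piMr.
Qed.

Lemma opnorm_ge0 T : bounded_operator T -> 0 <= opnorm T.
Proof.
move=> bT; apply: le_trans (rnorm_ge0 (T 0)) _.
apply: sup_upper_bound; first exact: opnorm_has_sup.
by exists 0 => //=; rewrite normr0 ler01.
Qed.

Lemma opnorm_bound T : bounded_operator T -> bounded_by (opnorm T) T.
Proof.
move=> bT x; have [lT _] := bT.
have [->|x0] := eqVneq x 0; first by rewrite (linear_op0 lT) !rnorm0 mulr0.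
have xp : 0 < rnorm x by rewrite lt_neqAle eq_sym rnorm_eq0 x0 rnorm_ge0.
rewrite -ler_pdivrMr //.
have cE : modulus (rnorm x)^-1%:C = (rnorm x)^-1 by rewrite modulus_real // invr_ge0 ltW.
apply: sup_upper_bound; first exact: opnorm_has_sup.
exists ((rnorm x)^-1%:C *: x).
  by rewrite /= rnorm_le1 rnormZ cE mulVf // gt_eqF.
by rewrite (linear_opZ lT) rnormZ cE mulrC.
Qed.

Lemma opnorm_le T (M : R) : 0 <= M -> bounded_by M T -> opnorm T <= M.
Proof.
move=> M0 TM; apply: ge_sup.
  by exists (rnorm (T 0)), 0 => //=; rewrite normr0 ler01.
move=> _ [x /= + <-]; rewrite rnorm_le1 => x1.
by apply: le_trans (TM x) _; rewrite ler_piMr.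
Qed.

Lemma bounded_operator_comp S T :
  bounded_operator S -> bounded_operator T -> bounded_operator (S \o T).
Proof.
move=> /bounded_operatorP[lS [M M0 SM]] /bounded_operatorP[lT [N N0 TN]].
apply/bounded_operatorP; split; first by move=> c x y /=; rewrite lT lS.
exists (M * N); first exact: mulr_ge0.
by move=> x /=; apply: le_trans (SM _) _; rewrite -mulrA ler_wpM2l.
Qed.

Lemma bounded_operator_lip T : bounded_operator T -> lipschitz_map T.
Proof.
by move=> /bounded_operatorP[lT [M M0 TM]]; apply: lipschitz_linear TM.
Qed.

Lemma bounded_operatorB S T :
  bounded_operator S -> bounded_operator T -> bounded_operator (S \- T).
Proof.
move=> /bounded_operatorP[lS [M M0 SM]] /bounded_operatorP[lT [N N0 TN]].
apply/bounded_operatorP; split.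
  by move=> c x y /=; rewrite lT lS scalerBr opprD addrACA.
exists (M + N); first exact: addr_ge0.
move=> x /=; apply: le_trans (rnormD _ _) _; rewrite rnormN mulrDl.
by apply: lerD.
Qed.

Lemma projection_le (P : H -> H) : projection P -> bounded_by 1 P.
Proof.
move=> [_ PP Ps] x; rewrite mul1r.
have [->|p0] := eqVneq (rnorm (P x)) 0; first exact: rnorm_ge0.
have pp : 0 < rnorm (P x) by rewrite lt_neqAle eq_sym p0 rnorm_ge0.
rewrite -(ler_pM2r pp) -expr2 -[leLHS](modulus_real (sqr_ge0 _)) -inner_rnorm.
by rewrite Ps -[P (P x)]/((P \o P) x) PP; apply: cauchy_schwarz.
Qed.

End Operators.

(** * Gram-Schmidt orthonormalization *)

Definition orthonormal_family (R : realType) (H : hilbertType R) (m : nat)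
  (e : 'I_m -> H) := forall i j, inner (e i) (e j) = (i == j)%:R.

Section GramSchmidt.
Variables (R : realType) (H : hilbertType R).

Lemma sum_delta (m : nat) (V : lmodType R[i]) (f : 'I_m -> V) j :
  \sum_(i < m) (i == j)%:R *: f i = f j.
Proof.
rewrite (bigD1 j) //= eqxx scale1r big1 ?addr0 // => i /negbTE ->.
by rewrite scale0r.
Qed.

Lemma sum_deltaM (m : nat) (f : 'I_m -> R[i]) j :
  \sum_(i < m) f i * (i == j)%:R = f j.
Proof.
rewrite (bigD1 j) //= eqxx mulr1 big1 ?addr0 // => i /negbTE ->.
by rewrite mulr0.
Qed.

(** The clause on maps fixing the vectors says that the family stays in their
   span, without naming the span. *)
Lemma gram_schmidt (vs : seq H) : exists (m : nat) (e : 'I_m -> H),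
  [/\ orthonormal_family e,
      forall v, v \in vs -> v = \sum_(i < m) inner v (e i) *: e i &
      forall T : H -> H, linear T -> (forall v, v \in vs -> T v = v) ->
        forall i, T (e i) = e i].
Proof.
elim: vs => [|v vs [m [e [oe se fe]]]].
  by exists 0%N, (fun _ => 0); split=> [[]|v|T _ _ []].
pose w := v - \sum_(i < m) inner v (e i) *: e i.
have we j : inner w (e j) = 0.
  rewrite innerBl inner_suml (eq_bigr (fun i => inner v (e i) * (i == j)%:R)).
    by rewrite sum_deltaM subrr.
  by move=> i _; rewrite innerZl oe.
have wT (T : H -> H) : linear T -> (forall u, u \in v :: vs -> T u = u) -> T w = w.
  move=> lT Tv; rewrite (linear_opB lT) Tv ?mem_head // (linear_op_sum lT).
  congr (_ - _); apply: eq_bigr => i _; rewrite (linear_opZ lT) (fe T) // => u uv.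
  by apply: Tv; rewrite inE uv orbT.
have [w0|w0] := eqVneq w 0.
  exists m, e; split; first exact: oe.
    move=> u; rewrite inE => /orP[/eqP ->|/se //].
    by apply/eqP; rewrite -subr_eq0 -/w w0.
  move=> T lT Tv; by apply: fe => // u uv; apply: Tv; rewrite inE uv orbT.
have wp : 0 < rnorm w by rewrite lt_neqAle eq_sym rnorm_eq0 w0 rnorm_ge0.
pose w1 := (rnorm w)^-1%:C *: w.
have w1e j : inner w1 (e j) = 0 by rewrite innerZl we mulr0.
have w11 : inner w1 w1 = 1.
  rewrite innerZl innerZr conj_real inner_rnorm -!rmorphM /=.
  by rewrite expr2 mulrA -mulrA mulKf ?gt_eqF // mulVf ?gt_eqF.
pose e' (i : 'I_m.+1) := oapp e w1 (unlift ord0 i).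
have e'0 : e' ord0 = w1 by rewrite /e' unlift_none.
have e'S i : e' (lift ord0 i) = e i by rewrite /e' liftK.
exists m.+1, e'; split.
- move=> i j; case: (unliftP ord0 i) => [i' ->|->]; case: (unliftP ord0 j) => [j' ->|->].
  + by rewrite !e'S oe (inj_eq (@lift_inj _ ord0)).
  + by rewrite e'S e'0 inner_conj w1e rmorph0 eq_sym (negbTE (neq_lift _ _)).
  + by rewrite e'S e'0 w1e (negbTE (neq_lift _ _)).
  + by rewrite e'0 w11 eqxx.
- move=> u; rewrite inE big_ord_recl e'0.
  rewrite (eq_bigr (fun i => inner u (e i) *: e i)); last by move=> i _; rewrite e'S.
  move=> /orP[/eqP ->|uv].
    have -> : inner v w1 = (rnorm w)%:C.
      have -> : inner v w1 = inner w w1.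
        rewrite /w innerBl inner_suml big1 ?subr0 // => i _.
        by rewrite innerZl [inner _ w1]inner_conj w1e rmorph0 mulr0.
      rewrite innerZr conj_real inner_rnorm -rmorphM /=.
      by rewrite expr2 mulKf ?gt_eqF.
    by rewrite scalerA -rmorphM /= divff ?gt_eqF // scale1r subrK.
  have -> : inner u w1 = 0.
    rewrite (se u uv) inner_suml big1 // => i _.
    by rewrite innerZl [inner _ w1]inner_conj w1e rmorph0 mulr0.
  by rewrite scale0r add0r; apply: se.
move=> T lT Tv i; case: (unliftP ord0 i) => [i' ->|->].
  by rewrite e'S; apply: fe => // u uv; apply: Tv; rewrite inE uv orbT.
by rewrite e'0 (linear_opZ lT) wT.
Qed.

(** Orthonormalize the images under P of vectors that span its range: P still
   fixes the resulting family. *)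
Lemma projection_basis (P : H -> H) : projection P -> finite_rank P ->
  exists (m : nat) (e : 'I_m -> H),
    [/\ orthonormal_family e, forall i, P (e i) = e i &
        forall x, P x = \sum_(i < m) inner x (e i) *: e i].
Proof.
move=> [bP PP Ps] [n [v Pv]]; have [lP _] := bP.
have PPx x : P (P x) = P x by rewrite -[P (P x)]/((P \o P) x) PP.
have [m [e [oe se fe]]] := gram_schmidt [seq P (v i) | i <- enum 'I_n].
have Pe i : P (e i) = e i by apply: fe => // _ /mapP[k _ ->].
exists m, e; split=> // x.
have PxE : P x = \sum_(i < m) inner (P x) (e i) *: e i.
  have [c xc] := Pv x; rewrite -PPx xc (linear_op_sum lP).
  have h k : P (c k *: v k) = \sum_(i < m) inner (P (c k *: v k)) (e i) *: e i.
    rewrite (linear_opZ lP) {1}(se (P (v k))); last by rewrite map_f // mem_enum.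
    by rewrite scaler_sumr; apply: eq_bigr => i _; rewrite innerZl scalerA.
  rewrite {1}(eq_bigr _ (fun k _ => h k)) exchange_big /=.
  by apply: eq_bigr => i _; rewrite inner_suml scaler_suml.
by rewrite PxE; apply: eq_bigr => i _; rewrite Ps Pe.
Qed.

End GramSchmidt.

(** * Tensor products of Hilbert spaces *)

(** Weaker than bilinearity, so that conjugate-linear pairings are covered: it is
   enough to rewrite a formal sum of tensors over an orthonormal family. *)
Record balanced (R : realType) (V V' : lmodType R[i]) (W : zmodType)
    (b : V -> V' -> W) : Prop := {
  balDl : forall x x' y, b (x + x') y = b x y + b x' y;
  balDr : forall x y y', b x (y + y') = b x y + b x y';
  balZ : forall c x y, b x (c *: y) = b (c *: x) y
}.

Section Balanced.
Variables (R : realType) (V V' : lmodType R[i]) (W : zmodType) (b : V -> V' -> W).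
Hypothesis bb : balanced b.

Lemma bal0l y : b 0 y = 0.
Proof. by apply: (addrI (b 0 y)); rewrite -(balDl bb) !addr0. Qed.

Lemma bal0r x : b x 0 = 0.
Proof. by apply: (addrI (b x 0)); rewrite -(balDr bb) !addr0. Qed.

Lemma bal_suml (I : Type) (s : seq I) (f : I -> V) y :
  b (\sum_(i <- s) f i) y = \sum_(i <- s) b (f i) y.
Proof.
by elim: s => [|i s IH]; rewrite ?big_nil ?bal0l // !big_cons (balDl bb) IH.
Qed.

Lemma bal_sumr (I : Type) (s : seq I) (f : I -> V') x :
  b x (\sum_(i <- s) f i) = \sum_(i <- s) b x (f i).
Proof.
by elim: s => [|i s IH]; rewrite ?big_nil ?bal0r // !big_cons (balDr bb) IH.
Qed.

End Balanced.

Section FormalTensors.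
Variables (R : realType) (H K : hilbertType R).
Implicit Types (u v : seq (H * K)).

Definition expands (m : nat) (e : 'I_m -> K) u :=
  forall q, q \in u -> q.2 = \sum_(j < m) inner q.2 (e j) *: e j.

(** When the second components of u lie in the span of an orthonormal family e,
   u stands for the sum of the tensors (coef u (e j)) (x) (e j). *)
Definition coef u (y : K) : H := \sum_(q <- u) inner q.2 y *: q.1.

Lemma balanced_sum (W : zmodType) (b : H -> K -> W) (m : nat) (e : 'I_m -> K) u :
  balanced b -> expands e u ->
  \sum_(q <- u) b q.1 q.2 = \sum_(j < m) b (coef u (e j)) (e j).
Proof.
move=> bb ue; rewrite (eq_big_seq (fun q => \sum_(j < m) b (inner q.2 (e j) *: q.1) (e j))).
  by rewrite exchange_big /=; apply: eq_bigr => j _; rewrite (bal_suml bb).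
move=> q /ue {1}->; rewrite (bal_sumr bb); apply: eq_bigr => j _.
by rewrite (balZ bb).
Qed.

Definition gram u v : R[i] :=
  \sum_(p <- u) \sum_(q <- v) inner p.1 q.1 * inner p.2 q.2.

Definition gram2 u : R := complex.Re (gram u u).

Lemma gram_cat u u' v : gram (u ++ u') v = gram u v + gram u' v.
Proof. by rewrite /gram big_cat. Qed.

Definition tscale (c : R[i]) u := [seq (c *: q.1, q.2) | q <- u].

Lemma gram_scale c u v : gram (tscale c u) v = c * gram u v.
Proof.
rewrite /gram big_map mulr_sumr; apply: eq_bigr => p _ /=.
by rewrite mulr_sumr; apply: eq_bigr => q _; rewrite innerZl mulrA.
Qed.

Lemma gram_conj u v : gram v u = Num.conj (gram u v).
Proof.
rewrite /gram exchange_big rmorph_sum /=; apply: eq_bigr => p _.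
rewrite rmorph_sum /=; apply: eq_bigr => q _.
by rewrite rmorphM /= -!inner_conj.
Qed.

Lemma balanced_gram v : balanced (fun x y => \sum_(q <- v) inner x q.1 * inner y q.2).
Proof.
split=> [x x' y|x y y'|c x y]; rewrite -?big_split /=; apply: eq_bigr => q _.
- by rewrite innerDl mulrDl.
- by rewrite innerDl mulrDr.
- by rewrite !innerZl mulrCA mulrA.
Qed.

Lemma balanced_innerr x (y : K) :
  balanced (fun (x' : H) (y' : K) => inner x x' * inner y y').
Proof.
split=> [x1 x2 z|z x1 x2|c x1 z].
- by rewrite innerDr mulrDl.
- by rewrite innerDr mulrDr.
- by rewrite !innerZr mulrCA mulrA.
Qed.

Lemma gram_expand (m : nat) (e : 'I_m -> K) u v :
  orthonormal_family e -> expands e u -> expands e v ->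
  gram u v = \sum_(j < m) inner (coef u (e j)) (coef v (e j)).
Proof.
move=> oe ue ve; rewrite /gram (balanced_sum (balanced_gram v) ue).
apply: eq_bigr => j _; rewrite (balanced_sum (balanced_innerr _ _) ve).
rewrite -[RHS](sum_deltaM (fun i => inner (coef u (e j)) (coef v (e i)))).
by apply: eq_bigr => i _; rewrite oe eq_sym.
Qed.

Lemma gram2_expand (m : nat) (e : 'I_m -> K) u :
  orthonormal_family e -> expands e u ->
  gram2 u = \sum_(j < m) rnorm (coef u (e j)) ^+ 2.
Proof.
move=> oe ue; rewrite /gram2 (gram_expand oe ue ue) Re_sum.
by apply: eq_bigr => j _; rewrite inner_rnorm.
Qed.

Lemma exists_expansion (ys : seq K) : exists (m : nat) (e : 'I_m -> K),
  orthonormal_family e /\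
  forall u, {subset [seq q.2 | q <- u] <= ys} -> expands e u.
Proof.
have [m [e [oe se _]]] := gram_schmidt ys.
by exists m, e; split=> // u uy q qu; apply: se; apply: uy; apply: map_f.
Qed.

Lemma gram_ge0 u : 0 <= gram u u.
Proof.
have [m [e [oe ue]]] := exists_expansion [seq q.2 | q <- u].
rewrite (gram_expand oe (ue u _) (ue u _)) //.
by apply: sumr_ge0 => j _; apply: inner_ge0.
Qed.

Definition tensor_pre : prehilbert R :=
  PreHilbert [::] gram_cat gram_scale gram_conj gram_ge0.

Lemma gramE u : gram u u = (gram2 u)%:C.
Proof. exact: (@pformE R tensor_pre u). Qed.

Lemma gram2_ge0 u : 0 <= gram2 u.
Proof. exact: (@pnorm2_ge0 R tensor_pre u). Qed.

(** In an orthonormal expansion, a (x) 1 acts on each coefficient separately. *)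
Lemma gram2_mapl (a : H -> H) (M : R) u : linear a -> 0 <= M -> bounded_by M a ->
  gram2 [seq (a q.1, q.2) | q <- u] <= M ^+ 2 * gram2 u.
Proof.
move=> la M0 aM; have [m [e [oe ue]]] := exists_expansion [seq q.2 | q <- u].
have ue' : expands e [seq (a q.1, q.2) | q <- u].
  by apply: ue => y; rewrite -map_comp /=.
rewrite (gram2_expand oe ue') (gram2_expand oe (ue u _)) // mulr_sumr.
apply: ler_sum => j _.
have -> : coef [seq (a q.1, q.2) | q <- u] (e j) = a (coef u (e j)).
  rewrite /coef big_map (linear_op_sum la); apply: eq_bigr => q _ /=.
  by rewrite (linear_opZ la).
by rewrite -exprMn ler_pXn2r ?nnegrE ?mulr_ge0 ?rnorm_ge0.
Qed.

End FormalTensors.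

Section FlipTensors.
Variables (R : realType) (H K : hilbertType R).

Definition flip (T T' : Type) (u : seq (T * T')) := [seq (q.2, q.1) | q <- u].

Lemma flipK (T T' : Type) (u : seq (T * T')) : flip (flip u) = u.
Proof. by rewrite /flip -map_comp -[RHS]map_id; apply: eq_map => -[]. Qed.

Lemma gram_flip (u v : seq (H * K)) : gram (flip u) (flip v) = gram u v.
Proof.
rewrite /gram big_map; apply: eq_bigr => p _; rewrite big_map.
by apply: eq_bigr => q _; rewrite mulrC.
Qed.

Lemma gram2_flip (u : seq (H * K)) : gram2 (flip u) = gram2 u.
Proof. by rewrite /gram2 gram_flip. Qed.

End FlipTensors.

Lemma gram2_map (R : realType) (H K : hilbertType R) (a : H -> H) (b : K -> K)
    (M N : R) (u : seq (H * K)) :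
  linear a -> 0 <= M -> bounded_by M a -> linear b -> 0 <= N -> bounded_by N b ->
  gram2 [seq (a q.1, b q.2) | q <- u] <= (M * N) ^+ 2 * gram2 u.
Proof.
move=> la M0 aM lb N0 bN.
have -> : [seq (a q.1, b q.2) | q <- u] =
  [seq (a q.1, q.2) | q <- flip [seq (b q.1, q.2) | q <- flip u]].
  by rewrite /flip -!map_comp.
apply: le_trans (gram2_mapl _ la M0 aM) _; rewrite exprMn -[leRHS]mulrA.
rewrite ler_wpM2l ?sqr_ge0 // gram2_flip.
by apply: le_trans (gram2_mapl _ lb N0 bN) _; rewrite gram2_flip.
Qed.

Section MakeBilinear.
Variables (R : realType) (U V W : lmodType R[i]) (f : U -> V -> W).
Hypothesis hf : bilinear_for (GRing.Scale.Law.clone _ _ *:%R _)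
  (GRing.Scale.Law.clone _ _ *:%R _) f.

Definition bilinear_map := let _ := hf in f.
HB.instance Definition _ :=
  bilinear_isBilinear.Build R[i] U V W _ _ bilinear_map hf.

Lemma make_bilinear : exists g : {bilinear U -> V -> W}, forall x y, g x y = f x y.
Proof. by exists bilinear_map. Qed.

End MakeBilinear.

(** Complete the formal sums of pairs for the form gram, which is positive
   because it is a sum of squares in an orthonormal expansion. *)
Theorem hilbert_tensor_exists (R : realType) (H K : hilbertType R) :
  exists (L : hilbertType R) (t : {bilinear H -> K -> L}), hilbert_tensor t.
Proof.
have [L [iota [iD iZ ii id]]] := prehilbert_completion (tensor_pre H K).
have ieq (u v : seq (H * K)) : (forall w, gram u w = gram v w) -> iota u = iota v.
  move=> uv; apply/eqP; rewrite -subr_eq0 -rnorm_eq0 -sqrf_eq0.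
  rewrite -(inj_eq (@complexI R)) -inner_rnorm innerBl !innerBr.
  by rewrite !ii /= !uv subrr.
have hbil : bilinear_for (GRing.Scale.Law.clone _ _ *:%R _)
  (GRing.Scale.Law.clone _ _ *:%R _) (fun x y => iota [:: (x, y)]).
  split=> [y a x x'|x a y y'] /=.
    rewrite -iZ -iD; apply: ieq => w; rewrite /gram /= !big_cons big_nil /=.
    by rewrite !addr0 -big_split; apply: eq_bigr => q _; rewrite innerDl /= mulrDl.
  rewrite -iZ -iD; apply: ieq => w; rewrite /gram /= !big_cons big_nil /=.
  rewrite !addr0 -big_split; apply: eq_bigr => q _ /=.
  by rewrite innerDl !innerZl mulrDr; congr (_ + _); rewrite mulrCA mulrA.
have [t tE] := make_bilinear hbil.
exists L, t; split.
  move=> x x' y y'; rewrite !tE ii /= /gram !big_cons !big_nil /=.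
  by rewrite !addr0.
have tsE u : tensor_sum t u = iota u.
  elim: u => [|[x y] u IH]; rewrite /tensor_sum.
    rewrite big_nil; apply/esym/eqP; rewrite -rnorm_eq0 -sqrf_eq0.
    by rewrite -(inj_eq (@complexI R)) -inner_rnorm ii /= /gram big_nil.
  by rewrite big_cons -/(tensor_sum t u) IH /= tE -iD.
suff -> : tensor_sum t = iota by exact: id.
by apply/funext => u; apply: tsE.
Qed.

Section HilbertTensor.
Variables (R : realType) (H K L : hilbertType R) (t : {bilinear H -> K -> L}).
Hypothesis ht : hilbert_tensor t.
Implicit Types (u v : seq (H * K)).

Lemma inner_tensor x x' y y' : inner (t x y) (t x' y') = inner x x' * inner y y'.
Proof. by case: ht. Qed.

Lemma inner_tensor_sum u v : inner (tensor_sum t u) (tensor_sum t v) = gram u v.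
Proof.
rewrite /tensor_sum inner_suml; apply: eq_bigr => p _; rewrite inner_sumr.
by apply: eq_bigr => q _; rewrite inner_tensor.
Qed.

Lemma rnorm_tensor_sum u : rnorm (tensor_sum t u) ^+ 2 = gram2 u.
Proof. by apply: complexI; rewrite -inner_rnorm inner_tensor_sum gramE. Qed.

Lemma rnorm_tensor x y : rnorm (t x y) = rnorm x * rnorm y.
Proof.
apply/eqP; rewrite -(eqrXn2 (n := 2)) ?mulr_ge0 ?rnorm_ge0 //; apply/eqP.
by apply: complexI; rewrite -inner_rnorm inner_tensor exprMn rmorphM /= !inner_rnorm.
Qed.

Lemma tensor_sum_cat u v : tensor_sum t (u ++ v) = tensor_sum t u + tensor_sum t v.
Proof. by rewrite /tensor_sum big_cat. Qed.

Lemma tensor_sum_scale c u : tensor_sum t (tscale c u) = c *: tensor_sum t u.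
Proof.
rewrite /tensor_sum big_map scaler_sumr; apply: eq_bigr => q _ /=.
exact: linearZl_LR.
Qed.

Lemma dense_tensor_sum : dense (range (tensor_sum t)).
Proof. by case: ht. Qed.

Lemma inner_tensor_inj z z' :
  (forall x y, inner z (t x y) = inner z' (t x y)) -> z = z'.
Proof.
move=> h; apply: inner_inj => w; apply/eqP; rewrite -subr_eq0 -modulus_eq0.
rewrite -innerBl eq_le modulus_ge0 andbT; apply/ler_addgt0Pr => e e0; rewrite add0r.
have d0 : 0 < rnorm (z - z') + 1 by rewrite ltr_wpDl // rnorm_ge0.
have /dense_rnormP/(_ w _ (divr_gt0 e0 d0))[_ [u _ <-] wu] := dense_tensor_sum.
have -> : inner (z - z') w = inner (z - z') (w - tensor_sum t u).
  suff w0 : inner (z - z') (tensor_sum t u) = 0 by rewrite innerBr w0 subr0.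
  rewrite /tensor_sum inner_sumr big1 // => q _.
  by rewrite innerBl h subrr.
apply: le_trans (cauchy_schwarz _ _) _.
move: wu; rewrite ltr_pdivlMr //; have := rnorm_ge0 (z - z').
have := rnorm_ge0 (w - tensor_sum t u); nra.
Qed.

End HilbertTensor.

(** * Representations are contractive *)

Lemma power_large (R : realType) (x K : R) : 1 < x -> exists n, K < x ^+ n.
Proof.
move=> x1; have h0 : 0 < x - 1 by rewrite subr_gt0.
have bern n : 1 + n%:R * (x - 1) <= x ^+ n.
  elim: n => [|n IH]; first by rewrite mul0r addr0 expr0.
  have n0 : 0 <= n%:R :> R by rewrite ler0n.
  rewrite exprS -natr1; apply: le_trans (ler_wpM2l _ IH); last by lra.
  have := mulr_ge0 n0 (sqr_ge0 (x - 1)); nra.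
set b := Num.bound `|K / (x - 1)|; exists b.
apply: lt_le_trans (bern _); apply: (@lt_trans _ _ (b%:R * (x - 1))).
  by rewrite -ltr_pdivrMr // (le_lt_trans (ler_norm _)) // archi_boundP.
by rewrite ltrDr.
Qed.

Section CStarFacts.
Variables (R : realType) (A : cstarType R).
Implicit Types a b : A.

Lemma rnorm_cmul a b : rnorm (cmul a b) <= rnorm a * rnorm b.
Proof. by rewrite -lecR rmorphM /= -!normE_rnorm cmul_norm_le. Qed.

Lemma rnorm_cstar a : rnorm (cmul (star a) a) = rnorm a ^+ 2.
Proof. by apply: complexI; rewrite rmorphXn /= -!normE_rnorm cstar_identity. Qed.

Lemma star_add a b : star (a + b) = star a + star b.
Proof. exact: starD. Qed.

Lemma rnorm_star a : rnorm (star a) = rnorm a.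
Proof.
have le b : rnorm b <= rnorm (star b).
  have [->|b0] := eqVneq (rnorm b) 0; first exact: rnorm_ge0.
  have bp : 0 < rnorm b by rewrite lt_neqAle eq_sym b0 rnorm_ge0.
  by rewrite -(ler_pM2r bp) -expr2 -rnorm_cstar rnorm_cmul.
by apply/eqP; rewrite eq_le le -{2}[a]starK le.
Qed.

(** q is the sum of the powers of g.  Without a unit in A, it plays the role of
   (1 - g)^-1 - 1. *)
Lemma quasi_inverse (g : A) : rnorm g < 1 -> exists q, q = g + cmul g q.
Proof.
move=> g1; have [->|g0] := eqVneq g 0.
  by exists 0; rewrite linear0r addr0.
have gp : 0 < rnorm g by rewrite lt_neqAle eq_sym rnorm_eq0 g0 rnorm_ge0.
pose B := rnorm g / (1 - rnorm g).
have g1' : 0 < 1 - rnorm g by rewrite subr_gt0.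
have BE : B * (1 - rnorm g) = rnorm g by rewrite mulfVK // gt_eqF.
have B0 : 0 < B by rewrite divr_gt0.
pose q := fix q n := if n is n'.+1 then g + cmul g (q n') else 0.
have qS n : q n.+1 = g + cmul g (q n) by [].
have qB n : rnorm (q n) <= B.
  elim: n => [|n IH]; first by rewrite rnorm0 ltW.
  rewrite qS; have := rnormD g (cmul g (q n)); have := rnorm_cmul g (q n).
  by move: IH; nra.
have qd k n : rnorm (q (n + k)%N - q n) <= B * rnorm g ^+ n.
  elim: n => [|n IH]; first by rewrite add0n subr0 mulr1.
  rewrite addSn !qS opprD addrACA subrr add0r -linearBr.
  apply: le_trans (rnorm_cmul _ _) _.
  by rewrite exprS mulrCA ler_wpM2l // ltW.
have small (e : R) : 0 < e -> exists N, forall n, (N <= n)%N -> B * rnorm g ^+ n < e.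
  move=> e0; have [|N hN] := @power_large R (rnorm g)^-1 (B / e).
    by rewrite invf_gt1.
  exists N => n Nn; apply: (@le_lt_trans _ _ (B * rnorm g ^+ N)).
    by rewrite ler_wpM2l ?(ltW B0) // ler_wiXn2l // ltW.
  move: hN; rewrite exprVn ltr_pdivrMr // mulrC ltr_pdivlMr ?exprn_gt0 //.
have [|l ql] := @cauchy_seq_cvg R A q.
  move=> e e0; have [N hN] := small (e / 2) (divr_gt0 e0 (ltr0Sn R 1)).
  have near n : (N <= n)%N -> rnorm (q n - q N) < e / 2.
    by move=> Nn; rewrite -(subnKC Nn); apply: le_lt_trans (qd _ _) (hN N _).
  exists N => m n /near hm /near hn; have := rnorm_triangle (q N) (q m) (q n).
  by rewrite [rnorm (q N - _)]rnorm_distC; lra.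
exists l; apply: eq_rnorm_small => e e0.
have [N hN] := ql _ (divr_gt0 e0 (ltr0Sn R 1)).
have h1 := hN N (leqnn N); have h2 := hN N.+1 (leqnSn N).
have := rnorm_triangle (q N.+1) l (g + cmul g l).
rewrite qS opprD [g + _ + _]addrACA subrr add0r -linearBr.
have := rnorm_cmul g (q N - l); rewrite [rnorm (q N - _)]rnorm_distC -qS.
have := rnorm_ge0 (l - q N); nra.
Qed.

End CStarFacts.

Section RepresentationFacts.
Variables (R : realType) (A : cstarType R) (H : hilbertType R) (pi : A -> H -> H).
Hypothesis rpi : representation pi.
Implicit Types (a b : A) (x y : H).

Lemma rep_bounded a : bounded_operator (pi a). Proof. by case: rpi. Qed.
Lemma rep_linear a : linear (pi a). Proof. by case: (rep_bounded a). Qed.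

Lemma rep_linear_arg x : linear (pi^~ x).
Proof. by move=> c a b; case: rpi => _ -> _ _. Qed.

Lemma repM a b x : pi (cmul a b) x = pi a (pi b x).
Proof. by case: rpi => _ _ -> _. Qed.

Lemma rep_star a x y : inner (pi (star a) x) y = inner x (pi a y).
Proof. by case: rpi. Qed.

Lemma rep_adj a x y : inner (pi a x) y = inner x (pi (star a) y).
Proof. by rewrite -{1}[a]starK rep_star. Qed.

(** If |pi(a)|^2 exceeded |a|^2, then g = a* a / |pi(a)|^2 would have a
   quasi-inverse, so 1 - pi(g) would be bounded below; but pi(a) nearly attains
   its norm, at vectors that 1 - pi(g) nearly kills. *)
Theorem rep_contractive a x : rnorm (pi a x) <= rnorm a * rnorm x.
Proof.
have ba := rep_bounded a; set s := opnorm (pi a).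
have s_ge0 : 0 <= s := opnorm_ge0 ba.
suff sa : s <= rnorm a.
  by apply: le_trans (opnorm_bound ba x) _; rewrite ler_wpM2r // rnorm_ge0.
rewrite leNgt; apply/negP => sa.
have a0 := rnorm_ge0 a; have s0 : 0 < s by apply: le_lt_trans sa.
pose m := s ^+ 2; have m0 : 0 < m by rewrite exprn_gt0.
pose g := m^-1%:C *: cmul (star a) a.
have mi : modulus m^-1%:C = m^-1 by rewrite modulus_real // invr_ge0 ltW.
have gsa : star g = g by rewrite /g starZ conj_real starM starK.
have [|q qE] := @quasi_inverse R A g.
  by rewrite rnormZ mi rnorm_cstar mulrC ltr_pdivrMr // mul1r /m; nra.
pose Q := opnorm (pi (star q)).
have Q0 : 0 <= Q := opnorm_ge0 (rep_bounded _).
have below y : rnorm y <= (1 + Q) * rnorm (y - pi g y).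
  have {1}-> : y = (y - pi g y) + pi (star q) (y - pi g y).
    rewrite (linear_opB (rep_linear _)) -repM.
    have -> : pi (star q) y = pi g y + pi (cmul (star q) g) y.
      rewrite -(linear_opD (rep_linear_arg y)); congr (pi _ y).
      by rewrite {1}qE star_add starM gsa.
    by rewrite addrK subrK.
  apply: le_trans (rnormD _ _) _; rewrite mulrDl mul1r lerD2l.
  exact: opnorm_bound (rep_bounded _) _.
have adj y : rnorm (pi (star a) y) <= s * rnorm y.
  apply: rnorm_le_inner => [|z]; first by rewrite mulr_ge0 ?rnorm_ge0.
  rewrite rep_star; apply: le_trans (cauchy_schwarz _ _) _.
  by rewrite mulrC -mulrA [_ * rnorm z]mulrC mulrA ler_wpM2r ?rnorm_ge0 // opnorm_bound.
have gE y : pi g y = m^-1%:C *: pi (star a) (pi a y).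
  by rewrite /g (linear_opZ (rep_linear_arg y)) repM.
have key y : rnorm (y - pi g y) ^+ 2 <= rnorm y ^+ 2 - rnorm (pi a y) ^+ 2 / m.
  have -> : rnorm (y - pi g y) ^+ 2 =
      rnorm y ^+ 2 - 2 * (rnorm (pi a y) ^+ 2 / m) + rnorm (pi g y) ^+ 2.
    have gy : inner (pi g y) y = (rnorm (pi a y) ^+ 2 / m)%:C.
      by rewrite gE innerZl rep_star inner_rnorm -rmorphM /= mulrC.
    apply: complexI; rewrite -inner_rnorm innerBl !innerBr.
    rewrite [inner y (pi g y)]inner_conj gy conj_real !inner_rnorm.
    by rewrite -!rmorphB; congr (_ %:C); ring.
  have -> : rnorm (pi g y) = m^-1 * rnorm (pi (star a) (pi a y)) by rewrite gE rnormZ mi.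
  have h : (m^-1 * rnorm (pi (star a) (pi a y))) ^+ 2 <= rnorm (pi a y) ^+ 2 / m.
    apply: (@le_trans _ _ ((m^-1 * (s * rnorm (pi a y))) ^+ 2)).
      rewrite ler_pXn2r ?nnegrE ?mulr_ge0 ?invr_ge0 ?rnorm_ge0 ?(ltW m0) //.
      by rewrite ler_wpM2l ?invr_ge0 ?(ltW m0).
    rewrite !exprMn -/m le_eqVlt; apply/orP; left; apply/eqP.
    by field; rewrite gt_eqF.
  lra.
(* [below] and [key] bound |pi(a) y|^2 by k m |y|^2 with k = 1 - 1/(1 + Q)^2 < 1,
   whereas m is the square of the norm of pi(a). *)
pose C := 1 + Q; have C1 : 1 <= C by rewrite lerDl.
pose k := 1 - (C ^+ 2)^-1.
have C0 : 0 < C ^+ 2 by rewrite exprn_gt0 // (lt_le_trans ltr01).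
have k0 : 0 <= k by rewrite subr_ge0 invf_le1 // exprn_ege1.
have k1 : k < 1 by rewrite ltrBlDr ltrDl invr_gt0.
have : s <= s * Num.sqrt k.
  apply: opnorm_le => [|y]; first by rewrite mulr_ge0 ?sqrtr_ge0.
  apply: le_of_sqr; first by rewrite !mulr_ge0 ?sqrtr_ge0 ?rnorm_ge0.
  rewrite !exprMn sqr_sqrtr // -/m.
  have h1 : rnorm y ^+ 2 <= C ^+ 2 * rnorm (y - pi g y) ^+ 2.
    by rewrite -exprMn ler_pXn2r ?nnegrE ?mulr_ge0 ?rnorm_ge0 ?below // (le_trans ler01).
  have := le_trans h1 (ler_wpM2l (ltW C0) (key y)).
  rewrite -ler_pdivrMl // => h2.
  have : rnorm (pi a y) ^+ 2 / m <= k * rnorm y ^+ 2 by rewrite /k; lra.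
  by rewrite ler_pdivrMr //; lra.
have sk : Num.sqrt k < 1 by rewrite -[1]sqrtr1 ltr_sqrt.
by rewrite ler_pMr // leNgt sk.
Qed.

Lemma rep_bounded_by a : bounded_by (rnorm a) (pi a).
Proof. by move=> x; apply: rep_contractive. Qed.

End RepresentationFacts.

(** * Compressions by almost commuting projections *)

Section Compression.
Variables (R : realType) (A : cstarType R).

Definition compress (H : hilbertType R) (pi : A -> H -> H) (P : H -> H) :
  A -> H -> H := fun a x => P (pi a (P x)).

Definition good_pair (F : seq A) (eps : R) (H : hilbertType R)
    (pi : A -> H -> H) (P : H -> H) : Prop :=
  forall a, a \in F ->
    (forall x, rnorm (P (pi a x) - pi a (P x)) <= eps * rnorm x) /\
    exists2 x, rnorm x <= 1 & rnorm a - eps < rnorm (compress pi P a x).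

(** Inner quasidiagonality supplies pairs that are good for any finite set and
   any tolerance; a property is eventual when it holds along this net. *)
Definition eventually
    (Q : forall (H : hilbertType R), (A -> H -> H) -> (H -> H) -> Prop) : Prop :=
  exists (F : seq A) (eps : R), 0 < eps /\
    forall (H : hilbertType R) (pi : A -> H -> H) (P : H -> H),
      representation pi -> projection P -> good_pair F eps pi P -> Q H pi P.

Implicit Types Q : forall (H : hilbertType R), (A -> H -> H) -> (H -> H) -> Prop.

Lemma good_pair_sub (F F' : seq A) (eps eps' : R) (H : hilbertType R)
    (pi : A -> H -> H) (P : H -> H) :
  {subset F <= F'} -> eps' <= eps -> good_pair F' eps' pi P -> good_pair F eps pi P.
Proof.
move=> FF ee g a /FF /g[c [x x1 n]]; split=> [y|].
  by apply: le_trans (c y) _; rewrite ler_wpM2r // rnorm_ge0.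
by exists x => //; apply: le_lt_trans n; rewrite lerB.
Qed.

Lemma eventually_and Q Q' : eventually Q -> eventually Q' ->
  eventually (fun H pi P => Q H pi P /\ Q' H pi P).
Proof.
move=> [F [e [e0 h]]] [F' [e' [e0' h']]]; exists (F ++ F'), (Num.min e e').
split; first by rewrite lt_min e0.
move=> H pi P rpi pP g; split.
  apply: h => //; apply: good_pair_sub g; last by rewrite ge_min lexx.
  by move=> a aF; rewrite mem_cat aF.
apply: h' => //; apply: good_pair_sub g; last by rewrite ge_min lexx orbT.
by move=> a aF; rewrite mem_cat aF orbT.
Qed.

Lemma eventually_imp Q Q' : eventually Q ->
  (forall H pi P, representation pi -> projection P -> Q H pi P -> Q' H pi P) ->
  eventually Q'.
Proof.
move=> [F [e [e0 h]]] QQ; exists F, e; split=> // H pi P rpi pP g.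
by apply: QQ => //; apply: h.
Qed.

Lemma eventually_all (I : eqType) (s : seq I)
    (Q : I -> forall H : hilbertType R, (A -> H -> H) -> (H -> H) -> Prop) :
  (forall i, i \in s -> eventually (Q i)) ->
  eventually (fun H pi P => forall i, i \in s -> Q i H pi P).
Proof.
elim: s => [|i s IH] h; first by exists [::], 1.
have [|F [e [e0 g]]] := eventually_and (h i (mem_head _ _)) (IH _).
  by move=> j js; apply: h; rewrite inE js orbT.
exists F, e; split=> // H pi P rpi pP /(g H pi P rpi pP)[Qi Qs] j.
by rewrite inE => /orP[/eqP ->|/Qs].
Qed.

Lemma eventually_commute (a : A) (eps : R) : 0 < eps ->
  eventually (fun H pi P => forall x, rnorm (P (pi a x) - pi a (P x)) <= eps * rnorm x).
Proof.
move=> e0; exists [:: a], eps; split=> // H pi P _ _ /(_ a (mem_head _ _))[] //.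
Qed.

Lemma eventually_norming (a : A) (eps : R) : 0 < eps ->
  eventually (fun H pi P =>
    exists2 x, rnorm x <= 1 & rnorm a - eps < rnorm (compress pi P a x)).
Proof.
move=> e0; exists [:: a], eps; split=> // H pi P _ _ /(_ a (mem_head _ _))[] //.
Qed.

End Compression.

(** * Matrices over a C*-algebra and complete norming *)

Section VectorFamilies.
Variables (R : realType) (H : hilbertType R) (m : nat).
Implicit Types (xi eta : 'I_m -> H).

Definition vform xi eta : R[i] := \sum_(i < m) inner (xi i) (eta i).

Lemma vformD xi xi' eta :
  vform (fun i => xi i + xi' i) eta = vform xi eta + vform xi' eta.
Proof. by rewrite /vform -big_split; apply: eq_bigr => i _; rewrite innerDl. Qed.

Lemma vformZ c xi eta : vform (fun i => c *: xi i) eta = c * vform xi eta.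
Proof. by rewrite /vform mulr_sumr; apply: eq_bigr => i _; rewrite innerZl. Qed.

Lemma vform_conj xi eta : vform eta xi = Num.conj (vform xi eta).
Proof. by rewrite /vform rmorph_sum; apply: eq_bigr => i _; rewrite inner_conj. Qed.

Lemma vform_ge0 xi : 0 <= vform xi xi.
Proof. by apply: sumr_ge0 => i _; apply: inner_ge0. Qed.

Definition vec_pre : prehilbert R :=
  PreHilbert (fun _ => 0) vformD vformZ vform_conj vform_ge0.

Definition vnorm xi : R := @pnorm R vec_pre xi.

Lemma vnorm_ge0 xi : 0 <= vnorm xi. Proof. exact: pnorm_ge0. Qed.

Lemma vnormK xi : vnorm xi ^+ 2 = \sum_(i < m) rnorm (xi i) ^+ 2.
Proof.
rewrite pnormK /pnorm2 /= /vform Re_sum.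
by apply: eq_bigr => i _; rewrite inner_rnorm.
Qed.

Lemma vformE xi : vform xi xi = (vnorm xi ^+ 2)%:C.
Proof. by rewrite pnormK -(pformE (xi : vec_pre)). Qed.

Lemma vform_cauchy_schwarz xi eta : modulus (vform xi eta) <= vnorm xi * vnorm eta.
Proof. exact: (@pform_cauchy_schwarz R vec_pre). Qed.

Lemma vnorm_le_form xi (M : R) : 0 <= M ->
  (forall eta, modulus (vform xi eta) <= M * vnorm eta) -> vnorm xi <= M.
Proof.
move=> M0 /(_ xi); rewrite vformE modulus_real ?sqr_ge0 // expr2.
have [->//|x0] := eqVneq (vnorm xi) 0.
by rewrite ler_pM2r // lt_neqAle eq_sym x0 vnorm_ge0.
Qed.

Lemma rnorm_le_vnorm xi i : rnorm (xi i) <= vnorm xi.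
Proof.
apply: le_of_sqr; first exact: vnorm_ge0.
by rewrite vnormK (bigD1 i) //= lerDl sumr_ge0 // => j _; apply: sqr_ge0.
Qed.

Lemma vnorm_le_sum xi : vnorm xi <= \sum_(i < m) rnorm (xi i).
Proof.
apply: vnorm_le_form => [|eta]; first by apply: sumr_ge0 => i _; apply: rnorm_ge0.
apply: le_trans (modulus_sum _ _) _; rewrite mulr_suml; apply: ler_sum => i _.
apply: le_trans (cauchy_schwarz _ _) _.
by rewrite ler_wpM2l ?rnorm_ge0 ?rnorm_le_vnorm.
Qed.

Lemma vnormZ c xi : vnorm (fun i => c *: xi i) = modulus c * vnorm xi.
Proof. exact: (@pnormZ R vec_pre). Qed.

End VectorFamilies.

Section OperatorFamilies.
Variables (R : realType) (A : cstarType R) (H : hilbertType R).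

Record op_family (alpha : A -> H -> H) : Prop := {
  fam_linear : forall a, linear (alpha a);
  fam_linear_arg : forall x, linear (alpha^~ x)
}.

Definition mact (m : nat) (alpha : A -> H -> H) (X : 'I_m -> 'I_m -> A)
  (xi : 'I_m -> H) : 'I_m -> H := fun i => \sum_(j < m) alpha (X i j) (xi j).

Lemma mactZ (m : nat) (alpha : A -> H -> H) (X : 'I_m -> 'I_m -> A) c xi :
  op_family alpha ->
  mact alpha X (fun i => c *: xi i) = fun i => c *: mact alpha X xi i.
Proof.
move=> fa; apply/funext => i; rewrite /mact scaler_sumr.
by apply: eq_bigr => j _; rewrite (linear_opZ (fam_linear fa _)).
Qed.

Lemma rep_family (pi : A -> H -> H) : representation pi -> op_family pi.
Proof.
move=> rpi; split=> [a|x]; [exact: rep_linear|exact: rep_linear_arg].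
Qed.

Lemma compress_family (pi : A -> H -> H) (P : H -> H) :
  representation pi -> projection P -> op_family (compress pi P).
Proof.
move=> rpi [[lP _] _ _]; split=> [a c x y|x c a b]; rewrite /compress.
  by rewrite lP (rep_linear rpi) lP.
by rewrite (rep_linear_arg rpi) lP.
Qed.

End OperatorFamilies.

(** This is the matrix X* X. *)
Definition msquare (R : realType) (A : cstarType R) (m : nat)
  (X : 'I_m -> 'I_m -> A) : 'I_m -> 'I_m -> A :=
  fun i j => \sum_(k < m) cmul (star (X k i)) (X k j).

Section MatrixSquare.
Variables (R : realType) (A : cstarType R) (m : nat).
Implicit Types (X : 'I_m -> 'I_m -> A).

Lemma vform_msquare (H : hilbertType R) (pi : A -> H -> H) X (xi eta : 'I_m -> H) :
  representation pi ->
  vform (mact pi (msquare X) xi) eta = vform (mact pi X xi) (mact pi X eta).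
Proof.
move=> rpi; rewrite /vform.
rewrite (eq_bigr (fun i => \sum_(j < m) \sum_(k < m)
  inner (pi (X k j) (xi j)) (pi (X k i) (eta i)))); last first.
  move=> i _; rewrite inner_suml; apply: eq_bigr => j _.
  rewrite (linear_op_sum (rep_linear_arg rpi _)) inner_suml; apply: eq_bigr => k _.
  by rewrite repM // rep_star.
rewrite [RHS](eq_bigr (fun k => \sum_(i < m) \sum_(j < m)
  inner (pi (X k j) (xi j)) (pi (X k i) (eta i)))); last first.
  move=> k _; rewrite inner_sumr; apply: eq_bigr => i _.
  by rewrite inner_suml.
rewrite [RHS]exchange_big; apply: eq_bigr => i _.
by rewrite exchange_big.
Qed.

(** Since <X* X xi, xi> = |X xi|^2, the map X |-> X* X squares norms at unit
   vectors. *)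
Lemma vnorm_iter_msquare (H : hilbertType R) (pi : A -> H -> H) X (xi : 'I_m -> H) l :
  representation pi -> vnorm xi = 1 ->
  vnorm (mact pi X xi) ^+ (2 ^ l) <= vnorm (mact pi (iter l (@msquare R A m) X) xi).
Proof.
move=> rpi x1; elim: l => [|l IH]; first by rewrite expr1.
rewrite expnSr exprM iterS; set Y := iter l _ X in IH *.
apply: le_trans (_ : vnorm (mact pi Y xi) ^+ 2 <= _).
  by rewrite ler_pXn2r ?nnegrE ?exprn_ge0 ?vnorm_ge0.
have := vform_cauchy_schwarz (mact pi (msquare Y) xi) xi.
by rewrite vform_msquare // vformE modulus_real ?sqr_ge0 // x1 mulr1.
Qed.

(** P X* X P differs from (P X P)* (P X P) by P X* (1 - P) X P, and (1 - P) X P is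
   a commutator cut by P: compression is almost multiplicative along good
   pairs. *)
Lemma eventually_msquare X (M d : R) : 0 <= M -> 0 < d ->
  eventually (fun (H : hilbertType R) (pi : A -> H -> H) (P : H -> H) =>
    (forall xi, vnorm (mact (compress pi P) X xi) <= M * vnorm xi) ->
    forall xi, vnorm (mact (compress pi P) (msquare X) xi) <= (M ^+ 2 + d) * vnorm xi).
Proof.
move=> M0 d0; pose S := \sum_(i < m) \sum_(j < m) \sum_(k < m) rnorm (X k i).
have S0 : 0 <= S by do 3!apply: sumr_ge0 => ? _; apply: rnorm_ge0.
have e0 : 0 < d / (S + 1) by rewrite divr_gt0 // ltr_wpDl.
set e := d / (S + 1) in e0.
have eS : e * S <= d.
  have : d = e * (S + 1) by rewrite mulfVK // gt_eqF // ltr_wpDl.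
  by move: e0; nra.
have := @eventually_all R A _ [seq X ij.1 ij.2 | ij <- enum {: 'I_m * 'I_m}] _
  (fun a _ => eventually_commute a e0).
move=> ev; apply: (eventually_imp ev) => H pi P {ev} rpi pP comm XM xi.
have [[lP _] PP Ps] := pP.
apply: vnorm_le_form => [|eta].
  by rewrite mulr_ge0 ?vnorm_ge0 // addr_ge0 ?sqr_ge0 // ltW.
pose E i j k := inner (pi (X k j) (P (xi j)) - compress pi P (X k j) (xi j))
  (pi (X k i) (P (eta i))).
have -> : vform (mact (compress pi P) (msquare X) xi) eta =
  vform (mact (compress pi P) X xi) (mact (compress pi P) X eta) +
  \sum_(i < m) \sum_(j < m) \sum_(k < m) E i j k.
  have -> : vform (mact (compress pi P) (msquare X) xi) eta =
      vform (mact pi (msquare X) (P \o xi)) (P \o eta).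
    rewrite /vform; apply: eq_bigr => i _; rewrite !inner_suml.
    by apply: eq_bigr => j _; rewrite Ps.
  rewrite vform_msquare //.
  have -> : vform (mact (compress pi P) X xi) (mact (compress pi P) X eta) =
      vform (mact (compress pi P) X xi) (mact pi X (P \o eta)).
    apply: eq_bigr => i _; rewrite {2 3}/mact inner_sumr inner_sumr.
    apply: eq_bigr => j _; rewrite /mact !inner_suml; apply: eq_bigr => k _.
    by rewrite -Ps -[P (compress _ _ _ _)]/((P \o P) _) PP.
  apply/eqP; rewrite addrC -subr_eq; apply/eqP; rewrite /vform -sumrB.
  rewrite (eq_bigr (fun k => \sum_(i < m) \sum_(j < m) E i j k)); last first.
    move=> k _; rewrite -innerBl {3}/mact inner_sumr; apply: eq_bigr => i _.
    by rewrite /mact -sumrB inner_suml.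
  by rewrite exchange_big; apply: eq_bigr => i _; rewrite exchange_big.
apply: le_trans (modulusD _ _) _; rewrite !mulrDl lerD //.
  apply: le_trans (vform_cauchy_schwarz _ _) _.
  have := XM xi; have := XM eta.
  have := vnorm_ge0 (mact (compress pi P) X xi).
  have := vnorm_ge0 (mact (compress pi P) X eta).
  have := vnorm_ge0 xi; have := vnorm_ge0 eta.
  move=> h1 h2 h3 h4 h5 h6.
  have -> : M ^+ 2 * vnorm xi * vnorm eta = (M * vnorm xi) * (M * vnorm eta) by ring.
  by rewrite ler_pM.
apply: le_trans (_ : e * S * vnorm xi * vnorm eta <= _); last first.
  by rewrite !ler_wpM2r ?vnorm_ge0.
rewrite /S mulr_sumr !mulr_suml; apply: le_trans (modulus_sum _ _) _.
apply: ler_sum => i _; rewrite mulr_sumr !mulr_suml; apply: le_trans (modulus_sum _ _) _.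
apply: ler_sum => j _; rewrite mulr_sumr !mulr_suml; apply: le_trans (modulus_sum _ _) _.
apply: ler_sum => k _; apply: le_trans (cauchy_schwarz _ _) _.
have h1 : rnorm (pi (X k j) (P (xi j)) - compress pi P (X k j) (xi j)) <= e * vnorm xi.
  rewrite rnorm_distC /compress.
  have c1 : X k j \in [seq X ij.1 ij.2 | ij <- enum {: 'I_m * 'I_m}].
    by apply/mapP; exists (k, j) => //; rewrite mem_enum.
  have := comm _ c1 (P (xi j)).
  rewrite -[P (P (xi j))]/((P \o P) (xi j)) PP => h; apply: le_trans h _.
  rewrite ler_wpM2l ?(ltW e0) //; apply: le_trans (projection_le pP _) _.
  by rewrite mul1r rnorm_le_vnorm.
have h2 : rnorm (pi (X k i) (P (eta i))) <= rnorm (X k i) * vnorm eta.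
  apply: le_trans (rep_contractive rpi _ _) _; rewrite ler_wpM2l ?rnorm_ge0 //.
  by apply: le_trans (projection_le pP _) _; rewrite mul1r rnorm_le_vnorm.
apply: le_trans (ler_pM (rnorm_ge0 _) (rnorm_ge0 _) h1 h2) _.
by rewrite le_eqVlt; apply/orP; left; apply/eqP; ring.
Qed.

Lemma eventually_iter_msquare X (M d : R) l : 0 <= M -> 0 < d ->
  eventually (fun (H : hilbertType R) (pi : A -> H -> H) (P : H -> H) =>
    (forall xi, vnorm (mact (compress pi P) X xi) <= M * vnorm xi) ->
    forall xi, vnorm (mact (compress pi P) (iter l (@msquare R A m) X) xi) <=
      (M ^+ (2 ^ l) + d) * vnorm xi).
Proof.
move=> M0; elim: l d => [|l IH] d d0.
  exists [::], 1; split=> // H pi P _ _ _ h xi; apply: le_trans (h xi) _.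
  by rewrite ler_wpM2r ?vnorm_ge0 // expr1 lerDl ltW.
(* d' is such that (N + d')^2 <= N^2 + d / 2. *)
set N := M ^+ (2 ^ l) in IH; have N0 : 0 <= N by rewrite exprn_ge0.
have n0 : 0 < 2 * (2 * N + 1) by lra.
pose d' := Num.min 1 (d / (2 * (2 * N + 1))).
have d'0 : 0 < d' by rewrite lt_min ltr01 divr_gt0.
have d'1 : d' <= 1 by rewrite ge_min lexx.
have dd : d' * (2 * (2 * N + 1)) <= d by rewrite -ler_pdivlMr // ge_min lexx orbT.
have d2 : 0 < d / 2 by rewrite divr_gt0.
have Nd : 0 <= N + d' by rewrite addr_ge0 // ltW.
have := eventually_and (IH d' d'0) (eventually_msquare (iter l (@msquare R A m) X) Nd d2).
move=> ev; apply: (eventually_imp ev) => H pi P {ev} _ _ [h1 h2] /h1 /h2 h xi.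
apply: le_trans (h xi) _.
by rewrite ler_wpM2r ?vnorm_ge0 // expnSr exprM -/N; nra.
Qed.

(** Pairs that are norming on elements of A are norming on matrices over A.  The
   norm of a matrix and the largest norm of its entries agree up to the factor
   m^2; iterating X |-> X* X raises norms to the power 2^l, both for
   representations and, nearly, for compressions, which makes that factor
   irrelevant. *)
Theorem eventually_matrix_norming X (M : R) (H0 : hilbertType R)
    (rho : A -> H0 -> H0) (xi0 : 'I_m -> H0) :
  representation rho -> 0 < M -> M * vnorm xi0 < vnorm (mact rho X xi0) ->
  eventually (fun (H : hilbertType R) (pi : A -> H -> H) (P : H -> H) =>
    exists xi, M * vnorm xi < vnorm (mact (compress pi P) X xi)).
Proof.
move=> rrho M0 big.
have x0 : 0 < vnorm xi0.
  rewrite lt_neqAle vnorm_ge0 andbT eq_sym; apply/eqP => z0.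
  have : xi0 = fun i => (0 : R[i]) *: xi0 i.
    apply/funext => i; rewrite scale0r; apply/eqP; rewrite -rnorm_eq0.
    by rewrite eq_le rnorm_ge0 andbT -z0 rnorm_le_vnorm.
  move=> xE; move: big; rewrite z0 mulr0 xE mactZ; last exact: rep_family.
  by rewrite vnormZ modulus0 mul0r ltxx.
pose c : R[i] := (vnorm xi0)^-1%:C.
have cE : modulus c = (vnorm xi0)^-1 by rewrite modulus_real // invr_ge0 ltW.
pose xi1 i := c *: xi0 i.
have x1 : vnorm xi1 = 1 by rewrite vnormZ cE mulVf // gt_eqF.
set N := vnorm (mact rho X xi1).
have MN : M < N.
  rewrite /N /xi1 mactZ; last exact: rep_family.
  by rewrite vnormZ cE mulrC ltr_pdivlMr.
have [l hl] : exists l, (m * m)%:R * M ^+ (2 ^ l) < N ^+ (2 ^ l).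
  have [|n hn] := @power_large R (N / M) (m * m)%:R; first by rewrite ltr_pdivlMr ?mul1r.
  exists n; rewrite -ltr_pdivlMr ?exprn_gt0 // -expr_div_n.
  apply: lt_le_trans hn _; rewrite ler_weXn2l //; last by rewrite ltnW // ltn_expl.
  by rewrite ler_pdivlMr // mul1r ltW.
pose Y := iter l (@msquare R A m) X.
have [i [j Yij]] : exists i j, M ^+ (2 ^ l) < rnorm (Y i j).
  apply: contrapT => no.
  have le i j : rnorm (Y i j) <= M ^+ (2 ^ l).
    by rewrite leNgt; apply/negP => ij; apply: no; exists i, j.
  have : N ^+ (2 ^ l) <= (m * m)%:R * M ^+ (2 ^ l).
    apply: le_trans (vnorm_iter_msquare _ _ rrho x1) _.
    apply: le_trans (vnorm_le_sum _) _.
    have -> : (m * m)%:R * M ^+ (2 ^ l) = \sum_(i < m) \sum_(j < m) M ^+ (2 ^ l).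
      by rewrite !sumr_const !card_ord -mulrnA mulr_natl.
    apply: ler_sum => i _; apply: le_trans (rnorm_sum _ _) _.
    apply: ler_sum => j _; apply: le_trans (rep_contractive rrho _ _) _.
    apply: le_trans (le i j); rewrite ler_piMr ?rnorm_ge0 // -x1.
    exact: rnorm_le_vnorm.
  by rewrite leNgt hl.
pose g := (rnorm (Y i j) - M ^+ (2 ^ l)) / 2.
have g0 : 0 < g by rewrite divr_gt0 // subr_gt0.
have := eventually_and (eventually_iter_msquare X l (ltW M0) g0)
  (eventually_norming (Y i j) g0).
move=> ev; apply: (eventually_imp ev) => H pi P {ev} rpi pP [up [x xx1 hx]].
apply: contrapT => no.
have XM xi : vnorm (mact (compress pi P) X xi) <= M * vnorm xi.
  by rewrite leNgt; apply/negP => ij; apply: no; exists xi.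
have fc := compress_family rpi pP.
(* A vector supported at j sees the entry (i, j) alone, on which P is norming. *)
pose xi (k : 'I_m) : H := (k == j)%:R *: x.
have xiE : vnorm xi <= 1.
  apply: le_trans (vnorm_le_sum _) _; rewrite (bigD1 j) //= big1 ?addr0.
    by rewrite /xi eqxx scale1r.
  by move=> k /negbTE kj; rewrite /xi kj scale0r rnorm0.
have := rnorm_le_vnorm (mact (compress pi P) Y xi) i.
have -> : mact (compress pi P) Y xi i = compress pi P (Y i j) x.
  rewrite /mact (bigD1 j) //= big1 ?addr0; first by rewrite /xi eqxx scale1r.
  by move=> k /negbTE kj; rewrite /xi kj scale0r (linear_op0 (fam_linear fc _)).
move=> h1; have h2 := up XM xi; rewrite -/Y in h2.
have h3 : (M ^+ (2 ^ l) + g) * vnorm xi <= M ^+ (2 ^ l) + g.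
  by rewrite ler_piMr // addr_ge0 ?exprn_ge0 // ltW.
have gE : rnorm (Y i j) - g = M ^+ (2 ^ l) + g by rewrite /g; field.
have := le_trans (le_trans h1 h2) h3; rewrite -gE leNgt => /negP; exact.
Qed.

End MatrixSquare.

(** * Replacing one tensor factor by compressions *)

Section TensorApply.
Variables (R : realType) (A B : cstarType R) (H K : hilbertType R).
Implicit Types (s : seq (A * B)) (u v : seq (H * K)).

Definition tapply (alpha : A -> H -> H) (beta : B -> K -> K) s u : seq (H * K) :=
  [seq (alpha p.1 q.1, beta p.2 q.2) | p <- s, q <- u].

(** The matrix coefficient at (u, v) of the operator (alpha (x) beta)(s), written
   without any tensor product of Hilbert spaces. *)
Definition pairing (alpha : A -> H -> H) (beta : B -> K -> K) s u v : R[i] :=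
  gram (tapply alpha beta s u) v.

Lemma big_tapply (W : zmodType) (b : H -> K -> W) (alpha : A -> H -> H)
    (beta : B -> K -> K) s u :
  \sum_(q <- tapply alpha beta s u) b q.1 q.2 =
  \sum_(p <- s) \sum_(q <- u) b (alpha p.1 q.1) (beta p.2 q.2).
Proof. by rewrite /tapply big_allpairs_dep. Qed.

Lemma pairingE (alpha : A -> H -> H) (beta : B -> K -> K) s u v :
  pairing alpha beta s u v = \sum_(p <- s) \sum_(q <- u) \sum_(q' <- v)
    inner (alpha p.1 q.1) q'.1 * inner (beta p.2 q.2) q'.2.
Proof.
exact: (big_tapply (fun x y => \sum_(q' <- v) inner x q'.1 * inner y q'.2)).
Qed.

(** Over an orthonormal family of K, the operator becomes a matrix over A. *)
Definition slice_matrix (m : nat) (e : 'I_m -> K) (beta : B -> K -> K) s :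
  'I_m -> 'I_m -> A := fun i j => \sum_(p <- s) inner (beta p.2 (e j)) (e i) *: p.1.

Lemma pairing_slice (m : nat) (e : 'I_m -> K) (alpha : A -> H -> H)
    (beta : B -> K -> K) s u v :
  op_family alpha -> (forall b, linear (beta b)) -> expands e u -> expands e v ->
  pairing alpha beta s u v =
  vform (mact alpha (slice_matrix e beta s) (fun j => coef u (e j)))
    (fun i => coef v (e i)).
Proof.
move=> fa lb ue ve; rewrite pairingE.
rewrite (eq_bigr (fun p => \sum_(j < m) \sum_(i < m)
  inner (alpha p.1 (coef u (e j))) (coef v (e i)) * inner (beta p.2 (e j)) (e i))).
  rewrite /vform [RHS](eq_bigr (fun i => \sum_(j < m) \sum_(p <- s)
    inner (alpha p.1 (coef u (e j))) (coef v (e i)) * inner (beta p.2 (e j)) (e i))).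
    rewrite exchange_big /= [RHS]exchange_big /=; apply: eq_bigr => j _.
    by rewrite exchange_big.
  move=> i _; rewrite inner_suml; apply: eq_bigr => j _.
  rewrite (linear_op_sum (fam_linear_arg fa _)) inner_suml; apply: eq_bigr => p _.
  by rewrite (linear_opZ (fam_linear_arg fa _)) innerZl mulrC.
move=> p _.
have bal1 : balanced (fun x y => \sum_(q' <- v)
    inner (alpha p.1 x) q'.1 * inner (beta p.2 y) q'.2).
  split=> [x x' y|x y y'|c x y]; rewrite -?big_split /=; apply: eq_bigr => q _.
  - by rewrite (linear_opD (fam_linear fa _)) innerDl mulrDl.
  - by rewrite (linear_opD (lb _)) innerDl mulrDr.
  - by rewrite (linear_opZ (fam_linear fa _)) (linear_opZ (lb _)) !innerZl mulrCA mulrA.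
rewrite (balanced_sum bal1 ue); apply: eq_bigr => j _.
exact: (balanced_sum (balanced_innerr _ _) ve).
Qed.

Lemma vnorm_coef (m : nat) (e : 'I_m -> K) u :
  orthonormal_family e -> expands e u ->
  vnorm (fun j => coef u (e j)) = Num.sqrt (gram2 u).
Proof.
move=> oe ue; rewrite (gram2_expand oe ue) -vnormK sqrtr_sqr ger0_norm //.
exact: vnorm_ge0.
Qed.

Definition vec_tensor (m : nat) (e : 'I_m -> K) (xi : 'I_m -> H) : seq (H * K) :=
  [seq (xi j, e j) | j <- enum 'I_m].

Lemma coef_vec_tensor (m : nat) (e : 'I_m -> K) (xi : 'I_m -> H) j :
  orthonormal_family e -> coef (vec_tensor e xi) (e j) = xi j.
Proof.
move=> oe; rewrite /coef big_map big_enum /=.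
by rewrite (eq_bigr (fun i => (i == j)%:R *: xi i)) ?sum_delta // => i _; rewrite oe.
Qed.

Lemma expands_vec_tensor (m : nat) (e : 'I_m -> K) (xi : 'I_m -> H) :
  orthonormal_family e -> expands e (vec_tensor e xi).
Proof.
move=> oe _ /mapP[j _ ->] /=.
rewrite (eq_bigr (fun i => (i == j)%:R *: e i)) ?sum_delta // => i _.
by rewrite oe eq_sym.
Qed.

End TensorApply.

Lemma pairing_flip (R : realType) (A B : cstarType R) (H K : hilbertType R)
    (alpha : A -> H -> H) (beta : B -> K -> K) s u v :
  pairing beta alpha (flip s) (flip u) (flip v) = pairing alpha beta s u v.
Proof.
rewrite !pairingE big_map; apply: eq_bigr => p _; rewrite big_map.
apply: eq_bigr => q _; rewrite big_map; apply: eq_bigr => q' _.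
by rewrite mulrC.
Qed.

(** The pairing is the coefficient of a matrix over A, so that the norming
   property for matrices lets compressions replace the representation of A.
   Here beta is any family of linear maps, so that the theorem applies once more,
   with the factors exchanged, when beta is itself a compression. *)
Theorem eventually_half_compress (R : realType) (A B : cstarType R)
    (H K : hilbertType R) (rho : A -> H -> H) (beta : B -> K -> K)
    (s : seq (A * B)) (u v : seq (H * K)) (r : R) :
  representation rho -> (forall b, linear (beta b)) -> 0 < r ->
  r * Num.sqrt (gram2 u) * Num.sqrt (gram2 v) < modulus (pairing rho beta s u v) ->
  eventually (fun (H' : hilbertType R) (pi : A -> H' -> H') (P : H' -> H') =>
    exists u' v' : seq (H' * K), r * Num.sqrt (gram2 u') * Num.sqrt (gram2 v') <
      modulus (pairing (compress pi P) beta s u' v')).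
Proof.
move=> rrho lb r0.
have [m [e [oe ee]]] := exists_expansion H [seq q.2 | q <- u ++ v].
have ue : expands e u by apply: ee => y yu; rewrite map_cat mem_cat yu.
have ve : expands e v by apply: ee => y yv; rewrite map_cat mem_cat yv orbT.
rewrite (pairing_slice _ (rep_family rrho) lb ue ve).
rewrite -(vnorm_coef oe ue) -(vnorm_coef oe ve).
set X := slice_matrix e beta s; set xi := fun j => _; set eta := fun i => _.
move=> big.
have bigX : r * vnorm xi < vnorm (mact rho X xi).
  rewrite ltNge; apply/negP => le; move: big; rewrite ltNge => /negP; apply.
  apply: le_trans (vform_cauchy_schwarz _ _) _.
  by rewrite ler_wpM2r ?vnorm_ge0.
have [F [eps [eps0 h]]] := eventually_matrix_norming rrho r0 bigX.
exists F, eps; split=> // H' pi P rpi pP /(h H' pi P rpi pP)[xi' big'].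
set eta' := mact (compress pi P) X xi' in big'.
exists (vec_tensor e xi'), (vec_tensor e eta').
have xE : expands e (vec_tensor e xi') by apply: expands_vec_tensor.
have eE : expands e (vec_tensor e eta') by apply: expands_vec_tensor.
rewrite (pairing_slice _ (compress_family rpi pP) lb xE eE).
rewrite -(vnorm_coef oe xE) -(vnorm_coef oe eE).
have -> : (fun j => coef (vec_tensor e xi') (e j)) = xi'.
  by apply/funext => j; apply: coef_vec_tensor.
have -> : (fun j => coef (vec_tensor e eta') (e j)) = eta'.
  by apply/funext => j; apply: coef_vec_tensor.
rewrite -/X -/eta' vformE modulus_real ?sqr_ge0 // expr2 ltr_pM2r //.
by apply: le_lt_trans big'; rewrite mulr_ge0 ?vnorm_ge0 // ltW.
Qed.

(** * The essential subspace of a representation *)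

Section EssentialProjection.
Variables (R : realType) (A : cstarType R) (H : hilbertType R) (pi : A -> H -> H).
Hypothesis rpi : representation pi.
Implicit Types (u v : seq (A * H)) (x y l : H).

Definition act_sum u : H := \sum_(q <- u) pi q.1 q.2.

Definition act_scale (c : R[i]) u := [seq (c *: q.1, q.2) | q <- u].

Lemma act_sum_cat u v : act_sum (u ++ v) = act_sum u + act_sum v.
Proof. by rewrite /act_sum big_cat. Qed.

Lemma act_sum_scale c u : act_sum (act_scale c u) = c *: act_sum u.
Proof.
rewrite /act_sum big_map scaler_sumr; apply: eq_bigr => q _ /=.
by rewrite (linear_opZ (rep_linear_arg rpi _)).
Qed.

Definition act_form u v := inner (act_sum u) (act_sum v).

Lemma act_formD u v w : act_form (u ++ v) w = act_form u w + act_form v w.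
Proof. by rewrite /act_form act_sum_cat innerDl. Qed.

Lemma act_formZ c u w : act_form (act_scale c u) w = c * act_form u w.
Proof. by rewrite /act_form act_sum_scale innerZl. Qed.

Lemma act_form_conj u v : act_form v u = Num.conj (act_form u v).
Proof. exact: inner_conj. Qed.

Lemma act_form_ge0 u : 0 <= act_form u u.
Proof. exact: inner_ge0. Qed.

Definition act_pre : prehilbert R :=
  PreHilbert [::] act_formD act_formZ act_form_conj act_form_ge0.

Lemma act_pnorm u : @pnorm R act_pre u = rnorm (act_sum u).
Proof. exact: (hilbert_pnorm (act_sum u)). Qed.

(** Membership in the closed span of the range of the representation. *)
Definition essential x := forall e : R, 0 < e -> exists u, rnorm (x - act_sum u) < e.

Definition essential_part x l :=
  essential l /\ forall a y, inner (x - l) (pi a y) = 0.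

Lemma essential_lin c x y : essential x -> essential y -> essential (c *: x + y).
Proof.
move=> hx hy e e0; have c1 : 0 < modulus c + 1 by rewrite ltr_wpDl ?modulus_ge0.
have [u xu] := hx _ (divr_gt0 e0 (mulr_gt0 (ltr0Sn R 1) c1)).
have [v yv] := hy _ (divr_gt0 e0 (ltr0Sn R 1)).
exists (act_scale c u ++ v); rewrite act_sum_cat act_sum_scale opprD addrACA -scalerBr.
apply: le_lt_trans (rnormD _ _) _; rewrite rnormZ.
have dE : e = e / (2 * (modulus c + 1)) * (2 * (modulus c + 1)).
  by rewrite mulfVK // gt_eqF // mulr_gt0.
have := rnorm_ge0 (x - act_sum u); have := modulus_ge0 c.
move: xu dE; set d := e / (2 * _); set n := rnorm (x - _); move=> *; nra.
Qed.

Lemma essential_pi a x : essential (pi a x).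
Proof.
move=> e e0; exists [:: (a, x)].
by rewrite /act_sum big_cons big_nil addr0 subrr rnorm0.
Qed.

Lemma essential_orth x k : (forall a y, inner x (pi a y) = 0) -> essential k ->
  inner x k = 0.
Proof.
move=> xo hk; apply/eqP; rewrite -modulus_eq0 eq_le modulus_ge0 andbT.
apply/ler_addgt0Pr => e e0; rewrite add0r.
have x1 : 0 < rnorm x + 1 by rewrite ltr_wpDl ?rnorm_ge0.
have [u ku] := hk _ (divr_gt0 e0 x1).
have -> : inner x k = inner x (k - act_sum u).
  suff u0 : inner x (act_sum u) = 0 by rewrite innerBr u0 subr0.
  by rewrite /act_sum inner_sumr big1.
apply: le_trans (cauchy_schwarz _ _) _; move: ku; rewrite ltr_pdivlMr //.
have := rnorm_ge0 x; have := rnorm_ge0 (k - act_sum u); nra.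
Qed.

Lemma essential_part_uniq x l l' :
  essential_part x l -> essential_part x l' -> l = l'.
Proof.
move=> [hl ol] [hl' ol']; apply/eqP; rewrite -subr_eq0 -rnorm_eq0 -sqrf_eq0.
rewrite -(inj_eq (@complexI R)) -inner_rnorm; apply/eqP.
apply: essential_orth => [a y|].
  have -> : l - l' = (x - l') - (x - l) by rewrite opprB [RHS]addrC subrKA.
  by rewrite innerBl ol ol' subrr.
have := essential_lin (-1) hl' hl; by rewrite scaleN1r addrC.
Qed.

(** The functional u |-> <x, act_sum u> is nearly represented by formal sums,
   whose values converge to the orthogonal projection of x. *)
Lemma essential_part_ex x : exists l, essential_part x l.
Proof.
pose f (u : act_pre) := inner x (act_sum u).
have fD (u v : act_pre) : f (padd u v) = f u + f v by rewrite /f act_sum_cat innerDr.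
have fZ c (u : act_pre) : f (pscale c u) = Num.conj c * f u.
  by rewrite /f act_sum_scale innerZr.
have fM (u : act_pre) : modulus (f u) <= rnorm x * pnorm u.
  by rewrite act_pnorm cauchy_schwarz.
have near n : exists u : act_pre, forall v : act_pre,
    modulus (inner (x - act_sum u) (act_sum v)) <= n.+1%:R^-1 * rnorm (act_sum v).
  have n0 : 0 < (n.+1%:R^-1 : R) by rewrite invr_gt0.
  have [u hu] := near_representation fD fZ fM n0.
  by exists u => v; have := hu v; rewrite act_pnorm innerBl.
have [w hw] := choice near.
have wc m n : rnorm (act_sum (w m) - act_sum (w n)) <= m.+1%:R^-1 + n.+1%:R^-1.
  set d := act_sum (w m) - act_sum (w n).
  have dE : d = act_sum (w m ++ act_scale (-1) (w n)).
    by rewrite act_sum_cat act_sum_scale scaleN1r.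
  have [->|d0] := eqVneq (rnorm d) 0; first by rewrite addr_ge0 // invr_ge0.
  have dp : 0 < rnorm d by rewrite lt_neqAle eq_sym d0 rnorm_ge0.
  rewrite -(ler_pM2r dp) -expr2 -[leLHS](modulus_real (sqr_ge0 _)) -inner_rnorm.
  have {1}-> : d = (x - act_sum (w n)) - (x - act_sum (w m)).
    by rewrite opprB [RHS]addrC subrKA.
  rewrite innerBl; apply: le_trans (modulusD _ _) _; rewrite modulusN mulrDl addrC.
  by rewrite lerD // {1}dE dE.
have [|l hl] := @cauchy_seq_cvg R H (fun n => act_sum (w n)).
  by apply: (@cauchy_seq_rate R H _ 1) => m n; rewrite mul1r.
exists l; split=> [e e0|a y].
  by have [N /(_ N (leqnn N)) hN] := hl e e0; exists (w N).
apply/eqP; rewrite -modulus_eq0 eq_le modulus_ge0 andbT.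
apply/ler_addgt0Pr => e e0; rewrite add0r.
have p1 : 0 < rnorm (pi a y) + 1 by rewrite ltr_wpDl ?rnorm_ge0.
have d0 : 0 < e / (2 * (rnorm (pi a y) + 1)) by rewrite divr_gt0 // mulr_gt0.
have [N1 h1] := hl _ d0; have [N2 h2] := inv_nat_small d0.
pose n := maxn N1 N2.
have hn1 := h1 n (leq_maxl _ _); have hn2 := h2 n (leq_maxr _ _).
have -> : x - l = (x - act_sum (w n)) - (l - act_sum (w n)).
  by rewrite opprB addrA subrK.
rewrite innerBl; apply: le_trans (modulusD _ _) _; rewrite modulusN.
have h3 := hw n [:: (a, y)]; rewrite {2 3}/act_sum big_cons big_nil addr0 /= in h3.
have h4 := cauchy_schwarz (l - act_sum (w n)) (pi a y).
have dE : e = e / (2 * (rnorm (pi a y) + 1)) * (2 * (rnorm (pi a y) + 1)).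
  by rewrite mulfVK // gt_eqF // mulr_gt0.
have := rnorm_ge0 (pi a y); move: d0 hn1 hn2 h3 h4 dE.
set d := e / _; set r := n.+1%:R^-1; set p := rnorm (pi a y).
move=> d0 hn1 hn2 h3 h4 dE p0.
have h5 : r * p <= d * p by rewrite ler_wpM2r // ltW.
have h6 : rnorm (l - act_sum (w n)) * p <= d * p by rewrite ler_wpM2r // ltW.
rewrite dE; lra.
Qed.

Record essential_projection (E : H -> H) : Prop := {
  ess_projection : projection E;
  ess_piE : forall a x, pi a (E x) = pi a x;
  ess_Epi : forall a x, E (pi a x) = pi a x;
  ess_essential : forall x, essential (E x);
  ess_commutes : forall T, commutant (range pi) T -> forall x, T (E x) = E (T x)
}.

Lemma essential_projection_exists : exists E, essential_projection E.
Proof.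
have [E hE] := choice essential_part_ex.
have uniq x l : essential_part x l -> E x = l by apply: essential_part_uniq.
have orth x k : essential k -> inner (x - E x) k = 0.
  by move=> hk; apply: essential_orth => //; case: (hE x).
have lE : linear E.
  move=> c x y; apply: uniq; split.
    by apply: essential_lin; [case: (hE x)|case: (hE y)].
  move=> a z; have [_ ox] := hE x; have [_ oy] := hE y.
  have -> : c *: x + y - (c *: E x + E y) = c *: (x - E x) + (y - E y).
    by rewrite scalerBr opprD addrACA.
  by rewrite innerDl innerZl ox oy mulr0 addr0.
have EE x y : inner (E x) (E y) = inner x (E y).
  apply/esym/eqP; rewrite -subr_eq0 -innerBl; apply/eqP; apply: orth.
  by case: (hE y).
have Es x y : inner (E x) y = inner x (E y).
  by rewrite -EE [RHS]inner_conj EE -inner_conj.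
have EK x : E (E x) = E x.
  apply: uniq; split; first by case: (hE x).
  by move=> a y; rewrite subrr inner0l.
have bE : bounded_operator E.
  apply/bounded_operatorP; split=> //; exists 1 => // x; rewrite mul1r.
  have [->|p0] := eqVneq (rnorm (E x)) 0; first exact: rnorm_ge0.
  have pp : 0 < rnorm (E x) by rewrite lt_neqAle eq_sym p0 rnorm_ge0.
  rewrite -(ler_pM2r pp) -expr2 -[leLHS](modulus_real (sqr_ge0 _)) -inner_rnorm.
  by rewrite EE cauchy_schwarz.
have piE a x : pi a (E x) = pi a x.
  apply: inner_inj => z; rewrite !rep_adj //; apply/esym/eqP.
  by rewrite -subr_eq0 -innerBl; apply/eqP; apply: orth; apply: essential_pi.
exists E; split=> //.
- by split=> //; apply/funext => x; apply: EK.
- move=> a x; apply: uniq; split; first exact: essential_pi.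
  by move=> b y; rewrite subrr inner0l.
- by move=> x; case: (hE x).
move=> T [bT Tpi] x; apply/esym; apply: uniq; split.
  have /bounded_operatorP[lT [M M0 TM]] := bT.
  have M1 : 0 < M + 1 by rewrite ltr_wpDl.
  move=> e e0; have [hx _] := hE x; have [u xu] := hx _ (divr_gt0 e0 M1).
  exists [seq (q.1, T q.2) | q <- u].
  have -> : act_sum [seq (q.1, T q.2) | q <- u] = T (act_sum u).
    rewrite /act_sum big_map (linear_op_sum lT); apply: eq_bigr => q _ /=.
    have /(congr1 (fun f : H -> H => f q.2)) : T \o pi q.1 = pi q.1 \o T.
      by apply: Tpi; exists q.1.
    by move=> /= <-.
  rewrite -(linear_opB lT); apply: le_lt_trans (TM _) _.
  by move: xu; rewrite ltr_pdivlMr //; have := rnorm_ge0 (E x - act_sum u); nra.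
move=> a y; have [lT _] := bT; rewrite -(linear_opB lT) -{1}[a]starK -rep_adj //.
have /(congr1 (fun f : H -> H => f (x - E x))) : T \o pi (star a) = pi (star a) \o T.
  by apply: Tpi; exists (star a).
move=> /= <-; rewrite (linear_opB (rep_linear rpi _)) piE subrr (linear_op0 lT).
exact: inner0l.
Qed.

End EssentialProjection.

Lemma opnorm_gt (R : realType) (H : hilbertType R) (T : H -> H) (c : R) :
  c < opnorm T -> exists2 x, rnorm x <= 1 & c < rnorm (T x).
Proof.
move=> cT; apply: contrapT => no; move: cT; rewrite ltNge => /negP; apply.
apply: ge_sup; first by exists (rnorm (T 0)), 0 => //=; rewrite normr0 ler01.
move=> _ [x /= + <-]; rewrite rnorm_le1 => x1; rewrite leNgt; apply/negP => h.
by apply: no; exists x.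
Qed.

(** The projections may be taken inside the essential subspace: cutting P down
   by the projection E onto it changes neither commutators nor compressions, and
   P commutes with E because E lies in the commutant. *)
Theorem good_pair_exists (R : realType) (A : cstarType R) :
  inner_quasidiagonal A -> forall (F : seq A) (eps : R), 0 < eps ->
  exists (H : hilbertType R) (pi : A -> H -> H) (P E : H -> H),
    [/\ representation pi, projection P, finite_rank P, good_pair F eps pi P &
     [/\ bicommutant (range pi) P, essential_projection pi E,
         forall x, E (P x) = P x & forall x, P (E x) = P x]].
Proof.
move=> qd F eps eps0.
have [H [pi [P [rpi [pP fP] bicP hP]]]] := qd (size F) (tnth (in_tuple F)) eps eps0.
have [E hE] := essential_projection_exists rpi.
have [bE EE Es] := ess_projection hE.
have EK x : E (E x) = E x by rewrite -[E (E x)]/((E \o E) x) EE.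
have [bP PP Ps] := pP.
have PE x : P (E x) = E (P x).
  have [_ /(_ E)] := bicP; move=> h.
  have /(congr1 (fun f : H -> H => f x)) // : P \o E = E \o P.
  apply: h; split=> // _ [a _ <-]; apply/funext => z /=.
  by rewrite (ess_Epi hE) (ess_piE hE).
have cE a x : P (E (pi a x)) - pi a (P (E x)) = P (pi a x) - pi a (P x).
  by rewrite (ess_Epi hE) PE (ess_piE hE).
have zE a x : compress pi (P \o E) a x = compress pi P a x.
  by rewrite /compress /= PE PE (ess_piE hE) -PE (ess_Epi hE).
have bPE : bounded_operator (P \o E) by apply: bounded_operator_comp.
exists H, pi, (P \o E), E; split=> //.
- split=> //.
    by apply/funext => x /=; rewrite !PE EK -[P (P x)]/((P \o P) x) PP.
  by move=> x y /=; rewrite Ps Es PE.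
- have [n [v hv]] := fP; exists n, v => x /=; exact: hv.
- move=> a aF; have [k kE] : exists k, a = tnth (in_tuple F) k.
    by have /(tnthP (in_tuple F)) [k ->] : a \in in_tuple F by []; exists k.
  have [h1 h2] := hP k; rewrite -kE in h1 h2; split=> [x|].
    rewrite /= cE; have ba := rep_bounded rpi a.
    have bc : bounded_operator ((P \o pi a) \- (pi a \o P)).
      by apply: bounded_operatorB; apply: bounded_operator_comp.
    apply: le_trans (opnorm_bound bc x) _.
    by rewrite ler_wpM2r ?rnorm_ge0 // ltW.
  by have [x x1 hx] := opnorm_gt h2; exists x => //; rewrite zE.
split=> //.
- split=> // T cT; apply/funext => x /=.
  have [_ /(_ T cT)] := bicP => /(congr1 (fun f : H -> H => f (E x))) /= <-.
  by rewrite (ess_commutes hE cT).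
- by move=> x /=; rewrite PE EK.
- by move=> x /=; rewrite EK.
Qed.

(** * The tensor product of two representations *)

Lemma linear_extend (R : realType) (V : normedModType R[i])
    (W : completeNormedModType R[i]) (I : Type) (add : I -> I -> I)
    (scale : R[i] -> I -> I) (iota : I -> V) (f : I -> W) (M : R) :
  dense (range iota) -> 0 <= M ->
  (forall i j, iota (add i j) = iota i + iota j) ->
  (forall c i, iota (scale c i) = c *: iota i) ->
  (forall i j, f (add i j) = f i + f j) ->
  (forall c i, f (scale c i) = c *: f i) ->
  (forall i, rnorm (f i) <= M * rnorm (iota i)) ->
  exists g : V -> W, [/\ linear g, bounded_by M g & forall i, g (iota i) = f i].
Proof.
move=> dI M0 iD iZ fD fZ fM.
have [|g gf gM] := @lipschitz_extend R V W I iota f M dI M0.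
  move=> i j; have -> : f i - f j = f (add i (scale (-1) j)) by rewrite fD fZ scaleN1r.
  by have -> : iota i - iota j = iota (add i (scale (-1) j)) by rewrite iD iZ scaleN1r.
have gL : lipschitz_map g by exists M.
have addL (c : R[i]) (y : V) : lipschitz_map (fun x : V => g (c *: x + y)).
  exists (M * modulus c); first by rewrite mulr_ge0 ?modulus_ge0.
  move=> x x'; apply: le_trans (gM _ _) _.
  by rewrite opprD addrACA subrr addr0 -scalerBr rnormZ mulrA.
have addR (c : R[i]) (y : W) : lipschitz_map (fun x : V => c *: g x + y).
  exists (modulus c * M); first by rewrite mulr_ge0 ?modulus_ge0.
  move=> x x'; rewrite opprD addrACA subrr addr0 -scalerBr rnormZ -mulrA.
  by rewrite ler_wpM2l ?modulus_ge0.
have gl : linear g.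
  move=> c x y; apply: (lipschitz_eq_dense dI (addL c y) (addR c (g y))) => i {x}.
  have tL (w : V) : lipschitz_map (fun y : V => g (w + y)).
    exists M => // x x'; apply: le_trans (gM _ _) _.
    by rewrite opprD addrACA subrr add0r.
  have tR (w : W) : lipschitz_map (fun y : V => w + g y).
    by exists M => // x x'; rewrite opprD addrACA subrr add0r.
  apply: (lipschitz_eq_dense dI (tL _) (tR _)) => j {y}.
  by rewrite -iZ -iD !gf fD fZ.
exists g; split=> // x.
by have := gM x 0; rewrite (linear_op0 gl) !subr0.
Qed.

Section DenseTensors.
Variables (R : realType) (U V : lmodType R[i]) (W : normedModType R[i]).
Variable t : {bilinear U -> V -> W}.
Hypothesis dt : dense (range (tensor_sum t)).

Lemma dense_tensor_eq (W' : normedModType R[i]) (f g : W -> W') :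
  linear f -> linear g -> lipschitz_map f -> lipschitz_map g ->
  (forall x y, f (t x y) = g (t x y)) -> forall z, f z = g z.
Proof.
move=> lf lg cf cg fg; apply: (lipschitz_eq_dense dt cf cg) => u.
rewrite /tensor_sum (linear_op_sum lf) (linear_op_sum lg).
by apply: eq_bigr => q _; apply: fg.
Qed.

Lemma dense_tensor_vanish (h : W -> R[i]) (M : R) :
  (forall x y, h (x + y) = h x + h y) -> 0 <= M ->
  (forall x, modulus (h x) <= M * rnorm x) ->
  (forall x y, h (t x y) = 0) -> forall z, h z = 0.
Proof.
move=> hD M0 hM h0 z; apply/eqP; rewrite -modulus_eq0 eq_le modulus_ge0 andbT.
apply/ler_addgt0Pr => e e0; rewrite add0r.
have M1 : 0 < M + 1 by rewrite ltr_wpDl.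
have /dense_rnormP/(_ z _ (divr_gt0 e0 M1))[_ [u _ <-] zu] := dt.
have h00 : h 0 = 0 by apply: (addrI (h 0)); rewrite -hD !addr0.
have hu : h (tensor_sum t u) = 0.
  rewrite /tensor_sum; elim: u {zu} => [|q u IH]; first by rewrite big_nil.
  by rewrite big_cons hD h0 IH addr0.
have := hD (z - tensor_sum t u) (tensor_sum t u); rewrite subrK hu addr0 => ->.
apply: le_trans (hM _) _; move: zu; rewrite ltr_pdivlMr //.
have := rnorm_ge0 (z - tensor_sum t u); nra.
Qed.

End DenseTensors.

Section TensorOperator.
Variables (R : realType) (A B : cstarType R) (H K L : hilbertType R).
Variable th : {bilinear H -> K -> L}.
Hypothesis ht : hilbert_tensor th.
Implicit Types (s : seq (A * B)) (u v : seq (H * K)).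

Lemma tensor_map_le (a : H -> H) (b : K -> K) (M N : R) u :
  linear a -> 0 <= M -> bounded_by M a -> linear b -> 0 <= N -> bounded_by N b ->
  rnorm (tensor_sum th [seq (a q.1, b q.2) | q <- u]) <=
  M * N * rnorm (tensor_sum th u).
Proof.
move=> la M0 aM lb N0 bN; apply: le_of_sqr.
  by rewrite !mulr_ge0 ?rnorm_ge0.
rewrite exprMn !(rnorm_tensor_sum ht); exact: gram2_map.
Qed.

Lemma tapply_le (pi : A -> H -> H) (sigma : B -> K -> K) s u :
  representation pi -> representation sigma ->
  rnorm (tensor_sum th (tapply pi sigma s u)) <=
  (\sum_(p <- s) rnorm p.1 * rnorm p.2) * rnorm (tensor_sum th u).
Proof.
move=> rpi rsi; elim: s => [|p s IH].
  by rewrite /tapply /tensor_sum /= !big_nil rnorm0 mul0r.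
have -> : tapply pi sigma (p :: s) u =
  [seq (pi p.1 q.1, sigma p.2 q.2) | q <- u] ++ tapply pi sigma s u by [].
rewrite (tensor_sum_cat th) big_cons mulrDl; apply: le_trans (rnormD _ _) _.
apply: lerD => //; apply: tensor_map_le; rewrite ?rnorm_ge0 //.
- exact: rep_linear.
- exact: rep_bounded_by.
- exact: rep_linear.
- exact: rep_bounded_by.
Qed.

Lemma tensor_sum_tapply (pi : A -> H -> H) (sigma : B -> K -> K) s u :
  tensor_sum th (tapply pi sigma s u) =
  \sum_(q <- u) \sum_(p <- s) th (pi p.1 q.1) (sigma p.2 q.2).
Proof. by rewrite /tensor_sum (big_tapply th) exchange_big. Qed.

Lemma tensor_operator_sum (pi : A -> H -> H) (sigma : B -> K -> K) s (S : L -> L) u :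
  tensor_operator th pi sigma s S ->
  S (tensor_sum th u) = tensor_sum th (tapply pi sigma s u).
Proof.
move=> [[lS _] hS]; rewrite tensor_sum_tapply /tensor_sum (linear_op_sum lS).
by apply: eq_bigr => q _; apply: hS.
Qed.

Lemma tensor_operator_exists (pi : A -> H -> H) (sigma : B -> K -> K) s :
  representation pi -> representation sigma ->
  exists S, tensor_operator th pi sigma s S.
Proof.
move=> rpi rsi; pose f u := tensor_sum th (tapply pi sigma s u).
have M0 : 0 <= \sum_(p <- s) rnorm p.1 * rnorm p.2.
  by apply: sumr_ge0 => p _; rewrite mulr_ge0 ?rnorm_ge0.
have fD u v : f (u ++ v) = f u + f v by rewrite /f !tensor_sum_tapply big_cat.
have fZ c u : f (tscale c u) = c *: f u.
  rewrite /f !tensor_sum_tapply big_map scaler_sumr; apply: eq_bigr => q _ /=.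
  rewrite scaler_sumr; apply: eq_bigr => p _.
  by rewrite (linear_opZ (rep_linear rpi _)) linearZl_LR.
have [S [lS SM Sf]] := linear_extend (dense_tensor_sum ht) M0
  (tensor_sum_cat th) (tensor_sum_scale th) fD fZ
  (fun u => tapply_le s u rpi rsi).
exists S; split.
  by apply/bounded_operatorP; split=> //; exists (\sum_(p <- s) rnorm p.1 * rnorm p.2).
move=> x y; have := Sf [:: (x, y)].
by rewrite /f tensor_sum_tapply /tensor_sum !big_cons !big_nil !addr0.
Qed.

Lemma tensor_bounded_by (S : L -> L) (M : R) : bounded_operator S -> 0 <= M ->
  (forall u, rnorm (S (tensor_sum th u)) <= M * rnorm (tensor_sum th u)) ->
  bounded_by M S.
Proof.
move=> bS M0 SM z; apply/ler_addgt0Pr => e e0.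
have /bounded_operatorP[lS [N N0 SN]] := bS.
have d0 : 0 < M + N + 1 by rewrite ltr_wpDl // addr_ge0.
have /dense_rnormP/(_ z _ (divr_gt0 e0 d0))[_ [u _ <-] zu] := dense_tensor_sum ht.
have h1 := SM u.
have h2 := rnorm_diff_le (S z) (S (tensor_sum th u)); rewrite -(linear_opB lS) in h2.
have h3 := SN (z - tensor_sum th u).
have h4 := rnorm_diff_le (tensor_sum th u) z; rewrite rnorm_distC in h4.
move: zu; rewrite ltr_pdivlMr // => zu.
have := rnorm_ge0 (z - tensor_sum th u); nra.
Qed.

Lemma tensor_operator_opnorm (pi : A -> H -> H) (sigma : B -> K -> K) s (S : L -> L) :
  representation pi -> representation sigma -> tensor_operator th pi sigma s S ->
  opnorm S <= \sum_(p <- s) rnorm p.1 * rnorm p.2.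
Proof.
move=> rpi rsi hS; have M0 : 0 <= \sum_(p <- s) rnorm p.1 * rnorm p.2.
  by apply: sumr_ge0 => p _; rewrite mulr_ge0 ?rnorm_ge0.
apply: opnorm_le => //; apply: tensor_bounded_by => // [|u]; first by case: hS.
by rewrite (tensor_operator_sum u hS) tapply_le.
Qed.

End TensorOperator.

Section MinNorm.
Variables (R : realType) (A B : cstarType R).

Lemma le_min_norm (H K L : hilbertType R) (th : {bilinear H -> K -> L})
    (pi : A -> H -> H) (sigma : B -> K -> K) (s : seq (A * B)) (S : L -> L) :
  hilbert_tensor th -> representation pi -> representation sigma ->
  tensor_operator th pi sigma s S -> opnorm S <= min_norm s.
Proof.
move=> ht rpi rsi hS; apply: sup_upper_bound; last first.
  by exists H, K, L, th, pi, sigma, S.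
split; first by exists (opnorm S), H, K, L, th, pi, sigma, S.
exists (\sum_(p <- s) rnorm p.1 * rnorm p.2).
move=> _ [H' [K' [L' [t' [pi' [si' [S' [ht' rpi' rsi' hS' ->]]]]]]]].
exact: tensor_operator_opnorm hS'.
Qed.

(** A vector nearly attaining the norm may be taken in the algebraic tensor
   product, and paired with its image. *)
Lemma min_norm_gt (s : seq (A * B)) (r : R) : 0 <= r -> r < min_norm s ->
  exists (H K : hilbertType R) (pi : A -> H -> H) (sigma : B -> K -> K)
    (u v : seq (H * K)),
    [/\ representation pi, representation sigma &
      r * Num.sqrt (gram2 u) * Num.sqrt (gram2 v) < modulus (pairing pi sigma s u v)].
Proof.
move=> r0; rewrite /min_norm; set E := [set _ | _] => rE.
have [x Ex rx] : exists2 x, E x & r < x.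
  apply: contrapT => no; move: rE; rewrite ltNge => /negP; apply.
  have [E0|/set0P[x Ex]] := eqVneq E set0; first by rewrite E0 sup0.
  apply: ge_sup; first by exists x.
  by move=> y Ey; rewrite leNgt; apply/negP => ry; apply: no; exists y.
move: Ex => [H [K [L [th [pi [sigma [S [ht rpi rsi hS xE]]]]]]]].
rewrite {}xE in rx.
have [bS _] := hS; have /bounded_operatorP[lS [N N0 SN]] := bS.
have [z z1 hz] := opnorm_gt rx.
have ts_gram w : rnorm (tensor_sum th w) = Num.sqrt (gram2 w).
  by rewrite -(rnorm_tensor_sum ht) sqrtr_sqr ger0_norm ?rnorm_ge0.
have d0 : 0 < (rnorm (S z) - r) / (N + r + 1).
  by apply: divr_gt0; [rewrite subr_gt0|rewrite ltr_wpDl // addr_ge0].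
have /dense_rnormP/(_ z _ d0)[_ [u _ <-] zu] := dense_tensor_sum ht.
have big : r * rnorm (tensor_sum th u) < rnorm (S (tensor_sum th u)).
  have h1 := rnorm_diff_le (S z) (S (tensor_sum th u)); rewrite -(linear_opB lS) in h1.
  have h2 := SN (z - tensor_sum th u).
  have h3 := rnorm_diff_le (tensor_sum th u) z; rewrite rnorm_distC in h3.
  have D0 : 0 < N + r + 1 by rewrite ltr_wpDl // addr_ge0.
  move: zu; rewrite ltr_pdivlMr // => zu.
  have := rnorm_ge0 (z - tensor_sum th u); nra.
pose v := tapply pi sigma s u.
exists H, K, pi, sigma, u, v; split=> //.
rewrite -!ts_gram; have Sv : S (tensor_sum th u) = tensor_sum th v.
  exact: tensor_operator_sum hS.
rewrite /pairing -/v gramE modulus_real ?gram2_ge0 // -(rnorm_tensor_sum ht) expr2.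
rewrite ltr_pM2r -Sv //; apply: le_lt_trans big.
by rewrite mulr_ge0 ?rnorm_ge0.
Qed.

End MinNorm.

Section TensorRepresentation.
Variables (R : realType) (A B C : cstarType R) (t : {bilinear A -> B -> C}).
Hypothesis mt : min_tensor_product t.

Lemma min_cmul a a' b b' : cmul (t a b) (t a' b') = t (cmul a a') (cmul b b').
Proof. by case: mt. Qed.

Lemma min_star a b : star (t a b) = t (star a) (star b).
Proof. by case: mt. Qed.

Lemma min_dense : dense (range (tensor_sum t)).
Proof. by case: mt. Qed.

Lemma lipschitz_cmull (c : C) : lipschitz_map (fun d : C => cmul d c).
Proof.
exists (rnorm c); first exact: rnorm_ge0.
by move=> x y; rewrite -linearBl mulrC rnorm_cmul.
Qed.

Lemma lipschitz_cmulr (c : C) : lipschitz_map (cmul c).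
Proof.
exists (rnorm c); first exact: rnorm_ge0.
by move=> x y; rewrite -linearBr rnorm_cmul.
Qed.

Lemma lipschitz_comp (U V W : normedModType R[i]) (g : V -> W) (f : U -> V) :
  lipschitz_map g -> lipschitz_map f -> lipschitz_map (g \o f).
Proof.
move=> [M M0 gM] [N N0 fN]; exists (M * N); first exact: mulr_ge0.
by move=> x y; apply: le_trans (gM _ _) _; rewrite -mulrA ler_wpM2l.
Qed.

Variables (H K L : hilbertType R) (th : {bilinear H -> K -> L}).
Hypothesis ht : hilbert_tensor th.
Variables (pi : A -> H -> H) (sigma : B -> K -> K).
Hypotheses (rpi : representation pi) (rsi : representation sigma).

(** The minimal norm dominates the norm of pi (x) sigma on the algebraic tensor
   product, so that pi (x) sigma extends by density. *)
Lemma tensor_map_exists : exists Pi : C -> L -> L,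
  [/\ forall z, linear (Pi^~ z), forall c, linear (Pi c),
      forall c z, rnorm (Pi c z) <= rnorm c * rnorm z &
      forall a b x y, Pi (t a b) (th x y) = th (pi a x) (sigma b y)].
Proof.
have [S hS] := choice (fun s => tensor_operator_exists ht s rpi rsi).
have bS s : bounded_operator (S s) by case: (hS s).
have lS s : linear (S s) by case: (bS s).
have cS s : lipschitz_map (S s) by apply: bounded_operator_lip.
have Sxy s x y : S s (th x y) = \sum_(p <- s) th (pi p.1 x) (sigma p.2 y).
  by case: (hS s) => _ ->.
have S_le s z : rnorm (S s z) <= rnorm z * rnorm (tensor_sum t s).
  apply: le_trans (opnorm_bound (bS s) z) _; rewrite mulrC ler_wpM2l ?rnorm_ge0 //.
  by case: mt => _ _ -> _; apply: le_min_norm (hS s).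
have SD z s s' : S (s ++ s') z = S s z + S s' z.
  pose f z := S s z + S s' z.
  have lf : linear f by move=> c x y; rewrite /f !lS scalerDr addrACA.
  have cf : lipschitz_map f.
    have [M M0 SM] := cS s; have [N N0 SN] := cS s'.
    exists (M + N); first exact: addr_ge0.
    move=> x y; rewrite /f opprD addrACA mulrDl.
    by apply: le_trans (rnormD _ _) _; apply: lerD.
  apply: (dense_tensor_eq (dense_tensor_sum ht) (lS _) lf (cS _) cf) => x y.
  by rewrite /f !Sxy big_cat.
have SZ z c s : S [seq (c *: p.1, p.2) | p <- s] z = c *: S s z.
  pose f z := c *: S s z.
  have lf : linear f by move=> d x y; rewrite /f lS scalerDr !scalerA mulrC.
  have cf : lipschitz_map f.
    have [M M0 SM] := cS s; exists (modulus c * M); first by rewrite mulr_ge0 ?modulus_ge0.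
    by move=> x y; rewrite /f -scalerBr rnormZ -mulrA ler_wpM2l ?modulus_ge0.
  apply: (dense_tensor_eq (dense_tensor_sum ht) (lS _) lf (cS _) cf) => x y.
  rewrite /f !Sxy big_map scaler_sumr; apply: eq_bigr => p _ /=.
  by rewrite (linear_opZ (rep_linear_arg rpi _)) linearZl_LR.
have tD (s s' : seq (A * B)) : tensor_sum t (s ++ s') = tensor_sum t s + tensor_sum t s'.
  by rewrite /tensor_sum big_cat.
have tZ c (s : seq (A * B)) :
    tensor_sum t [seq (c *: p.1, p.2) | p <- s] = c *: tensor_sum t s.
  rewrite /tensor_sum big_map scaler_sumr; apply: eq_bigr => p _ /=.
  exact: linearZl_LR.
have ex z := linear_extend min_dense (rnorm_ge0 z) tD tZ (SD z) (SZ z) (S_le^~ z).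
have [Pi hPi] := choice ex.
have lPi z : linear (Pi z) by case: (hPi z).
have PiM z : bounded_by (rnorm z) (Pi z) by case: (hPi z).
have PiS z s : Pi z (tensor_sum t s) = S s z by case: (hPi z).
have cPi z : lipschitz_map (Pi z) := lipschitz_linear (lPi z) (rnorm_ge0 z) (PiM z).
exists (fun c z => Pi z c); split=> //.
- move=> c k z z'; move: c.
  pose f c := k *: Pi z c + Pi z' c.
  have cf : lipschitz_map f.
    have [M M0 SM] := cPi z; have [N N0 SN] := cPi z'.
    exists (modulus k * M + N); first by rewrite addr_ge0 ?mulr_ge0 ?modulus_ge0.
    move=> x y; rewrite /f opprD addrACA -scalerBr mulrDl.
    apply: le_trans (rnormD _ _) _; apply: lerD; rewrite // rnormZ -mulrA.
    by rewrite ler_wpM2l ?modulus_ge0.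
  by apply: (lipschitz_eq_dense min_dense (cPi _) cf) => s; rewrite /f !PiS lS.
- by move=> c z; rewrite mulrC; apply: PiM.
move=> a b x y; have <- : tensor_sum t [:: (a, b)] = t a b.
  by rewrite /tensor_sum big_cons big_nil addr0.
by rewrite PiS Sxy big_cons big_nil addr0.
Qed.

(** The algebraic identities hold on elementary tensors, hence everywhere by
   density in C and in L. *)
Theorem tensor_representation : exists Pi : C -> L -> L,
  representation Pi /\
  forall a b x y, Pi (t a b) (th x y) = th (pi a x) (sigma b y).
Proof.
have [Pi [lc lz Pile Pit]] := tensor_map_exists.
have bz c : bounded_by (rnorm c) (Pi c) by move=> z; apply: Pile.
have bc z : bounded_by (rnorm z) (Pi^~ z) by move=> c; rewrite mulrC; apply: Pile.
have cz c : lipschitz_map (Pi c) := lipschitz_linear (lz c) (rnorm_ge0 c) (bz c).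
have cc z : lipschitz_map (Pi^~ z) := lipschitz_linear (lc z) (rnorm_ge0 z) (bc z).
have PiM c d z : Pi (cmul c d) z = Pi c (Pi d z).
  move: c; apply: (dense_tensor_eq min_dense).
  - by move=> k x y; rewrite linearPl /= lc.
  - by move=> k x y; rewrite lc.
  - exact: (lipschitz_comp (cc z) (lipschitz_cmull d)).
  - exact: cc.
  move=> a b; move: d; apply: (dense_tensor_eq min_dense).
  - by move=> k x y; rewrite linearPr /= lc.
  - by move=> k x y; rewrite lc lz.
  - exact: (lipschitz_comp (cc z) (lipschitz_cmulr (t a b))).
  - exact: (lipschitz_comp (cz (t a b)) (cc z)).
  move=> a' b'; move: z; apply: (dense_tensor_eq (dense_tensor_sum ht)).
  - exact: lz.
  - by move=> k x y; rewrite !lz.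
  - exact: cz.
  - exact: (lipschitz_comp (cz _) (cz _)).
  by move=> x y; rewrite min_cmul !Pit !repM.
exists Pi; split=> //; split.
- move=> c; apply/bounded_operatorP; split=> //; exists (rnorm c) => //.
  exact: rnorm_ge0.
- by move=> k c d; apply/funext => z /=; rewrite lc.
- by move=> c d; apply/funext => z /=; apply: PiM.
move=> c z z'; apply/eqP; rewrite -subr_eq0; apply/eqP; move: c.
apply: (@dense_tensor_vanish R A B C t min_dense _ (2 * rnorm z * rnorm z')).
- move=> x y; rewrite star_add !(linear_opD (lc _)) innerDl innerDr; ring.
- by rewrite !mulr_ge0 ?rnorm_ge0.
- move=> c; apply: le_trans (modulusD _ _) _; rewrite modulusN.
  have h1 := cauchy_schwarz (Pi (star c) z) z'; have h2 := cauchy_schwarz z (Pi c z').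
  have h3 := Pile (star c) z; have h4 := Pile c z'; rewrite rnorm_star in h3.
  have := rnorm_ge0 z; have := rnorm_ge0 z'; nra.
move=> a b; rewrite min_star; move: z.
apply: (@dense_tensor_vanish R H K L th (dense_tensor_sum ht) _
  (rnorm (t (star a) (star b)) * rnorm z' + rnorm (t a b) * rnorm z')).
- move=> x y; rewrite (linear_opD (lz _)) !innerDl; ring.
- by rewrite addr_ge0 ?mulr_ge0 ?rnorm_ge0.
- move=> x; apply: le_trans (modulusD _ _) _; rewrite modulusN mulrDl.
  apply: lerD; apply: le_trans (cauchy_schwarz _ _) _.
    by rewrite mulrAC ler_wpM2r ?rnorm_ge0.
  by rewrite mulrC ler_wpM2r ?rnorm_ge0.
move=> x y; move: z'; apply: (@dense_tensor_vanish R H K L th (dense_tensor_sum ht) _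
  (rnorm (Pi (t (star a) (star b)) (th x y)) + rnorm (th x y) * rnorm (t a b))).
- move=> x' y'; rewrite (linear_opD (lz _)) !innerDr; ring.
- by rewrite addr_ge0 ?mulr_ge0 ?rnorm_ge0.
- move=> x'; apply: le_trans (modulusD _ _) _; rewrite modulusN mulrDl.
  apply: lerD; apply: le_trans (cauchy_schwarz _ _) _; rewrite // -mulrA.
  by rewrite ler_wpM2l ?rnorm_ge0.
move=> x' y'; rewrite !Pit !(inner_tensor ht) !rep_star //.
exact: subrr.
Qed.

End TensorRepresentation.

(** * Tensor products of finite-rank projections *)

Lemma orthonormal_projection (R : realType) (H : hilbertType R) (m : nat)
    (e : 'I_m -> H) : orthonormal_family e ->
  projection (fun x => \sum_(i < m) inner x (e i) *: e i) /\
  finite_rank (fun x => \sum_(i < m) inner x (e i) *: e i).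
Proof.
move=> oe; pose P x := \sum_(i < m) inner x (e i) *: e i.
have lP : linear P.
  move=> c x y; rewrite /P scaler_sumr -big_split; apply: eq_bigr => i _ /=.
  by rewrite innerDl innerZl scalerDl scalerA.
have Ps x y : inner (P x) y = inner x (P y).
  rewrite inner_suml inner_sumr; apply: eq_bigr => i _.
  by rewrite innerZl innerZr [inner (e i) y]inner_conj mulrC.
split; last first.
  by exists m, e => x; exists (fun i => inner x (e i)).
split=> //.
  apply/bounded_operatorP; split=> //; exists (\sum_(i < m) rnorm (e i) * rnorm (e i)).
    by apply: sumr_ge0 => i _; rewrite mulr_ge0 ?rnorm_ge0.
  move=> x; apply: le_trans (rnorm_sum _ _) _; rewrite mulr_suml.
  apply: ler_sum => i _; rewrite rnormZ mulrAC ler_wpM2r ?rnorm_ge0 //.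
  by rewrite mulrC cauchy_schwarz.
apply/funext => x; apply: eq_bigr => j _; congr (_ *: _).
rewrite inner_suml (eq_bigr (fun i => inner x (e i) * (i == j)%:R)) ?sum_deltaM //.
by move=> i _; rewrite innerZl oe.
Qed.

Theorem tensor_projection_exists (R : realType) (H K L : hilbertType R)
    (th : {bilinear H -> K -> L}) (P : H -> H) (Q : K -> K) :
  hilbert_tensor th -> projection P -> finite_rank P ->
  projection Q -> finite_rank Q ->
  exists PQ : L -> L, [/\ projection PQ, finite_rank PQ &
    forall x y, PQ (th x y) = th (P x) (Q y)].
Proof.
move=> ht pP fP pQ fQ.
have [m [e [oe _ eP]]] := projection_basis pP fP.
have [n [f [of' _ fQ']]] := projection_basis pQ fQ.
pose g (k : 'I_#|{: 'I_m * 'I_n}|) := th (e (enum_val k).1) (f (enum_val k).2).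
have og : orthonormal_family g.
  move=> k l; rewrite (inner_tensor ht) oe of' -natrM mulnb.
  by rewrite -(inj_eq enum_val_inj) -pair_eqE.
have [pg fg] := orthonormal_projection og.
exists (fun z => \sum_k inner z (g k) *: g k); split=> // x y.
rewrite -(big_enum_val (fun p : 'I_m * 'I_n =>
  inner (th x y) (th (e p.1) (f p.2)) *: th (e p.1) (f p.2))) /=.
rewrite -(pair_bigA _ (fun i j => inner (th x y) (th (e i) (f j)) *: th (e i) (f j))) /=.
rewrite eP fQ' linear_sumlz; apply: eq_bigr => i _.
rewrite linear_sumr; apply: eq_bigr => j _.
by rewrite (inner_tensor ht) [RHS]linearZr_LR /= linearZl_LR scalerA mulrC.
Qed.

Section Slices.
Variables (R : realType) (H K L : hilbertType R) (th : {bilinear H -> K -> L}).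
Hypothesis ht : hilbert_tensor th.

(** V is the adjoint of x |-> x (x) k. *)
Lemma slice_exists (k : K) : exists V : L -> H,
  [/\ linear V, bounded_by (rnorm k) V &
    forall z x, inner (V z) x = inner z (th x k)].
Proof.
have cD (u v : seq (H * K)) : coef (u ++ v) k = coef u k + coef v k.
  by rewrite /coef big_cat.
have cZ c (u : seq (H * K)) : coef (tscale c u) k = c *: coef u k.
  rewrite /coef big_map scaler_sumr; apply: eq_bigr => q _ /=.
  by rewrite !scalerA mulrC.
have ci (u : seq (H * K)) x : inner (coef u k) x = inner (tensor_sum th u) (th x k).
  rewrite /coef /tensor_sum !inner_suml; apply: eq_bigr => q _.
  by rewrite innerZl (inner_tensor ht) mulrC.
have cM (u : seq (H * K)) : rnorm (coef u k) <= rnorm k * rnorm (tensor_sum th u).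
  apply: rnorm_le_inner => [|x]; first by rewrite mulr_ge0 ?rnorm_ge0.
  rewrite ci; apply: le_trans (cauchy_schwarz _ _) _.
  by rewrite (rnorm_tensor ht) le_eqVlt; apply/orP; left; apply/eqP; ring.
have [V [lV VM Vc]] := linear_extend (dense_tensor_sum ht) (rnorm_ge0 k)
  (tensor_sum_cat th) (tensor_sum_scale th) cD cZ cM.
exists V; split=> // z x; apply/eqP; rewrite -subr_eq0; apply/eqP; move: z.
apply: (@dense_tensor_vanish R H K L th (dense_tensor_sum ht) _
  (rnorm k * rnorm x + rnorm (th x k))).
- move=> z z'; rewrite (linear_opD lV) !innerDl; ring.
- by rewrite addr_ge0 ?mulr_ge0 ?rnorm_ge0.
- move=> z; apply: le_trans (modulusD _ _) _; rewrite modulusN mulrDl.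
  apply: lerD; apply: le_trans (cauchy_schwarz _ _) _.
    by rewrite mulrAC ler_wpM2r ?rnorm_ge0.
  by rewrite mulrC.
move=> y y'; have <- : tensor_sum th [:: (y, y')] = th y y'.
  by rewrite /tensor_sum big_cons big_nil addr0.
by rewrite Vc ci subrr.
Qed.

(** The hypothesis on T says that its slice between k and k' commutes with pi(A);
   so this slice commutes with P. *)
Lemma slice_commute (A : cstarType R) (pi : A -> H -> H) (P : H -> H) (T : L -> L)
    (k k' : K) :
  representation pi -> bicommutant (range pi) P -> projection P ->
  bounded_operator T ->
  (forall a x x', inner (T (th (pi a x) k)) (th x' k') =
                  inner (T (th x k)) (th (pi (star a) x') k')) ->
  forall x x', inner (T (th (P x) k)) (th x' k') = inner (T (th x k)) (th (P x') k').
Proof.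
move=> rpi [_ cP] [_ _ Ps] /bounded_operatorP[lT [M M0 TM]] hT x x'.
have [V [lV VM Vi]] := slice_exists k'.
pose Tk x := V (T (th x k)).
have cTk : commutant (range pi) Tk.
  split.
    apply/bounded_operatorP; split.
      by move=> c y z; rewrite /Tk linearPl lT lV.
    exists (rnorm k' * M * rnorm k); first by rewrite !mulr_ge0 ?rnorm_ge0.
    move=> y; apply: le_trans (VM _) _; rewrite -!mulrA ler_wpM2l ?rnorm_ge0 //.
    by apply: le_trans (TM _) _; rewrite (rnorm_tensor ht) ler_wpM2l // mulrC.
  move=> _ [a _ <-]; apply/funext => y; apply: inner_inj => z /=.
  by rewrite Vi hT (rep_adj rpi) Vi.
have := cP Tk cTk => /(congr1 (fun f : H -> H => inner (f x) x')) /=.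
by rewrite Ps /Tk !Vi.
Qed.

Lemma flip_tensor : exists th' : {bilinear K -> H -> L},
  hilbert_tensor th' /\ forall x y, th' y x = th x y.
Proof.
have [|th' thE] := @make_bilinear R K H L (fun y x => th x y).
  split=> [x c y y'|y c x x'] /=; [exact: linearPr|exact: linearPl].
exists th'; split=> //; split.
  by move=> y y' x x'; rewrite !thE (inner_tensor ht) mulrC.
apply/dense_rnormP => z e e0.
have /dense_rnormP/(_ z _ e0)[_ [u _ <-] zu] := dense_tensor_sum ht.
exists (tensor_sum th u) => //; exists (flip u) => //.
by rewrite /tensor_sum big_map; apply: eq_bigr => q _; rewrite thE.
Qed.

End Slices.

(** * Tensor products of bicommutant projections *)

Lemma essential_vanish (R : realType) (B : cstarType R) (K : hilbertType R)
    (sigma : B -> K -> K) (h : K -> R[i]) (M : R) :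
  (forall x y, h (x + y) = h x + h y) -> 0 <= M ->
  (forall x, modulus (h x) <= M * rnorm x) ->
  (forall b y, h (sigma b y) = 0) -> forall k, essential sigma k -> h k = 0.
Proof.
move=> hD M0 hM h0 k hk; apply/eqP; rewrite -modulus_eq0 eq_le modulus_ge0 andbT.
apply/ler_addgt0Pr => e e0; rewrite add0r.
have M1 : 0 < M + 1 by rewrite ltr_wpDl.
have [u ku] := hk _ (divr_gt0 e0 M1).
have h00 : h 0 = 0 by apply: (addrI (h 0)); rewrite -hD !addr0.
have hu : h (act_sum sigma u) = 0.
  rewrite /act_sum; elim: u {ku} => [|q u IH]; first by rewrite big_nil.
  by rewrite big_cons hD h0 IH addr0.
have := hD (k - act_sum sigma u) (act_sum sigma u); rewrite subrK hu addr0 => ->.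
apply: le_trans (hM _) _; move: ku; rewrite ltr_pdivlMr //.
have := rnorm_ge0 (k - act_sum sigma u); nra.
Qed.

(** W a b stands for pi(a) (x) sigma(b), and T is an operator commuting with all
   of them.  Stated in this form, the situation is symmetric in the two factors:
   what follows is applied to the flipped tensor product as well. *)
Record tensor_commuting (R : realType) (A B : cstarType R) (H K L : hilbertType R)
    (th : {bilinear H -> K -> L}) (pi : A -> H -> H) (sigma : B -> K -> K)
    (W : A -> B -> L -> L) (T : L -> L) : Prop := {
  tc_W : forall a b x y, W a b (th x y) = th (pi a x) (sigma b y);
  tc_adj : forall a b z z', inner (W a b z) z' = inner z (W (star a) (star b) z');
  tc_T : forall a b z, T (W a b z) = W a b (T z)
}.

Section TensorCommutant.
Variables (R : realType) (A B : cstarType R) (H K L : hilbertType R).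
Variable th : {bilinear H -> K -> L}.
Hypothesis ht : hilbert_tensor th.
Variables (pi : A -> H -> H) (sigma : B -> K -> K).
Hypotheses (rpi : representation pi) (rsi : representation sigma).
Variables (W : A -> B -> L -> L) (T : L -> L).
Hypothesis hW : tensor_commuting th pi sigma W T.
Hypothesis bT : bounded_operator T.

Let F x y x' y' : R[i] := inner (T (th x y)) (th x' y').

Let lT : linear T. Proof. by case: bT. Qed.

Lemma tc_formDl x1 x2 y x' y' : F (x1 + x2) y x' y' = F x1 y x' y' + F x2 y x' y'.
Proof. by rewrite /F linearDl (linear_opD lT) innerDl. Qed.

Lemma tc_formDr x y1 y2 x' y' : F x (y1 + y2) x' y' = F x y1 x' y' + F x y2 x' y'.
Proof. by rewrite /F linearDr (linear_opD lT) innerDl. Qed.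

Lemma tc_formDl' x y x1 x2 y' : F x y (x1 + x2) y' = F x y x1 y' + F x y x2 y'.
Proof. by rewrite /F linearDl innerDr. Qed.

Lemma tc_formDr' x y x' y1 y2 : F x y x' (y1 + y2) = F x y x' y1 + F x y x' y2.
Proof. by rewrite /F linearDr innerDr. Qed.

Lemma tc_form_le x y x' y' :
  modulus (F x y x' y') <= opnorm T * rnorm x * rnorm y * rnorm x' * rnorm y'.
Proof.
apply: le_trans (cauchy_schwarz _ _) _.
have := opnorm_bound bT (th x y); rewrite !(rnorm_tensor ht) => h.
have -> : opnorm T * rnorm x * rnorm y * rnorm x' * rnorm y' =
  opnorm T * (rnorm x * rnorm y) * (rnorm x' * rnorm y') by ring.
by rewrite ler_wpM2r ?mulr_ge0 ?rnorm_ge0.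
Qed.

Lemma tc_adjr a b z z' : inner z (W a b z') = inner (W (star a) (star b) z) z'.
Proof. by rewrite (tc_adj hW) !starK. Qed.

(** The operator (1 (x) sigma(b1)) T (1 (x) sigma(b2)) commutes with pi(A) (x) 1:
   multiplied by pi(a) (x) 1 on either side, it is T (pi(a) (x) sigma(b1 b2)).  So
   its slices lie in the commutant of pi(A). *)
Lemma commute_left (P : H -> H) : bicommutant (range pi) P -> projection P ->
  forall x x' k k', essential sigma k -> essential sigma k' ->
  F (P x) k x' k' = F x k (P x') k'.
Proof.
move=> cP pP x x' k k' hk hk'.
have core b1 b2 y y' : F (P x) (sigma b2 y) x' (sigma b1 y') =
    F x (sigma b2 y) (P x') (sigma b1 y').
  apply: (slice_commute ht rpi cP pP bT) => a z z'.
  rewrite -(tc_W hW) (tc_T hW) (tc_adj hW) (tc_W hW).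
  rewrite -[in RHS](tc_W hW) [RHS]tc_adjr starK -[in RHS](tc_T hW) [in RHS](tc_W hW).
  rewrite -[in RHS](repM rsi) -[in RHS](tc_W hW) [in RHS](tc_T hW).
  rewrite [in RHS](tc_adj hW) [in RHS](tc_W hW).
  by rewrite starM starK (repM rsi).
have b0 := opnorm_ge0 bT.
have step b1 y' : F (P x) k x' (sigma b1 y') = F x k (P x') (sigma b1 y').
  apply/eqP; rewrite -subr_eq0; apply/eqP; move: k hk.
  pose c1 := opnorm T * rnorm (P x) * rnorm x' * rnorm (sigma b1 y').
  pose c2 := opnorm T * rnorm x * rnorm (P x') * rnorm (sigma b1 y').
  apply: (@essential_vanish _ _ _ _ _ (c1 + c2)).
  - move=> y1 y2; rewrite !tc_formDr; ring.
  - by rewrite addr_ge0 ?mulr_ge0 ?rnorm_ge0.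
  - move=> y; apply: le_trans (modulusD _ _) _; rewrite modulusN mulrDl /c1 /c2.
    apply: lerD; apply: le_trans (tc_form_le _ _ _ _) _;
      rewrite le_eqVlt; apply/orP; left; apply/eqP; ring.
  by move=> b2 y; rewrite core subrr.
apply/eqP; rewrite -subr_eq0; apply/eqP; move: k' hk'.
pose c1 := opnorm T * rnorm (P x) * rnorm k * rnorm x'.
pose c2 := opnorm T * rnorm x * rnorm k * rnorm (P x').
apply: (@essential_vanish _ _ _ _ _ (c1 + c2)).
- move=> y1 y2; rewrite !tc_formDr'; ring.
- by rewrite addr_ge0 ?mulr_ge0 ?rnorm_ge0.
- move=> y; apply: le_trans (modulusD _ _) _; rewrite modulusN mulrDl /c1 /c2.
  by apply: lerD; apply: tc_form_le.
by move=> b1 y'; rewrite step subrr.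
Qed.

Variables (E : H -> H) (E' : K -> K).
Hypotheses (hE : essential_projection pi E) (hE' : essential_projection sigma E').

(** T maps the essential subspace of pi (x) sigma into itself, and so does its
   adjoint: hence the next two identities. *)
Lemma essential_left h k x' y' : essential pi h -> essential sigma k ->
  F h k x' y' = F h k (E x') (E' y').
Proof.
move=> hh hk; have b0 := opnorm_ge0 bT.
have core a b z w : F (pi a z) (sigma b w) x' y' = F (pi a z) (sigma b w) (E x') (E' y').
  rewrite /F -(tc_W hW) (tc_T hW) !(tc_adj hW) !(tc_W hW).
  by rewrite (ess_piE hE) (ess_piE hE').
have step a z : F (pi a z) k x' y' = F (pi a z) k (E x') (E' y').
  apply/eqP; rewrite -subr_eq0; apply/eqP; move: k hk.
  pose c1 := opnorm T * rnorm (pi a z) * rnorm x' * rnorm y'.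
  pose c2 := opnorm T * rnorm (pi a z) * rnorm (E x') * rnorm (E' y').
  apply: (@essential_vanish _ _ _ _ _ (c1 + c2)).
  - move=> y1 y2; rewrite !tc_formDr; ring.
  - by rewrite addr_ge0 ?mulr_ge0 ?rnorm_ge0.
  - move=> y; apply: le_trans (modulusD _ _) _; rewrite modulusN mulrDl /c1 /c2.
    apply: lerD; apply: le_trans (tc_form_le _ _ _ _) _;
      rewrite le_eqVlt; apply/orP; left; apply/eqP; ring.
  by move=> b w; rewrite core subrr.
apply/eqP; rewrite -subr_eq0; apply/eqP; move: h hh.
pose c1 := opnorm T * rnorm k * rnorm x' * rnorm y'.
pose c2 := opnorm T * rnorm k * rnorm (E x') * rnorm (E' y').
apply: (@essential_vanish _ _ _ _ _ (c1 + c2)).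
- move=> y1 y2; rewrite !tc_formDl; ring.
- by rewrite addr_ge0 ?mulr_ge0 ?rnorm_ge0.
- move=> y; apply: le_trans (modulusD _ _) _; rewrite modulusN mulrDl /c1 /c2.
  apply: lerD; apply: le_trans (tc_form_le _ _ _ _) _;
    rewrite le_eqVlt; apply/orP; left; apply/eqP; ring.
by move=> a z; rewrite step subrr.
Qed.

Lemma essential_right x y h' k' : essential pi h' -> essential sigma k' ->
  F x y h' k' = F (E x) (E' y) h' k'.
Proof.
move=> hh hk; have b0 := opnorm_ge0 bT.
have core a b z w : F x y (pi a z) (sigma b w) = F (E x) (E' y) (pi a z) (sigma b w).
  rewrite /F -(tc_W hW) !tc_adjr -!(tc_T hW) !(tc_W hW).
  by rewrite (ess_piE hE) (ess_piE hE').
have step a z : F x y (pi a z) k' = F (E x) (E' y) (pi a z) k'.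
  apply/eqP; rewrite -subr_eq0; apply/eqP; move: k' hk.
  pose c1 := opnorm T * rnorm x * rnorm y * rnorm (pi a z).
  pose c2 := opnorm T * rnorm (E x) * rnorm (E' y) * rnorm (pi a z).
  apply: (@essential_vanish _ _ _ _ _ (c1 + c2)).
  - move=> y1 y2; rewrite !tc_formDr'; ring.
  - by rewrite addr_ge0 ?mulr_ge0 ?rnorm_ge0.
  - move=> w; apply: le_trans (modulusD _ _) _; rewrite modulusN mulrDl /c1 /c2.
    by apply: lerD; apply: tc_form_le.
  by move=> b w; rewrite core subrr.
apply/eqP; rewrite -subr_eq0; apply/eqP; move: h' hh.
pose c1 := opnorm T * rnorm x * rnorm y * rnorm k'.
pose c2 := opnorm T * rnorm (E x) * rnorm (E' y) * rnorm k'.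
apply: (@essential_vanish _ _ _ _ _ (c1 + c2)).
- move=> y1 y2; rewrite !tc_formDl'; ring.
- by rewrite addr_ge0 ?mulr_ge0 ?rnorm_ge0.
- move=> z; apply: le_trans (modulusD _ _) _; rewrite modulusN mulrDl /c1 /c2.
  apply: lerD; apply: le_trans (tc_form_le _ _ _ _) _;
    rewrite le_eqVlt; apply/orP; left; apply/eqP; ring.
by move=> a z; rewrite step subrr.
Qed.

End TensorCommutant.

(** P (x) Q is moved across T one factor at a time, on essential vectors, where
   slices are available; the conditions E P = P and E' Q = Q reduce everything to
   such vectors.  Without them the result fails: if pi is zero, P may be the
   identity, while the commutant of pi (x) sigma contains all bounded
   operators. *)
Theorem bicommutant_tensor (R : realType) (A B C : cstarType R)
    (t : {bilinear A -> B -> C}) (H K L : hilbertType R)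
    (th : {bilinear H -> K -> L}) (pi : A -> H -> H) (sigma : B -> K -> K)
    (Pi : C -> L -> L) (P E : H -> H) (Q E' : K -> K) (PQ : L -> L) :
  min_tensor_product t -> hilbert_tensor th ->
  representation pi -> representation sigma -> representation Pi ->
  (forall a b x y, Pi (t a b) (th x y) = th (pi a x) (sigma b y)) ->
  projection P -> bicommutant (range pi) P -> essential_projection pi E ->
  (forall x, E (P x) = P x) -> (forall x, P (E x) = P x) ->
  projection Q -> bicommutant (range sigma) Q -> essential_projection sigma E' ->
  (forall y, E' (Q y) = Q y) -> (forall y, Q (E' y) = Q y) ->
  projection PQ -> (forall x y, PQ (th x y) = th (P x) (Q y)) ->
  bicommutant (range Pi) PQ.
Proof.
move=> mt ht rpi rsi rPi Pit pP cP hE EP PE pQ cQ hE' EQ QE [bPQ _ PQs] PQt.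
split=> // T [bT cT].
have PiT c z : T (Pi c z) = Pi c (T z).
  have /(congr1 (fun f : L -> L => f z)) : T \o Pi c = Pi c \o T by apply: cT; exists c.
  by [].
pose W a b := Pi (t a b).
have hW : tensor_commuting th pi sigma W T.
  split=> [a b x y|a b z z'|a b z]; [exact: Pit| |exact: PiT].
  by rewrite /W (rep_adj rPi) (min_star mt).
have [th' [ht' th'E]] := flip_tensor ht.
have hW' : tensor_commuting th' sigma pi (fun b a => W a b) T.
  split=> [b a y x|b a z z'|b a z]; last exact: PiT.
    by rewrite !th'E; apply: Pit.
  exact: (tc_adj hW).
have essP x : essential pi (P x) by rewrite -EP; apply: (ess_essential hE).
have essQ y : essential sigma (Q y) by rewrite -EQ; apply: (ess_essential hE').
have key x y x' y' : inner (T (th (P x) (Q y))) (th x' y') =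
    inner (T (th x y)) (th (P x') (Q y')).
  rewrite (essential_left ht hW bT hE hE') // -(PE x).
  rewrite (commute_left ht rpi rsi hW bT cP pP) //; last exact: (ess_essential hE').
  rewrite PE -(QE y) -!th'E.
  rewrite (commute_left ht' rsi rpi hW' bT cQ pQ) //; last exact: (ess_essential hE).
  by rewrite QE !th'E -(essential_right ht hW bT hE hE').
have [lT _] := bT; have [lPQ _] := bPQ.
apply/funext; apply: (dense_tensor_eq (dense_tensor_sum ht)).
- by move=> c z z' /=; rewrite lT lPQ.
- by move=> c z z' /=; rewrite lPQ lT.
- exact/bounded_operator_lip/bounded_operator_comp.
- exact/bounded_operator_lip/bounded_operator_comp.
move=> x y /=; apply: (inner_tensor_inj ht) => x' y'.
by rewrite PQs !PQt key.
Qed.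

(** * Inner quasidiagonality of the minimal tensor product *)

Section FinalEstimates.
Variables (R : realType) (A B C : cstarType R) (t : {bilinear A -> B -> C}).
Variables (H K L : hilbertType R) (th : {bilinear H -> K -> L}).
Hypothesis ht : hilbert_tensor th.
Variables (pi : A -> H -> H) (sigma : B -> K -> K) (Pi : C -> L -> L).
Hypotheses (rpi : representation pi) (rsi : representation sigma).
Hypothesis rPi : representation Pi.
Hypothesis Pit : forall a b x y, Pi (t a b) (th x y) = th (pi a x) (sigma b y).
Variables (P : H -> H) (Q : K -> K) (PQ : L -> L).
Hypotheses (pP : projection P) (pQ : projection Q) (pPQ : projection PQ).
Hypothesis PQt : forall x y, PQ (th x y) = th (P x) (Q y).

Let bPQ : bounded_operator PQ. Proof. by case: pPQ. Qed.
Let lPQ : linear PQ. Proof. by case: bPQ. Qed.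
Let lP : linear P. Proof. by case: pP => -[]. Qed.
Let lQ : linear Q. Proof. by case: pQ => -[]. Qed.

(** [P (x) Q, a (x) b] = [P, a] (x) Q b + a P (x) [Q, b]. *)
Lemma tensor_commutator_le (a : A) (b : B) (e : R) : 0 <= e ->
  (forall x, rnorm (P (pi a x) - pi a (P x)) <= e * rnorm x) ->
  (forall y, rnorm (Q (sigma b y) - sigma b (Q y)) <= e * rnorm y) ->
  forall z, rnorm (PQ (Pi (t a b) z) - Pi (t a b) (PQ z)) <=
    e * (rnorm a + rnorm b) * rnorm z.
Proof.
move=> e0 hP hQ; have bW := rep_bounded rPi (t a b); have lW := rep_linear rPi (t a b).
apply: (tensor_bounded_by ht) (_ : bounded_operator (fun z => _ - _)) _ _.
- apply: (@bounded_operatorB _ _ (PQ \o Pi (t a b)) (Pi (t a b) \o PQ));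
    exact: bounded_operator_comp.
- by rewrite mulr_ge0 ?addr_ge0 ?rnorm_ge0.
move=> u; pose D x := P (pi a x) - pi a (P x); pose D' y := Q (sigma b y) - sigma b (Q y).
have lD : linear D.
  move=> c x y; rewrite /D (rep_linear rpi) !lP (rep_linear rpi).
  by rewrite scalerBr opprD addrACA.
have lD' : linear D'.
  move=> c x y; rewrite /D' (rep_linear rsi) !lQ (rep_linear rsi).
  by rewrite scalerBr opprD addrACA.
have lQs : linear (fun y => Q (sigma b y)).
  by move=> c x y; rewrite (rep_linear rsi) lQ.
have lpP : linear (fun x => pi a (P x)).
  by move=> c x y; rewrite lP (rep_linear rpi).
have bQs : bounded_by (rnorm b) (fun y => Q (sigma b y)).
  move=> y; apply: le_trans (projection_le pQ _) _; rewrite mul1r.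
  exact: rep_contractive.
have bpP : bounded_by (rnorm a) (fun x => pi a (P x)).
  move=> x; apply: le_trans (rep_contractive rpi _ _) _.
  by rewrite ler_wpM2l ?rnorm_ge0 // -[leRHS]mul1r; apply: projection_le.
have -> : PQ (Pi (t a b) (tensor_sum th u)) - Pi (t a b) (PQ (tensor_sum th u)) =
    tensor_sum th [seq (D q.1, Q (sigma b q.2)) | q <- u] +
    tensor_sum th [seq (pi a (P q.1), D' q.2) | q <- u].
  rewrite /tensor_sum !big_map (linear_op_sum lW) !(linear_op_sum lPQ) (linear_op_sum lW).
  rewrite -sumrB -big_split; apply: eq_bigr => q _ /=.
  by rewrite Pit !PQt Pit /D /D' linearBl linearBr addrA subrK.
apply: le_trans (rnormD _ _) _; rewrite mulrDr mulrDl [leRHS]addrC.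
have h1 := tensor_map_le ht u lD e0 hP lQs (rnorm_ge0 b) bQs.
have h2 := tensor_map_le ht u lpP (rnorm_ge0 a) bpP lD' e0 hQ.
by apply: lerD; rewrite // [e * _]mulrC.
Qed.

Lemma rep_tensor_sum s z : Pi (tensor_sum t s) z = \sum_(p <- s) Pi (t p.1 p.2) z.
Proof. by rewrite /tensor_sum (linear_op_sum (rep_linear_arg rPi z)). Qed.

Lemma tensor_sum_commutator_le (s : seq (A * B)) (e : R) : 0 <= e ->
  (forall p, p \in s -> forall x, rnorm (P (pi p.1 x) - pi p.1 (P x)) <= e * rnorm x) ->
  (forall p, p \in s ->
     forall y, rnorm (Q (sigma p.2 y) - sigma p.2 (Q y)) <= e * rnorm y) ->
  forall z, rnorm (PQ (Pi (tensor_sum t s) z) - Pi (tensor_sum t s) (PQ z)) <=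
    e * (\sum_(p <- s) (rnorm p.1 + rnorm p.2)) * rnorm z.
Proof.
move=> e0 hP hQ z; rewrite !rep_tensor_sum (linear_op_sum lPQ) -sumrB.
apply: le_trans (rnorm_sum _ _) _; rewrite mulr_sumr mulr_suml.
rewrite big_seq [leRHS]big_seq; apply: ler_sum => p ps.
by apply: tensor_commutator_le => // [x|y]; [apply: hP|apply: hQ].
Qed.

Lemma compress_tensor_sum (s : seq (A * B)) (u : seq (H * K)) :
  tensor_sum th (tapply (compress pi P) (compress sigma Q) s u) =
  PQ (Pi (tensor_sum t s) (PQ (tensor_sum th u))).
Proof.
rewrite rep_tensor_sum (linear_op_sum lPQ) {1}/tensor_sum (big_tapply th).
apply: eq_bigr => p _; rewrite /tensor_sum (linear_op_sum lPQ).
rewrite (linear_op_sum (rep_linear rPi _)) (linear_op_sum lPQ).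
by apply: eq_bigr => q _; rewrite PQt Pit PQt.
Qed.

(** The pairing with compressions is a matrix coefficient of the compression by
   P (x) Q, hence bounded by its norm. *)
Lemma compress_norm_gt (s : seq (A * B)) (u v : seq (H * K)) (r : R) :
  r * Num.sqrt (gram2 u) * Num.sqrt (gram2 v) <
    modulus (pairing (compress pi P) (compress sigma Q) s u v) ->
  r * rnorm (tensor_sum th u) <
    rnorm (PQ (Pi (tensor_sum t s) (PQ (tensor_sum th u)))).
Proof.
have ts_gram w : Num.sqrt (gram2 w) = rnorm (tensor_sum th w).
  by rewrite -(rnorm_tensor_sum ht) sqrtr_sqr ger0_norm ?rnorm_ge0.
rewrite !ts_gram /pairing -(inner_tensor_sum ht) compress_tensor_sum => big.
rewrite ltNge; apply/negP => le; move: big; rewrite ltNge => /negP; apply.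
apply: le_trans (cauchy_schwarz _ _) _.
by rewrite ler_wpM2r ?rnorm_ge0.
Qed.

End FinalEstimates.

Theorem proposition6p1 (R : realType) (A B C : cstarType R)
    (t : {bilinear A -> B -> C}%R) :
  min_tensor_product t ->
  inner_quasidiagonal A -> inner_quasidiagonal B -> inner_quasidiagonal C.
Proof.
move=> mt qA qB n c eps eps0.
have d0 : 0 < eps / 8 by rewrite divr_gt0.
have near j : exists s, rnorm (c j - tensor_sum t s) < eps / 8.
  have /dense_rnormP/(_ (c j) _ d0)[_ [s _ <-] cs] := min_dense mt.
  by exists s.
have [s hs] := choice near.
pose r j := rnorm (tensor_sum t (s j)) - eps / 8.
pose M := \sum_(j < n) (\sum_(p <- s j) (rnorm p.1 + rnorm p.2)) + 1.
have sum0 j : 0 <= \sum_(p <- s j) (rnorm p.1 + rnorm p.2).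
  by apply: sumr_ge0 => p _; rewrite addr_ge0 ?rnorm_ge0.
have M0 : 0 < M by rewrite ltr_wpDl // sumr_ge0.
have leM j : \sum_(p <- s j) (rnorm p.1 + rnorm p.2) <= M.
  apply: le_trans (_ : \sum_(j < n) (\sum_(p <- s j) (rnorm p.1 + rnorm p.2)) <= M).
    by rewrite (bigD1 j) //= lerDl sumr_ge0.
  by rewrite lerDl.
pose e1 := eps / 8 / M.
have e10 : 0 < e1 by rewrite divr_gt0.
have e1M : e1 * M = eps / 8 by rewrite mulfVK // gt_eqF.
(* Good pairs for A: the norm of each [tensor_sum t (s j)] is nearly attained
   with the compression of A and some representation of B. *)
have evA1 := @eventually_all R A _ (enum 'I_n) (fun j (H : hilbertType R) pi P =>
   0 < r j -> exists (K0 : hilbertType R) (tau : B -> K0 -> K0) (u v : seq (H * K0)),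
     representation tau /\
     r j * Num.sqrt (gram2 u) * Num.sqrt (gram2 v) <
       modulus (pairing (compress pi P) tau (s j) u v)).
have [|FA [eA [eA0 hA]]] := eventually_and (evA1 _) (@eventually_all R A _
  (flatten [seq s j | j <- enum 'I_n])
  (fun p (H : hilbertType R) pi P =>
     forall x, rnorm (P (pi p.1 x) - pi p.1 (P x)) <= e1 * rnorm x)
  (fun p _ => eventually_commute p.1 e10)).
  move=> j _; have [rj|rj] := ltP 0 (r j); last by exists [::], 1; split.
  have rlt : r j < min_norm (s j).
    case: mt => _ _ <- _; rewrite /r; lra.
  have [H0 [K0 [rho [tau [u [v [rrho rtau big]]]]]]] := min_norm_gt (ltW rj) rlt.
  have ev := eventually_half_compress rrho (rep_linear rtau) rj big.
  apply: (eventually_imp ev) => H pi P _ _ [u' [v' uv]] _.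
  by exists K0, tau, u', v'.
have [H [pi [P [E [rpi pP fP gP [cP hE EP PE]]]]]] := good_pair_exists qA FA eA0.
have [normA commA] := hA H pi P rpi pP gP.
(* Good pairs for B, against the compression of A just chosen. *)
have evB1 := @eventually_all R B _ (enum 'I_n) (fun j (K : hilbertType R) sigma Q =>
   0 < r j -> exists u v : seq (K * H),
     r j * Num.sqrt (gram2 u) * Num.sqrt (gram2 v) <
       modulus (pairing (compress sigma Q) (compress pi P) (flip (s j)) u v)).
have [|FB [eB [eB0 hB]]] := eventually_and (evB1 _) (@eventually_all R B _
  (flatten [seq s j | j <- enum 'I_n])
  (fun p (K : hilbertType R) sigma Q =>
     forall x, rnorm (Q (sigma p.2 x) - sigma p.2 (Q x)) <= e1 * rnorm x)
  (fun p _ => eventually_commute p.2 e10)).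
  move=> j jn; have [rj|rj] := ltP 0 (r j); last by exists [::], 1; split.
  have [K0 [tau [u [v [rtau big]]]]] := normA j jn rj.
  rewrite -(pairing_flip (compress pi P)) -(gram2_flip u) -(gram2_flip v) in big.
  have ev := eventually_half_compress rtau (fam_linear (compress_family rpi pP)) rj big.
  by apply: (eventually_imp ev).
have [K [sigma [Q [E' [rsi pQ fQ gQ [cQ hE' EQ QE]]]]]] := good_pair_exists qB FB eB0.
have [normB commB] := hB K sigma Q rsi pQ gQ.
have [L [th ht]] := hilbert_tensor_exists H K.
have [PQ [pPQ fPQ PQt]] := tensor_projection_exists ht pP fP pQ fQ.
have [Pi [rPi Pit]] := tensor_representation mt ht rpi rsi.
have [bPQ _ _] := pPQ; have [lPQ _] := bPQ.
exists L, Pi, PQ; split=> //.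
  exact: (bicommutant_tensor mt ht rpi rsi rPi Pit pP cP hE EP PE pQ cQ hE' EQ QE pPQ PQt).
move=> j; have jn : j \in enum 'I_n by rewrite mem_enum.
have sS p : p \in s j -> p \in flatten [seq s j | j <- enum 'I_n].
  by move=> ps; apply/flattenP; exists (s j) => //; apply: map_f.
set z := tensor_sum t (s j).
have cz x : Pi (c j) x = Pi (c j - z) x + Pi z x.
  by rewrite -(linear_opD (rep_linear_arg rPi x)) subrK.
have small x : rnorm (Pi (c j - z) x) <= eps / 8 * rnorm x.
  apply: le_trans (rep_contractive rPi _ _) _.
  by rewrite ler_wpM2r ?rnorm_ge0 // ltW.
have PQ1 x : rnorm (PQ x) <= rnorm x by rewrite -[leRHS]mul1r; apply: projection_le.
split.
  apply: le_lt_trans (_ : eps / 2 < eps); last by lra.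
  apply: opnorm_le => [|x /=]; first by rewrite ltW // divr_gt0.
  have -> : PQ (Pi (c j) x) - Pi (c j) (PQ x) = (PQ (Pi (c j - z) x) - Pi (c j - z) (PQ x))
      + (PQ (Pi z x) - Pi z (PQ x)).
    by rewrite !cz (linear_opD lPQ) opprD addrACA.
  have h1 := rnormD (PQ (Pi (c j - z) x) - Pi (c j - z) (PQ x)) (PQ (Pi z x) - Pi z (PQ x)).
  have h2 := rnormD (PQ (Pi (c j - z) x)) (- Pi (c j - z) (PQ x)).
  rewrite rnormN in h2.
  have h3 := le_trans (PQ1 _) (small x).
  have h4 := small (PQ x); have h5 := PQ1 x.
  have h6 := tensor_sum_commutator_le ht rpi rsi rPi Pit pP pQ pPQ PQt (ltW e10)
    (fun p ps => commA p (sS p ps)) (fun p ps => commB p (sS p ps)) x.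
  have h7 : e1 * (\sum_(p <- s j) (rnorm p.1 + rnorm p.2)) * rnorm x <= eps / 8 * rnorm x.
    by rewrite -e1M ler_wpM2r ?rnorm_ge0 // ler_wpM2l // ltW.
  rewrite -/z in h6.
  have := rnorm_ge0 x; nra.
have bc : bounded_operator (PQ \o Pi (c j) \o PQ).
  by do 2?apply: bounded_operator_comp => //; apply: rep_bounded.
have cle := rnorm_diff_le (c j) z; have csmall := hs j; rewrite -/z in csmall.
have [rj|rj] := leP (r j) 0.
  apply: lt_le_trans (opnorm_ge0 bc); move: rj; rewrite /r -/z; lra.
have [u [v big]] := normB j jn rj.
have big' : r j * Num.sqrt (gram2 (flip u)) * Num.sqrt (gram2 (flip v)) <
    modulus (pairing (compress pi P) (compress sigma Q) (s j) (flip u) (flip v)).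
  by rewrite !gram2_flip -(pairing_flip (compress pi P)) !flipK.
have := compress_norm_gt ht rPi Pit pPQ PQt big'.
set U := tensor_sum th (flip u) => hU.
have hb := opnorm_bound bc U; rewrite /= in hb.
rewrite ltNge; apply/negP => le.
have h1 : PQ (Pi z (PQ U)) = PQ (Pi (c j) (PQ U)) - PQ (Pi (c j - z) (PQ U)).
  by rewrite cz (linear_opD lPQ) addrAC subrr add0r.
have h2 := rnormD (PQ (Pi (c j) (PQ U))) (- PQ (Pi (c j - z) (PQ U))).
rewrite -h1 rnormN in h2.
have h3 := le_trans (PQ1 _) (small (PQ U)); have h4 := PQ1 U.
have h5 := rnorm_ge0 U.
move: hU; rewrite /r -/z => hU; nra.
Qed.
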